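(* Let $f:\mathbb{D}\to\mathbb{P}$ be meromorphic with $\mathbb{A}_S(f(\mathbb{D}))<\infty$. For any $\theta\in\mathbb{R}$ and $\rho_0>0$, let $L_S(\rho_0)=\int_0^{\rho_0}\|f'(\gamma(t))\|_{H\to S}\,dt$, where $\gamma(t)=\tanh(\frac{t}{2})e^{i\theta}$; this is the spherical length of the image under $f$ of the radial segment of hyperbolic length $\rho_0$ from $0$ in direction $\theta$. Then $$L_S(\rho_0)=o(\rho_0^{1/2})\quad\text{as }\rho_0\to\infty.$$
   Context: $\mathbb{D}=\{|z|<1\}$ carries the hyperbolic metric with density $\lambda_H(z)=2/(1-|z|^2)$. $\mathbb{P}=\mathbb{C}\cup\{\infty\}$ carries the spherical metric with density $\lambda_S(w)=2/(1+|w|^2)$. $\|f'(z)\|_{H\to S}=\frac{2|f'(z)|}{1+|f(z)|^2}\cdot\frac{1-|z|^2}{2}$ (extended continuously at poles). $\mathbb{A}_S(f(\mathbb{D}))=\int_{\mathbb{D}}|f'(z)|^2\lambda_S(f(z))^2\,dx\,dy$ is the spherical area of the image counting multiplicity. *)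

(* Defs.v *)
From Stdlib Require Import Reals Lra.
Open Scope R_scope.

Definition Cx : Type := (R * R)%type.
Definition Cadd (a b : Cx) : Cx := (fst a + fst b, snd a + snd b).
Definition Csub (a b : Cx) : Cx := (fst a - fst b, snd a - snd b).
Definition Cmul (a b : Cx) : Cx :=
  (fst a * fst b - snd a * snd b, fst a * snd b + snd a * fst b).
Definition Cinv (a : Cx) : Cx :=
  (fst a / (fst a ^ 2 + snd a ^ 2), - snd a / (fst a ^ 2 + snd a ^ 2)).
Definition Cmod (a : Cx) : R := sqrt (fst a ^ 2 + snd a ^ 2).

Definition in_disk (z : Cx) : Prop := Cmod z < 1.

Definition has_cderiv (F : Cx -> Cx) (z d : Cx) : Prop :=
  forall eps, 0 < eps -> exists del, 0 < del /\
    forall h, 0 < Cmod h < del ->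
      Cmod (Csub (Csub (F (Cadd z h)) (F z)) (Cmul d h)) <= eps * Cmod h.

Definition holo_on_ball (g : Cx -> Cx) (z0 : Cx) (r : R) : Prop :=
  forall w, Cmod (Csub w z0) < r -> exists d, has_cderiv g w d.

(* points of the Riemann sphere P = C ∪ {∞}: Some w = w, None = ∞ *)
Definition recip (u : Cx) : option Cx :=
  if Req_EM_T (fst u) 0 then
    (if Req_EM_T (snd u) 0 then None else Some (Cinv u))
  else Some (Cinv u).

(* f : D -> P is meromorphic: near every point of D, either f or 1/f is a
   holomorphic Cx-valued function (local charts of P). *)
Definition meromorphic_disk (f : Cx -> option Cx) : Prop :=
  forall z0, in_disk z0 -> exists (r : R) (g : Cx -> Cx),
    0 < r /\ (forall w, Cmod (Csub w z0) < r -> in_disk w) /\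
    holo_on_ball g z0 r /\
    ((forall w, Cmod (Csub w z0) < r -> f w = Some (g w)) \/
     (forall w, Cmod (Csub w z0) < r -> f w = recip (g w))).

(* finite part of f (value 0 at poles; only used at non-poles) *)
Definition fin (f : Cx -> option Cx) (w : Cx) : Cx :=
  match f w with Some u => u | None => (0, 0) end.

(* s = ||f'||_{H->S} on D: given by the formula at non-poles and extended
   continuously (within D) at the poles. *)
Definition is_HS_norm (f : Cx -> option Cx) (s : Cx -> R) : Prop :=
  (forall z w d, in_disk z -> f z = Some w -> has_cderiv (fin f) z d ->
     s z = 2 * Cmod d / (1 + Cmod w ^ 2) * ((1 - Cmod z ^ 2) / 2)) /\
  (forall z, in_disk z -> f z = None ->
     forall eps, 0 < eps -> exists del, 0 < del /\
       forall w, in_disk w -> Cmod (Csub w z) < del -> Rabs (s w - s z) < eps).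

Definition Rint (g : R -> R) (a b v : R) : Prop :=
  exists pr : Riemann_integrable g a b, RiemannInt pr = v.

(* A_S(f(D)) = \int_D |f'|^2 lambda_S(f)^2 dx dy < infinity.
   Note |f'(z)| lambda_S(f(z)) = s z * lambda_H z with lambda_H z = 2/(1-|z|^2).
   The integrand is continuous and nonnegative on D, so the (Lebesgue) integral
   is finite iff the polar iterated integrals over the disks |z| <= r < 1
   are uniformly bounded. *)
Definition finite_sph_area (s : Cx -> R) : Prop :=
  exists M, forall r, 0 < r < 1 -> exists I : R -> R,
    (forall rho, 0 <= rho <= r ->
       Rint (fun phi => (s (rho * cos phi, rho * sin phi) * (2 / (1 - rho ^ 2))) ^ 2 * rho)
            0 (2 * PI) (I rho)) /\
    exists v, Rint I 0 r v /\ v <= M.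

Definition tanh (x : R) : R := (exp x - exp (- x)) / (exp x + exp (- x)).

Definition gamma (theta t : R) : Cx :=
  (tanh (t / 2) * cos theta, tanh (t / 2) * sin theta).

(* Main.v *)
(* In the coordinate [z = exp (x + i y)] annuli become rectangles; with
   [S = |(f o exp)'| / (1 + |f o exp|^2)] the spherical area density is [4 S^2] and
   [s (exp w) = S w (1 - |exp w|^2) / |exp w|]. The key is an epsilon-regularity estimate: if the
   area [E] over a square of half-side [r] is small, then [r^2 S^2 <= C E] at its centre. To see it,
   choose a point where (distance to the boundary) * [S] is almost maximal. Around it [S] is bounded at
   its own scale, so the image of a smaller square lies in a hemisphere, and after a rotation of the
   sphere the mean value inequality for the derivative of a holomorphic function applies.
   On the ray with hyperbolic parameter [t] this gives [s^2 <= C (B (t + 1) - B (t - 1))], where [B t]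
   is the area over the disk of hyperbolic radius [t], up to constants. The integral of the right-hand
   side over [T, oo) tends to 0 as [T] grows, and the Cauchy-Schwarz inequality concludes. *)

(* Smallness of the area is essential to the pointwise estimate: the maps [u -> n u] have derivative
   [n] at [0], yet each covers at most one sphere. Positive curvature spoils the mean value
   inequality for [S ^ 2]; only where the image stays in a hemisphere is [S] comparable with the
   derivative of a holomorphic function. The tail of a finite area is small, so the estimate holds
   far out on the ray, and the initial part of the ray is a constant absorbed by [sqrt rho0].
   Holomorphy is given as mere differentiability at each point. Continuity of [S], on which every
   integral here depends, therefore rests on Goursat's lemma and Cauchy's formula. The contours are
   squares because their sides, moved parallel to themselves, sweep out iterated integrals in [x]
   and [y]. At a pole [is_HS_norm] determines [s] by continuity alone, so the formula for [s] has to
   be carried there from nearby points that are not poles. Unique continuation along a segment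
   provides them, starting from one point where [f] is finite; for [f] constantly infinite, [s]
   would be an arbitrary continuous function. *)
Require Import Defs.
From Stdlib Require Import Reals Lra Lia Classical ClassicalEpsilon.
From Coquelicot Require Import Coquelicot.
Open Scope R_scope.

(** * Complex differentiability *)

(* [ring] and [field] look for their structure at the syntactic type [C]. *)
Ltac cring := match goal with |- @eq _ ?a ?b => change (@eq C a b) end; ring.
Ltac cfield := match goal with |- @eq _ ?a ?b => change (@eq C a b) end; field.

Lemma Rabs_re_le (z : C) : Rabs (fst z) <= Cmod z.
Proof. exact (Rle_trans _ _ _ (Rmax_l _ _) (Rmax_Cmod z)). Qed.

Lemma Rabs_im_le (z : C) : Rabs (snd z) <= Cmod z.
Proof. exact (Rle_trans _ _ _ (Rmax_r _ _) (Rmax_Cmod z)). Qed.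

Lemma Cmod_le_Rabs (z : C) : Cmod z <= Rabs (fst z) + Rabs (snd z).
Proof.
  assert (H1 := Rabs_pos (fst z)). assert (H2 := Rabs_pos (snd z)).
  unfold Cmod. rewrite <- (sqrt_Rsqr (Rabs (fst z) + Rabs (snd z))) by lra.
  apply sqrt_le_1_alt.
  rewrite <- (pow2_abs (fst z)), <- (pow2_abs (snd z)). unfold Rsqr. nra.
Qed.

Lemma Cmod_sqr (z : C) : Cmod z ^ 2 = fst z ^ 2 + snd z ^ 2.
Proof. unfold Cmod. apply pow2_sqrt. nra. Qed.

Lemma Cmod_minus_sym (z w : C) : Cmod (z - w) = Cmod (w - z).
Proof. rewrite <- Cmod_opp. f_equal. ring. Qed.

(** Balls of the product uniform structure are squares, while [has_cderiv] is stated with [Cmod];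
    squares and discs are nested up to a factor [2]. *)
Lemma locally_C_iff (z : C) (P : C -> Prop) :
  locally z P <-> exists d, 0 < d /\ forall w : C, Cmod (w - z) < d -> P w.
Proof.
  split.
  - intros [d H]. exists d. split; [apply cond_pos|]. intros w Hw. apply H.
    split; eapply Rle_lt_trans; [exact (Rabs_re_le (w - z))| exact Hw | exact (Rabs_im_le (w - z)) | exact Hw].
  - intros [d [Hd H]]. assert (Hd2 : 0 < d / 2) by lra. exists (mkposreal _ Hd2).
    intros w [H1 H2]. apply H. eapply Rle_lt_trans; [apply Cmod_le_Rabs|].
    change (Rabs (fst w - fst z) < d / 2) in H1.
    change (Rabs (snd w - snd z) < d / 2) in H2. simpl. unfold Rminus in *. lra.
Qed.

Lemma locally_C_imp (z : C) (P Q : C -> Prop) :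
  (forall w : C, P w -> Q w) -> locally z P -> locally z Q.
Proof. intros H. apply filter_imp. exact H. Qed.

Lemma locally_C_forall (z : C) (P : C -> Prop) : (forall w : C, P w) -> locally z P.
Proof. intros H. apply filter_forall. exact H. Qed.

Lemma continuous_C_iff (U : UniformSpace) (f : U -> C) (z : U) :
  continuous f z <->
  continuous (fun w => fst (f w)) z /\ continuous (fun w => snd (f w)) z.
Proof.
  split.
  - intros H; split.
    + apply (continuous_comp f fst); [exact H|]. destruct (f z). apply continuous_fst.
    + apply (continuous_comp f snd); [exact H|]. destruct (f z). apply continuous_snd.
  - intros [H1 H2] P [d HP].
    assert (A1 := H1 _ (locally_ball (fst (f z)) d)).
    assert (A2 := H2 _ (locally_ball (snd (f z)) d)).
    unfold filtermap in *. generalize (filter_and _ _ A1 A2). apply filter_imp.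
    intros w [B1 B2]. apply HP. split; assumption.
Qed.

Lemma continuous_R_eps (f : C -> R) (z : C) :
  continuous f z <->
  forall e, 0 < e -> exists d, 0 < d /\ forall w : C, Cmod (w - z) < d -> Rabs (f w - f z) < e.
Proof.
  split.
  - intros H e He. apply (locally_C_iff z (fun w => Rabs (f w - f z) < e)).
    apply (H (fun y => Rabs (y - f z) < e)). exists (mkposreal e He). intros y Hy. exact Hy.
  - intros H P [d HP]. destruct (H d (cond_pos d)) as [e He].
    apply (locally_C_iff z (fun w => P (f w))). exists e. split; [tauto|].
    intros w Hw. apply HP. apply He, Hw.
Qed.

Lemma continuous_C_eps (f : C -> C) (z : C) :
  continuous f z <->
  forall e, 0 < e -> exists d, 0 < d /\ forall w : C, Cmod (w - z) < d -> Cmod (f w - f z) < e.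
Proof.
  split.
  - intros H e He. apply (locally_C_iff z (fun w => Cmod (f w - f z) < e)).
    apply (H (fun y => Cmod (y - f z) < e)). apply locally_C_iff. exists e. split; [lra|].
    intros w Hw; exact Hw.
  - intros H. apply continuous_C_iff. split; apply continuous_R_eps; intros e He;
    destruct (H e He) as [d [Hd H']]; exists d; (split; [exact Hd|]); intros w Hw;
    (eapply Rle_lt_trans; [|apply (H' w Hw)]); [apply (Rabs_re_le (f w - f z))|apply (Rabs_im_le (f w - f z))].
Qed.

Section Rules.
Context {U : UniformSpace}.
Implicit Types f g : U -> C.

Lemma continuous_Cplus f g z : continuous f z -> continuous g z ->
  continuous (fun w => (f w + g w)%C) z.
Proof.
  intros F G. apply continuous_C_iff in F. apply continuous_C_iff in G. apply continuous_C_iff.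
  simpl. split; apply (@continuous_plus _ R_AbsRing R_NormedModule); tauto.
Qed.

Lemma continuous_Copp f z : continuous f z -> continuous (fun w => (- f w)%C) z.
Proof.
  intros F. apply continuous_C_iff in F. apply continuous_C_iff.
  simpl. split; apply (@continuous_opp _ R_AbsRing R_NormedModule); tauto.
Qed.

Lemma continuous_Cminus f g z : continuous f z -> continuous g z ->
  continuous (fun w => (f w - g w)%C) z.
Proof. intros F G. apply continuous_Cplus; [exact F|apply continuous_Copp, G]. Qed.

Lemma continuous_Cmult f g z : continuous f z -> continuous g z ->
  continuous (fun w => (f w * g w)%C) z.
Proof.
  intros F G. apply continuous_C_iff in F. apply continuous_C_iff in G. apply continuous_C_iff.
  simpl. split; [apply (@continuous_minus _ R_AbsRing R_NormedModule)|apply (@continuous_plus _ R_AbsRing R_NormedModule)];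
    apply (@continuous_mult _ R_AbsRing); tauto.
Qed.

Lemma continuous_Cmod f z : continuous f z -> continuous (fun w => Cmod (f w)) z.
Proof.
  intros F. apply (continuous_comp f Cmod); [exact F|]. apply continuous_R_eps.
  intros e He. exists e. split; [exact He|]. intros w Hw.
  eapply Rle_lt_trans; [|exact Hw]. apply Rabs_le_between'.
  assert (A := Cmod_triangle (w - f z) (f z)). assert (B := Cmod_triangle (f z - w) w).
  rewrite (Cmod_minus_sym (f z) w) in B.
  replace (w - f z + f z)%C with w in A by ring.
  replace (f z - w + w)%C with (f z) in B by ring. lra.
Qed.

Lemma continuous_Rdiv (f g : U -> R) z : continuous f z -> continuous g z -> g z <> 0 ->
  continuous (fun w => f w / g w) z.
Proof.
  intros F G Hz. apply (@continuous_mult _ R_AbsRing); [exact F|].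
  apply (continuous_comp g Rinv); [exact G|].
  apply (@ex_derive_continuous R_AbsRing R_NormedModule). auto_derive. exact Hz.
Qed.

Lemma continuous_Cinv f z : continuous f z -> f z <> 0 -> continuous (fun w => (/ f w)%C) z.
Proof.
  intros F Hz. assert (N : fst (f z) ^ 2 + snd (f z) ^ 2 <> 0).
  { rewrite <- Cmod_sqr. apply pow_nonzero. apply Cmod_gt_0 in Hz. lra. }
  apply continuous_C_iff in F. destruct F as [F1 F2].
  assert (G : continuous (fun w => fst (f w) ^ 2 + snd (f w) ^ 2) z).
  { assert (P : forall h : U -> R, continuous h z -> continuous (fun w => h w ^ 2) z).
    { intros h Hh. apply (continuous_comp h (fun x => x ^ 2)); [exact Hh|].
      apply (@ex_derive_continuous R_AbsRing R_NormedModule). auto_derive. auto. }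
    apply (@continuous_plus _ R_AbsRing R_NormedModule (fun w => fst (f w) ^ 2) (fun w => snd (f w) ^ 2)); auto. }
  apply continuous_C_iff. simpl fst; simpl snd.
  split; apply continuous_Rdiv; auto. apply (@continuous_opp _ R_AbsRing R_NormedModule). exact F2.
Qed.

Lemma continuous_Cdiv f g z : continuous f z -> continuous g z -> g z <> 0 ->
  continuous (fun w => (f w / g w)%C) z.
Proof. intros F G H. apply continuous_Cmult; [exact F|apply continuous_Cinv; assumption]. Qed.
End Rules.

Lemma Ceq_dec (z w : C) : {z = w} + {z <> w}.
Proof.
  destruct z as [a b], w as [c d].
  destruct (Req_EM_T a c) as [->|H]; [destruct (Req_EM_T b d) as [->|H]|].
  - left; reflexivity.
  - right; congruence.
  - right; congruence.
Qed.

(* Caratheodory's form of the derivative. *)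
Lemma has_cderiv_iff (F : C -> C) (z d : C) :
  has_cderiv F z d <->
  exists phi : C -> C, phi z = d /\ continuous phi z /\
    locally z (fun w => F w = (F z + phi w * (w - z))%C).
Proof.
  split.
  - intros H. exists (fun w => if Ceq_dec w z then d else ((F w - F z) / (w - z))%C).
    split; [destruct (Ceq_dec z z); congruence|]. split.
    + apply continuous_C_eps. intros e He. assert (He2 : 0 < e / 2) by lra.
      destruct (H _ He2) as [del [Hd H']]. exists del. split; [exact Hd|].
      intros w Hw. destruct (Ceq_dec z z) as [_|]; [|congruence].
      destruct (Ceq_dec w z) as [->|Hne].
      { replace (d - d)%C with (RtoC 0) by ring. rewrite Cmod_0. lra. }
      assert (N : (w - z)%C <> 0). { intros E. apply Hne. replace w with (w - z + z)%C by ring. rewrite E. ring. }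
      assert (Hp := proj1 (Cmod_gt_0 _) N).
      specialize (H' (w - z)%C (conj Hp Hw)).
      change (Cmod (F (z + (w - z)) - F z - d * (w - z))%C <= e / 2 * Cmod (w - z)%C) in H'.
      replace (z + (w - z))%C with w in H' by ring.
      replace ((F w - F z) / (w - z) - d)%C with ((F w - F z - d * (w - z)) / (w - z))%C by (field; exact N).
      rewrite Cmod_div by exact N. apply Rle_lt_trans with (e / 2); [|lra].
      apply Rle_div_l; assumption.
    + apply filter_forall. intros w. destruct (Ceq_dec w z) as [->|Hne]; [ring|].
      field. intros E. apply Hne. replace w with (w - z + z)%C by ring. rewrite E. ring.
  - intros [phi [E [Hc HF]]] e He.
    apply locally_C_iff in HF. destruct HF as [d1 [Hd1 HF]].
    destruct (proj1 (continuous_C_eps _ _) Hc e He) as [d2 [Hd2 H2]].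
    exists (Rmin d1 d2). split; [apply Rmin_pos; assumption|].
    enough (A : forall h : C, 0 < Cmod h < Rmin d1 d2 ->
      Cmod (F (z + h) - F z - d * h)%C <= e * Cmod h) by exact A.
    intros h [_ Hh].
    assert (Hh1 := Rlt_le_trans _ _ _ Hh (Rmin_l _ _)).
    assert (Hh2 := Rlt_le_trans _ _ _ Hh (Rmin_r _ _)).
    specialize (HF (z + h)%C). specialize (H2 (z + h)%C).
    replace (z + h - z)%C with h in * by ring.
    rewrite (HF Hh1).
    replace (F z + phi (z + h) * h - F z - d * h)%C with ((phi (z + h)%C - phi z) * h)%C
      by (rewrite E; ring).
    rewrite Cmod_mult. apply Rmult_le_compat_r; [apply Cmod_ge_0|]. left. apply H2, Hh2.
Qed.

Lemma continuous_Cid (z : C) : continuous (fun w : C => w) z.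
Proof. apply continuous_id. Qed.

Lemma has_cderiv_continuous (F : C -> C) (z d : C) : has_cderiv F z d -> continuous F z.
Proof.
  intros H. apply has_cderiv_iff in H. destruct H as [phi [_ [Hc HF]]].
  apply continuous_ext_loc with (g := fun w => (F z + phi w * (w - z))%C).
  - revert HF. apply locally_C_imp. auto.
  - apply continuous_Cplus; [apply continuous_const|].
    apply continuous_Cmult; [exact Hc|]. apply continuous_Cminus; [apply continuous_Cid|apply continuous_const].
Qed.

Lemma has_cderiv_ext_loc (F G : C -> C) (z d : C) :
  locally z (fun w => F w = G w) -> has_cderiv F z d -> has_cderiv G z d.
Proof.
  intros E H. apply has_cderiv_iff in H. destruct H as [phi [Ed [Hc HF]]].
  apply has_cderiv_iff. exists phi. repeat split; try assumption.
  assert (Ez := locally_singleton _ _ E). generalize (filter_and _ _ E HF).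
  apply locally_C_imp. intros w [E1 E2]. rewrite <- E1, E2, Ez. reflexivity.
Qed.

Lemma has_cderiv_const (c z : C) : has_cderiv (fun _ => c) z (RtoC 0).
Proof.
  apply has_cderiv_iff. exists (fun _ => RtoC 0). repeat split.
  - apply continuous_const.
  - apply locally_C_forall. intros w. cring.
Qed.

Lemma has_cderiv_id (z : C) : has_cderiv (fun w => w) z (RtoC 1).
Proof.
  apply has_cderiv_iff. exists (fun _ => RtoC 1). repeat split.
  - apply continuous_const.
  - apply locally_C_forall. intros w. cring.
Qed.

Lemma has_cderiv_plus (F G : C -> C) (z a b : C) :
  has_cderiv F z a -> has_cderiv G z b -> has_cderiv (fun w => (F w + G w)%C) z (a + b)%C.
Proof.
  intros HF HG. apply has_cderiv_iff in HF. apply has_cderiv_iff in HG.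
  destruct HF as [p [Ep [Cp HF]]]. destruct HG as [q [Eq [Cq HG]]].
  apply has_cderiv_iff. exists (fun w => (p w + q w)%C). repeat split.
  - congruence.
  - apply continuous_Cplus; assumption.
  - generalize (filter_and _ _ HF HG). apply locally_C_imp. intros w [-> ->]. cring.
Qed.

Lemma has_cderiv_mult (F G : C -> C) (z a b : C) :
  has_cderiv F z a -> has_cderiv G z b ->
  has_cderiv (fun w => (F w * G w)%C) z (a * G z + F z * b)%C.
Proof.
  intros HF HG. assert (CG := has_cderiv_continuous _ _ _ HG).
  apply has_cderiv_iff in HF. apply has_cderiv_iff in HG.
  destruct HF as [p [Ep [Cp HF]]]. destruct HG as [q [Eq [Cq HG]]].
  apply has_cderiv_iff. exists (fun w => (p w * G w + F z * q w)%C). repeat split.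
  - congruence.
  - apply continuous_Cplus; apply continuous_Cmult; try assumption. apply continuous_const.
  - generalize (filter_and _ _ HF HG). apply locally_C_imp. intros w [-> ->]. cring.
Qed.

Lemma has_cderiv_comp (F G : C -> C) (z a b : C) :
  has_cderiv F (G z) a -> has_cderiv G z b -> has_cderiv (fun w => F (G w)) z (a * b)%C.
Proof.
  intros HF HG. assert (CG := has_cderiv_continuous _ _ _ HG).
  apply has_cderiv_iff in HF. apply has_cderiv_iff in HG.
  destruct HF as [p [Ep [Cp HF]]]. destruct HG as [q [Eq [Cq HG]]].
  apply has_cderiv_iff. exists (fun w => (p (G w) * q w)%C). repeat split.
  - congruence.
  - apply continuous_Cmult; [|assumption]. apply continuous_comp; assumption.
  - assert (HFG : locally z (fun w : C => F (G w) = (F (G z) + p (G w) * (G w - G z))%C)) by exact (CG _ HF).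
    generalize (filter_and _ _ HFG HG). apply locally_C_imp. intros w [E1 E2].
    rewrite E1. rewrite E2 at 2. cring.
Qed.

Lemma continuous_neq0 (G : C -> C) (z : C) :
  continuous G z -> G z <> 0 -> locally z (fun w => G w <> 0).
Proof.
  intros H Hz. assert (Hp := proj1 (Cmod_gt_0 _) Hz).
  destruct (proj1 (continuous_C_eps _ _) H _ Hp) as [d [Hd H']].
  apply locally_C_iff. exists d. split; [exact Hd|]. intros w Hw E. specialize (H' w Hw).
  rewrite E in H'. replace (0 - G z)%C with (- G z)%C in H' by cring. rewrite Cmod_opp in H'. lra.
Qed.

Lemma has_cderiv_inv (G : C -> C) (z b : C) :
  has_cderiv G z b -> G z <> 0 ->
  has_cderiv (fun w => (/ G w)%C) z (- b / (G z * G z))%C.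
Proof.
  intros HG Hz. assert (CG := has_cderiv_continuous _ _ _ HG).
  apply has_cderiv_iff in HG. destruct HG as [q [Eq [Cq HG]]].
  apply has_cderiv_iff. exists (fun w => (- q w / (G w * G z))%C). repeat split.
  - congruence.
  - apply continuous_Cdiv.
    + apply continuous_Copp, Cq.
    + apply continuous_Cmult; [exact CG|apply continuous_const].
    + apply Cmult_neq_0; assumption.
  - generalize (filter_and _ _ (continuous_neq0 _ _ CG Hz) HG). apply locally_C_imp.
    intros w [E1 E2]. replace (- q w / (G w * G z) * (w - z))%C with (- (G w - G z) / (G w * G z))%C.
    + cfield. split; assumption.
    + rewrite E2 at 1. cfield. split; assumption.
Qed.

Lemma has_cderiv_minus (F G : C -> C) (z a b : C) :
  has_cderiv F z a -> has_cderiv G z b -> has_cderiv (fun w => (F w - G w)%C) z (a - b)%C.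
Proof.
  intros HF HG.
  assert (H := has_cderiv_plus _ _ _ _ _ HF (has_cderiv_mult _ _ _ _ _ (has_cderiv_const (- (1))%C z) HG)).
  cbv beta in H.
  replace (a - b)%C with (a + (0 * G z + - (1) * b))%C by cring.
  revert H. apply has_cderiv_ext_loc. apply locally_C_forall. intros w. cring.
Qed.

Lemma has_cderiv_div (F G : C -> C) (z a b : C) :
  has_cderiv F z a -> has_cderiv G z b -> G z <> 0 ->
  has_cderiv (fun w => (F w / G w)%C) z ((a * G z - F z * b) / (G z * G z))%C.
Proof.
  intros HF HG Hz.
  assert (H := has_cderiv_mult _ _ _ _ _ HF (has_cderiv_inv _ _ _ HG Hz)). cbv beta in H.
  replace ((a * G z - F z * b) / (G z * G z))%C with (a * / G z + F z * (- b / (G z * G z)))%C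
    by (cfield; exact Hz).
  exact H.
Qed.

Lemma has_cderiv_unique (F : C -> C) (z a b : C) :
  has_cderiv F z a -> has_cderiv F z b -> a = b.
Proof.
  intros Ha Hb. destruct (Ceq_dec a b) as [|Hne]; [assumption|exfalso].
  assert (N : (a - b)%C <> 0).
  { intros E. apply Hne. replace a with (a - b + b)%C by cring. rewrite E. cring. }
  apply Cmod_gt_0 in N. assert (He : 0 < Cmod (a - b) / 3) by lra.
  destruct (Ha _ He) as [d1 [Hd1 H1]]. destruct (Hb _ He) as [d2 [Hd2 H2]].
  set (t := Rmin d1 d2 / 2). assert (Ht : 0 < t) by (unfold t; generalize (Rmin_pos _ _ Hd1 Hd2); lra).
  assert (Et : Cmod (RtoC t) = t) by (rewrite Cmod_R; apply Rabs_pos_eq; lra).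
  assert (T1 : 0 < Cmod (RtoC t) < d1).
  { rewrite Et. split; [lra|]. generalize (Rmin_l d1 d2). unfold t in *. lra. }
  assert (T2 : 0 < Cmod (RtoC t) < d2).
  { rewrite Et. split; [lra|]. generalize (Rmin_r d1 d2). unfold t in *. lra. }
  specialize (H1 _ T1). specialize (H2 _ T2).
  change (Cmod (F (z + t) - F z - a * t)%C <= Cmod (a - b) / 3 * Cmod t) in H1.
  change (Cmod (F (z + t) - F z - b * t)%C <= Cmod (a - b) / 3 * Cmod t) in H2.
  assert (T := Cmod_triangle (F (z + t) - F z - b * t)%C (- (F (z + t) - F z - a * t))%C).
  rewrite Cmod_opp in T.
  replace (F (z + t) - F z - b * t + - (F (z + t) - F z - a * t))%C with ((a - b) * t)%C in T by cring.
  rewrite Cmod_mult in T. rewrite Et in *. nra.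
Qed.

(** * The complex exponential *)

Definition cexp (z : C) : C := (exp (fst z) * cos (snd z), exp (fst z) * sin (snd z)).

Lemma cexp_plus (z w : C) : cexp (z + w)%C = (cexp z * cexp w)%C.
Proof.
  unfold cexp. simpl. rewrite exp_plus, cos_plus, sin_plus. apply injective_projections; simpl; ring.
Qed.

Lemma Cmod_cexp (z : C) : Cmod (cexp z) = exp (fst z).
Proof.
  unfold cexp, Cmod; simpl fst; simpl snd.
  replace ((exp (fst z) * cos (snd z)) ^ 2 + (exp (fst z) * sin (snd z)) ^ 2)
    with (Rsqr (exp (fst z)) * (Rsqr (sin (snd z)) + Rsqr (cos (snd z)))) by (unfold Rsqr; ring).
  rewrite sin2_cos2, Rmult_1_r. apply sqrt_Rsqr. left. apply exp_pos.
Qed.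

Lemma is_derive_slope (f : R -> R) (l : R) (e : R) :
  is_derive f 0 l -> 0 < e -> exists d, 0 < d /\ forall t, Rabs t < d -> Rabs (f t - f 0 - l * t) <= e * Rabs t.
Proof.
  intros H He. apply is_derive_Reals in H. destruct (H e He) as [d Hd].
  exists d. split; [apply cond_pos|]. intros t Ht. destruct (Req_dec t 0) as [->|Ht0].
  - replace (f 0 - f 0 - l * 0) with 0 by ring. rewrite Rabs_R0. lra.
  - specialize (Hd t Ht0 Ht). rewrite Rplus_0_l in Hd.
    replace (f t - f 0 - l * t) with (((f t - f 0) / t - l) * t) by (field; exact Ht0).
    rewrite Rabs_mult. apply Rmult_le_compat_r; [apply Rabs_pos|]. lra.
Qed.

Lemma has_cderiv_cexp (z : C) : has_cderiv cexp z (cexp z).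
Proof.
  (* The origin suffices: [cexp_plus] carries the estimate to [z] with a factor [Cmod (cexp z)].
     With [exp a <= 3], the error terms add up to at most nine tenths of [e * Cmod h]. *)
  assert (H0 : forall e, 0 < e -> exists d, 0 < d /\ forall h : C, Cmod h < d ->
    Cmod (cexp h - 1 - h) <= e * Cmod h).
  { intros e He. assert (He8 : 0 < e / 10) by lra.
    destruct (is_derive_slope exp 1 (e/10)) as [d1 [D1 H1]]; [auto_derive; [auto|]; rewrite exp_0; ring|lra|].
    destruct (is_derive_slope sin 1 (e/10)) as [d2 [D2 H2]]; [auto_derive; [auto|]; rewrite cos_0; ring|lra|].
    destruct (is_derive_slope cos 0 (e/10)) as [d3 [D3 H3]]; [auto_derive; [auto|]; rewrite sin_0; ring|lra|].
    rewrite exp_0 in H1. rewrite sin_0 in H2. rewrite cos_0 in H3.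
    set (d := Rmin (Rmin d1 d2) (Rmin d3 (Rmin 1 (e / 10)))).
    assert (L : d <= d1 /\ d <= d2 /\ d <= d3 /\ d <= 1 /\ d <= e / 10).
    { unfold d, Rmin. repeat destruct Rle_dec; repeat split; lra. }
    exists d. split. { unfold d; repeat apply Rmin_pos; lra. }
    intros [a b] Hh. assert (Ha := Rabs_re_le (a, b)). assert (Hb := Rabs_im_le (a, b)).
    simpl in Ha, Hb. destruct L as [L1 [L2 [L3 [L4 L5]]]].
    specialize (H1 a ltac:(lra)). specialize (H2 b ltac:(lra)). specialize (H3 b ltac:(lra)).
    assert (E3 : exp a <= 3). { apply Rle_trans with (exp 1); [|apply exp_le_3].
      left. apply exp_increasing. apply Rle_lt_trans with (Rabs a); [apply Rle_abs|lra]. }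
    assert (E0 := exp_pos a).
    eapply Rle_trans; [apply Cmod_le_Rabs|].
    simpl.
    replace (exp a * cos b + -(1) + - a) with (exp a * (cos b - 1 - 0 * b) + (exp a - 1 - 1 * a)) by ring.
    replace (exp a * sin b + -0 + - b) with (exp a * (sin b - 0 - 1 * b) + ((exp a - 1 - 1 * a) * b + a * b)) by ring.
    assert (P1 := Rabs_pos a). assert (P2 := Rabs_pos b).
    assert (A1 : Rabs (exp a * (cos b - 1 - 0 * b)) <= 3 * (e / 10 * Rabs b)).
    { rewrite Rabs_mult, (Rabs_pos_eq (exp a)) by lra. apply Rmult_le_compat; try lra. apply Rabs_pos. }
    assert (A2 : Rabs (exp a * (sin b - 0 - 1 * b)) <= 3 * (e / 10 * Rabs b)).
    { rewrite Rabs_mult, (Rabs_pos_eq (exp a)) by lra. apply Rmult_le_compat; try lra. apply Rabs_pos. }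
    assert (A3 : Rabs ((exp a - 1 - 1 * a) * b) <= e / 10 * Rabs a).
    { rewrite Rabs_mult. assert (Q := Rabs_pos (exp a - 1 - 1 * a)). nra. }
    assert (A4 : Rabs (a * b) <= e / 10 * Rabs b).
    { rewrite Rabs_mult. nra. }
    assert (T1 := Rabs_triang (exp a * (cos b - 1 - 0 * b)) (exp a - 1 - 1 * a)).
    assert (T2 := Rabs_triang (exp a * (sin b - 0 - 1 * b)) ((exp a - 1 - 1 * a) * b + a * b)).
    assert (T3 := Rabs_triang ((exp a - 1 - 1 * a) * b) (a * b)).
    assert (X : e * Rabs a <= e * Cmod (a, b)) by (apply Rmult_le_compat_l; lra).
    assert (Y : e * Rabs b <= e * Cmod (a, b)) by (apply Rmult_le_compat_l; lra).
    assert (Z : 0 <= e * Rabs a) by nra. lra. }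
  intros e He. assert (Hm : 0 < Cmod (cexp z)) by (rewrite Cmod_cexp; apply exp_pos).
  assert (He' : 0 < e / Cmod (cexp z)) by (apply Rdiv_lt_0_compat; assumption).
  destruct (H0 _ He') as [d [Hd H]]. exists d. split; [exact Hd|]. intros h [_ Hh].
  change (Cmod (cexp (z + h) - cexp z - cexp z * h)%C <= e * Cmod h).
  rewrite cexp_plus. replace (cexp z * cexp h - cexp z - cexp z * h)%C with (cexp z * (cexp h - 1 - h))%C by ring.
  rewrite Cmod_mult. replace (e * Cmod h) with (Cmod (cexp z) * (e / Cmod (cexp z) * Cmod h)) by (field; lra).
  apply Rmult_le_compat_l; [lra|]. apply H, Hh.
Qed.

(** * Goursat's lemma *)

(** If [P] failed on the whole rectangle it would fail on a quarter, then on a quarter of that one,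
    and so on; these shrink to a point, where the local hypothesis is contradicted. A subrectangle
    is coded by its corner and a scale [l], so that all have the same shape. Serves both [goursat]
    and the compactness argument in [bounded_on_rect]. *)
Lemma bisection (P : R -> R -> R -> Prop) (x0 y0 w h : R) :
  0 <= w -> 0 <= h ->
  (forall x y l, 0 < l ->
     x0 <= x -> x + l * w <= x0 + w -> y0 <= y -> y + l * h <= y0 + h ->
     P x y (l / 2) -> P (x + l / 2 * w) y (l / 2) ->
     P x (y + l / 2 * h) (l / 2) -> P (x + l / 2 * w) (y + l / 2 * h) (l / 2) -> P x y l) ->
  (forall p q, x0 <= p <= x0 + w -> y0 <= q <= y0 + h ->
     exists d, 0 < d /\ forall x y l, 0 < l < d ->
       x0 <= x -> x + l * w <= x0 + w -> y0 <= y -> y + l * h <= y0 + h ->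
       x <= p <= x + l * w -> y <= q <= y + l * h -> P x y l) ->
  P x0 y0 1.
Proof.
  intros Hw Hh Hstep Hloc. apply NNPP. intros HP.
  set (sub := fun s : R * R * R => let '(x, y, l) := s in
     x0 <= x /\ x + l * w <= x0 + w /\ y0 <= y /\ y + l * h <= y0 + h /\ 0 < l /\ ~ P x y l).
  (* The premise [sub s] stands under the existential so that the choice function [next] is
     total. *)
  assert (Hch : forall s : R * R * R, exists s' : R * R * R, sub s ->
    sub s' /\ fst (fst s) <= fst (fst s') /\ snd (fst s) <= snd (fst s') /\ snd s' = snd s / 2 /\
    fst (fst s') + snd s' * w <= fst (fst s) + snd s * w /\
    snd (fst s') + snd s' * h <= snd (fst s) + snd s * h).
  { intros [[x y] l]. destruct (classic (sub (x, y, l))) as [[H1 [H2 [H3 [H4 [Hl H5]]]]]|Hn].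
    2:{ exists (x, y, l). tauto. }
    assert (M1 : 0 <= l / 2 * w) by (apply Rmult_le_pos; lra).
    assert (M2 : 0 <= l / 2 * h) by (apply Rmult_le_pos; lra).
    destruct (classic (P x y (l / 2))) as [A1|A1].
    2:{ exists (x, y, l / 2). simpl. intros _. repeat split; try lra; assumption. }
    destruct (classic (P (x + l / 2 * w) y (l / 2))) as [A2|A2].
    2:{ exists (x + l / 2 * w, y, l / 2). simpl. intros _. repeat split; try lra; assumption. }
    destruct (classic (P x (y + l / 2 * h) (l / 2))) as [A3|A3].
    2:{ exists (x, y + l / 2 * h, l / 2). simpl. intros _. repeat split; try lra; assumption. }
    destruct (classic (P (x + l / 2 * w) (y + l / 2 * h) (l / 2))) as [A4|A4].
    2:{ exists (x + l / 2 * w, y + l / 2 * h, l / 2). simpl. intros _. repeat split; try lra; assumption. }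
    exfalso. apply H5. apply Hstep; assumption. }
  set (next := fun s => proj1_sig (constructive_indefinite_description _ (Hch s))).
  set (s := fix s n := match n with O => (x0, y0, 1) | S n => next (s n) end).
  assert (Hs : forall n, sub (s n)).
  { induction n as [|n IH].
    - simpl. repeat split; try lra. exact HP.
    - simpl. unfold next. destruct constructive_indefinite_description as [s' Hs']. simpl. apply Hs', IH. }
  assert (Hn : forall n, fst (fst (s n)) <= fst (fst (s (S n))) /\ snd (fst (s n)) <= snd (fst (s (S n))) /\
     snd (s (S n)) = snd (s n) / 2 /\
    fst (fst (s (S n))) + snd (s (S n)) * w <= fst (fst (s n)) + snd (s n) * w /\
    snd (fst (s (S n))) + snd (s (S n)) * h <= snd (fst (s n)) + snd (s n) * h).
  { intros n. assert (H := Hs n). simpl. unfold next.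
    destruct constructive_indefinite_description as [s' Hs']. simpl. apply Hs', H. }
  assert (Hl : forall n, snd (s n) = (1 / 2) ^ n).
  { induction n as [|n IH]; [reflexivity|].
    destruct (Hn n) as [_ [_ [E _]]]. rewrite E, IH. simpl. field. }
  assert (Hpos : forall n, 0 < snd (s n)) by (intros n; rewrite Hl; apply pow_lt; lra).
  (* Nested intervals: left ends increase and right ends decrease, so the supremum of the left ends
     lies in all of them. Applied to each coordinate. *)
  assert (Hlim : forall (u : nat -> R) (W : R), 0 <= W -> (forall n, u n <= u (S n)) ->
    (forall n, u (S n) + snd (s (S n)) * W <= u n + snd (s n) * W) ->
    exists p, forall n, u n <= p <= u n + snd (s n) * W).
  { intros u W HW Hinc Hdec.
    assert (I : forall n k, u n <= u (k + n)%nat).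
    { intros n; induction k as [|k IH]; simpl; [lra|]. specialize (Hinc (k + n)%nat). lra. }
    assert (D : forall n k, u (k + n)%nat + snd (s (k + n)%nat) * W <= u n + snd (s n) * W).
    { intros n; induction k as [|k IH]; [simpl; lra|]. specialize (Hdec (k + n)%nat).
      change (S k + n)%nat with (S (k + n)). lra. }
    assert (B : forall n m, u m <= u n + snd (s n) * W).
    { intros n m. destruct (Nat.le_ge_cases n m) as [L|L].
      - specialize (D n (m - n)%nat). replace (m - n + n)%nat with m in D by lia.
        assert (0 <= snd (s m) * W) by (apply Rmult_le_pos; [left; apply Hpos|exact HW]). lra.
      - specialize (I m (n - m)%nat). replace (n - m + m)%nat with n in I by lia.
        assert (0 <= snd (s n) * W) by (apply Rmult_le_pos; [left; apply Hpos|exact HW]). lra. }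
    destruct (completeness (fun y => exists n, y = u n)) as [p [P1 P2]].
    - exists (u O + snd (s O) * W). intros y [n ->]. apply B.
    - exists (u O), O. reflexivity.
    - exists p. intros n. split; [apply P1; exists n; reflexivity|].
      apply P2. intros y [m ->]. apply B. }
  destruct (Hlim (fun n => fst (fst (s n))) w Hw) as [p Hp]; [intros n; apply Hn|intros n; apply Hn|].
  destruct (Hlim (fun n => snd (fst (s n))) h Hh) as [q Hq]; [intros n; apply Hn|intros n; apply Hn|].
  assert (P0 := Hp O). assert (Q0 := Hq O). simpl in P0, Q0. rewrite Rmult_1_l in P0, Q0.
  destruct (Hloc p q P0 Q0) as [d [Hd H]].
  destruct (pow_lt_1_zero (1 / 2) ltac:(rewrite Rabs_pos_eq; lra) d Hd) as [N HN].
  specialize (HN N (Nat.le_refl N)). rewrite <- Hl in HN.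
  rewrite Rabs_pos_eq in HN by (left; apply Hpos).
  assert (A := Hs N). specialize (Hp N). specialize (Hq N). specialize (Hpos N).
  destruct (s N) as [[x y] l]. simpl in *. apply A. apply H; tauto || lra.
Qed.

(** * Integrals along the sides of rectangles *)

Definition CInt (f : R -> C) (a b : R) : C :=
  (RInt (fun t => fst (f t)) a b, RInt (fun t => snd (f t)) a b).

Definition cont_on {V : UniformSpace} (f : R -> V) (a b : R) := forall t, a <= t <= b -> continuous f t.

Lemma cont_on_sub {V : UniformSpace} (f : R -> V) (a b a' b' : R) :
  cont_on f a b -> a <= a' -> b' <= b -> cont_on f a' b'.
Proof. intros H H1 H2 t Ht. apply H. lra. Qed.

Lemma ex_RInt_cont_on (f : R -> R) (a b : R) : a <= b -> cont_on f a b -> ex_RInt f a b.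
Proof.
  intros Hab H. apply (@ex_RInt_continuous R_CompleteNormedModule). intros t.
  rewrite Rmin_left, Rmax_right by exact Hab. apply H.
Qed.

Lemma cont_on_fst (f : R -> C) (a b : R) : cont_on f a b -> cont_on (fun t => fst (f t)) a b.
Proof. intros H t Ht. exact (proj1 (proj1 (continuous_C_iff _ f t) (H t Ht))). Qed.

Lemma cont_on_snd (f : R -> C) (a b : R) : cont_on f a b -> cont_on (fun t => snd (f t)) a b.
Proof. intros H t Ht. exact (proj2 (proj1 (continuous_C_iff _ f t) (H t Ht))). Qed.

#[local] Hint Resolve cont_on_fst cont_on_snd ex_RInt_cont_on : cint.

Lemma CInt_Chasles (f : R -> C) (a b c : R) : a <= b -> b <= c -> cont_on f a c ->
  CInt f a c = (CInt f a b + CInt f b c)%C.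
Proof.
  intros H1 H2 H.
  assert (A := cont_on_sub f a c a b H (Rle_refl _) H2).
  assert (B := cont_on_sub f a c b c H H1 (Rle_refl _)).
  apply injective_projections; simpl; symmetry;
    apply (@RInt_Chasles R_CompleteNormedModule); auto with cint.
Qed.

Lemma CInt_ext (f g : R -> C) (a b : R) : a <= b -> (forall t, a <= t <= b -> f t = g t) ->
  CInt f a b = CInt g a b.
Proof.
  intros Hab H. apply injective_projections; simpl; apply RInt_ext; intros t;
  rewrite Rmin_left, Rmax_right by exact Hab; intros Ht; rewrite (H t); auto; lra.
Qed.

Lemma CInt_minus (f g : R -> C) (a b : R) : a <= b -> cont_on f a b -> cont_on g a b ->
  CInt (fun t => f t - g t)%C a b = (CInt f a b - CInt g a b)%C.
Proof.
  intros Hab Hf Hg. apply injective_projections; simpl;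
    apply (@RInt_minus R_CompleteNormedModule); auto with cint.
Qed.

Lemma CInt_scal (k : C) (f : R -> C) (a b : R) : a <= b -> cont_on f a b ->
  CInt (fun t => k * f t)%C a b = (k * CInt f a b)%C.
Proof.
  intros Hab Hf.
  assert (A : forall x g, cont_on g a b -> RInt (fun t => x * g t) a b = x * RInt g a b).
  { intros x g Hg. apply (@RInt_scal R_CompleteNormedModule). auto with cint. }
  assert (E : forall x g, cont_on g a b -> ex_RInt (fun t => x * g t) a b).
  { intros x g Hg. apply (@ex_RInt_scal R_CompleteNormedModule). auto with cint. }
  apply injective_projections; simpl; rewrite <- !A by auto with cint.
  - apply (@RInt_minus R_CompleteNormedModule); auto with cint.
  - apply (@RInt_plus R_CompleteNormedModule); auto with cint.
Qed.

Lemma CInt_const (k : C) (a b : R) : CInt (fun _ => k) a b = (RtoC (b - a) * k)%C.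
Proof. unfold CInt. rewrite !RInt_const. apply injective_projections; simpl; unfold scal; simpl; unfold mult; simpl; ring. Qed.

(* The factor 2 comes from estimating the two components separately. *)
Lemma CInt_bound (f : R -> C) (g : R -> R) (a b : R) : a <= b -> cont_on f a b -> ex_RInt g a b ->
  (forall t, a <= t <= b -> Cmod (f t) <= g t) -> Cmod (CInt f a b) <= 2 * RInt g a b.
Proof.
  intros Hab Hf Hg H.
  assert (A : forall u, cont_on u a b -> (forall t, a <= t <= b -> Rabs (u t) <= g t) ->
    Rabs (RInt u a b) <= RInt g a b).
  { intros u Hu Hb. apply (norm_RInt_le (V := R_NormedModule) u g a b); auto.
    - apply (@RInt_correct R_CompleteNormedModule). auto with cint.
    - apply (@RInt_correct R_CompleteNormedModule). auto with cint. }
  eapply Rle_trans; [apply Cmod_le_Rabs|]. simpl.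
  assert (A1 := A (fun t => fst (f t)) (cont_on_fst _ _ _ Hf)).
  assert (A2 := A (fun t => snd (f t)) (cont_on_snd _ _ _ Hf)).
  assert (B1 := A1 (fun t Ht => Rle_trans _ _ _ (Rabs_re_le _) (H t Ht))).
  assert (B2 := A2 (fun t Ht => Rle_trans _ _ _ (Rabs_im_le _) (H t Ht))). lra.
Qed.

(** The counterclockwise contour integral of [q dz]: [dz] is [dx] on the horizontal sides and
    [Ci dy] on the vertical ones. *)
Definition oint (q : C -> C) (a b c d : R) : C :=
  (CInt (fun x => q (x, c)) a b - CInt (fun x => q (x, d)) a b
   + Ci * (CInt (fun y => q (b, y)) c d - CInt (fun y => q (a, y)) c d))%C.

Lemma continuous_horizontal (V : UniformSpace) (q : C -> V) (x c : R) :
  continuous q (x, c) -> continuous (fun x => q (x, c)) x.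
Proof.
  intros H. apply (continuous_comp (fun x : R => ((x, c) : C)) q); [|exact H].
  apply continuous_C_iff; simpl. split; [apply continuous_id|apply continuous_const].
Qed.

Lemma continuous_vertical (V : UniformSpace) (q : C -> V) (x c : R) :
  continuous q (x, c) -> continuous (fun y => q (x, y)) c.
Proof.
  intros H. apply (continuous_comp (fun y : R => ((x, y) : C)) q); [|exact H].
  apply continuous_C_iff; simpl. split; [apply continuous_const|apply continuous_id].
Qed.

Definition hcont {V : UniformSpace} (q : C -> V) (a b c : R) := forall x, a <= x <= b -> continuous q (x, c).
Definition vcont {V : UniformSpace} (q : C -> V) (a c d : R) := forall y, c <= y <= d -> continuous q (a, y).

Lemma hcont_on {V : UniformSpace} (q : C -> V) a b c : hcont q a b c -> cont_on (fun x => q (x, c)) a b.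
Proof. intros H t Ht. apply continuous_horizontal, H, Ht. Qed.

Lemma vcont_on {V : UniformSpace} (q : C -> V) a c d : vcont q a c d -> cont_on (fun y => q (a, y)) c d.
Proof. intros H t Ht. apply continuous_vertical, H, Ht. Qed.

(** The two integrals over the common vertical side cancel as terms, whatever their value, so
    continuity is asked only on the sides that are cut. *)
Lemma oint_split_x (q : C -> C) (a m b c d : R) : a <= m -> m <= b ->
  hcont q a b c -> hcont q a b d -> oint q a b c d = (oint q a m c d + oint q m b c d)%C.
Proof.
  intros H1 H2 A B. unfold oint.
  rewrite (CInt_Chasles (fun x => q (x, c)) a m b H1 H2 (hcont_on _ _ _ _ A)).
  rewrite (CInt_Chasles (fun x => q (x, d)) a m b H1 H2 (hcont_on _ _ _ _ B)). ring.
Qed.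

Lemma oint_split_y (q : C -> C) (a b c m d : R) : c <= m -> m <= d ->
  vcont q a c d -> vcont q b c d -> oint q a b c d = (oint q a b c m + oint q a b m d)%C.
Proof.
  intros H1 H2 A B. unfold oint.
  rewrite (CInt_Chasles (fun y => q (b, y)) c m d H1 H2 (vcont_on _ _ _ _ B)).
  rewrite (CInt_Chasles (fun y => q (a, y)) c m d H1 H2 (vcont_on _ _ _ _ A)). ring.
Qed.

Definition bcont {V : UniformSpace} (q : C -> V) a b c d :=
  hcont q a b c /\ hcont q a b d /\ vcont q a c d /\ vcont q b c d.

Lemma oint_minus (p q : C -> C) a b c d : a <= b -> c <= d -> bcont p a b c d -> bcont q a b c d ->
  oint (fun z => p z - q z)%C a b c d = (oint p a b c d - oint q a b c d)%C.
Proof.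
  intros H1 H2 [P1 [P2 [P3 P4]]] [Q1 [Q2 [Q3 Q4]]]. unfold oint.
  rewrite (CInt_minus _ _ a b H1 (hcont_on _ _ _ _ P1) (hcont_on _ _ _ _ Q1)).
  rewrite (CInt_minus _ _ a b H1 (hcont_on _ _ _ _ P2) (hcont_on _ _ _ _ Q2)).
  rewrite (CInt_minus _ _ c d H2 (vcont_on _ _ _ _ P3) (vcont_on _ _ _ _ Q3)).
  rewrite (CInt_minus _ _ c d H2 (vcont_on _ _ _ _ P4) (vcont_on _ _ _ _ Q4)).
  ring.
Qed.

Lemma oint_scal (k : C) (q : C -> C) a b c d : a <= b -> c <= d -> bcont q a b c d ->
  oint (fun z => k * q z)%C a b c d = (k * oint q a b c d)%C.
Proof.
  intros H1 H2 [Q1 [Q2 [Q3 Q4]]]. unfold oint.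
  rewrite (CInt_scal k _ a b H1 (hcont_on _ _ _ _ Q1)), (CInt_scal k _ a b H1 (hcont_on _ _ _ _ Q2)).
  rewrite (CInt_scal k _ c d H2 (vcont_on _ _ _ _ Q3)), (CInt_scal k _ c d H2 (vcont_on _ _ _ _ Q4)).
  ring.
Qed.

Definition on_boundary (a b c d : R) (z : C) :=
  (a <= fst z <= b /\ (snd z = c \/ snd z = d)) \/ (c <= snd z <= d /\ (fst z = a \/ fst z = b)).

Lemma bcont_intro {V : UniformSpace} (q : C -> V) a b c d :
  a <= b -> c <= d -> (forall z, on_boundary a b c d z -> continuous q z) -> bcont q a b c d.
Proof.
  intros H1 H2 H. repeat split; intros t Ht; apply H; unfold on_boundary; simpl; auto.
Qed.

Lemma Cmod_Ci_mult (z : C) : Cmod (Ci * z) = Cmod z.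
Proof. rewrite Cmod_mult, Cmod_Ci. ring. Qed.

Lemma Cmod_minus_le (z w : C) : Cmod (z - w) <= Cmod z + Cmod w.
Proof. rewrite <- (Cmod_opp w). apply Cmod_triangle. Qed.

Lemma oint_bound (q : C -> C) (g : C -> R) a b c d : a <= b -> c <= d -> bcont q a b c d -> bcont g a b c d ->
  (forall z, on_boundary a b c d z -> Cmod (q z) <= g z) ->
  Cmod (oint q a b c d) <= 2 * (RInt (fun x => g (x, c)) a b + RInt (fun x => g (x, d)) a b
    + RInt (fun y => g (b, y)) c d + RInt (fun y => g (a, y)) c d).
Proof.
  intros H1 H2 [Q1 [Q2 [Q3 Q4]]] [G1 [G2 [G3 G4]]] H. unfold oint.
  assert (A1 := CInt_bound (fun x => q (x, c)) (fun x => g (x, c)) a b H1 (hcont_on _ _ _ _ Q1)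
     (ex_RInt_cont_on _ _ _ H1 (hcont_on _ _ _ _ G1))
     (fun t Ht => H (t, c) (or_introl (conj Ht (or_introl eq_refl))))).
  assert (A2 := CInt_bound (fun x => q (x, d)) (fun x => g (x, d)) a b H1 (hcont_on _ _ _ _ Q2)
     (ex_RInt_cont_on _ _ _ H1 (hcont_on _ _ _ _ G2))
     (fun t Ht => H (t, d) (or_introl (conj Ht (or_intror eq_refl))))).
  assert (A3 := CInt_bound (fun y => q (b, y)) (fun y => g (b, y)) c d H2 (vcont_on _ _ _ _ Q4)
     (ex_RInt_cont_on _ _ _ H2 (vcont_on _ _ _ _ G4))
     (fun t Ht => H (b, t) (or_intror (conj Ht (or_intror eq_refl))))).
  assert (A4 := CInt_bound (fun y => q (a, y)) (fun y => g (a, y)) c d H2 (vcont_on _ _ _ _ Q3)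
     (ex_RInt_cont_on _ _ _ H2 (vcont_on _ _ _ _ G3))
     (fun t Ht => H (a, t) (or_intror (conj Ht (or_introl eq_refl))))).
  eapply Rle_trans; [apply Cmod_triangle|]. rewrite Cmod_Ci_mult.
  assert (B1 := Cmod_minus_le (CInt (fun x => q (x, c)) a b) (CInt (fun x => q (x, d)) a b)).
  assert (B2 := Cmod_minus_le (CInt (fun y => q (b, y)) c d) (CInt (fun y => q (a, y)) c d)).
  lra.
Qed.

Lemma oint_bound_const (q : C -> C) (M a b c d : R) : a <= b -> c <= d -> bcont q a b c d ->
  (forall z, on_boundary a b c d z -> Cmod (q z) <= M) ->
  Cmod (oint q a b c d) <= 4 * M * ((b - a) + (d - c)).
Proof.
  intros H1 H2 Q H. assert (A := oint_bound q (fun _ => M) a b c d H1 H2 Q).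
  cbv beta in A. rewrite !RInt_const in A.
  replace (4 * M * (b - a + (d - c))) with
    (2 * (scal (b - a) M + scal (b - a) M + scal (d - c) M + scal (d - c) M)).
  - apply A; [|exact H]. apply bcont_intro; auto. intros; apply continuous_const.
  - unfold scal; simpl; unfold mult; simpl; ring.
Qed.

Definition in_rect (a b c d : R) (z : C) := a <= fst z <= b /\ c <= snd z <= d.

(** The affine part of [q] has contour integral [0]: its difference between opposite sides is
    constant, and the two contributions cancel. The remainder is at most [e] times the
    half-perimeter, and the length of the contour brings in a second such factor. *)
Lemma goursat_local (q : C -> C) (z0 k : C) (e a b c d : R) : a <= b -> c <= d -> 0 <= e ->
  in_rect a b c d z0 -> bcont q a b c d ->
  (forall z, in_rect a b c d z -> Cmod (q z - q z0 - k * (z - z0))%C <= e * Cmod (z - z0)) ->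
  Cmod (oint q a b c d) <= 4 * e * ((b - a) + (d - c)) ^ 2.
Proof.
  intros H1 H2 He Hz0 Hq H. set (D := (b - a) + (d - c)).
  assert (Hc : forall l : C -> C, (forall z, continuous l z) -> bcont l a b c d).
  { intros l Hl. apply bcont_intro; auto. }
  assert (Hlin : forall z, continuous (fun z => q z0 + k * (z - z0))%C z).
  { intros z. apply continuous_Cplus; [apply continuous_const|].
    apply continuous_Cmult; [apply continuous_const|].
    apply continuous_Cminus; [apply continuous_Cid|apply continuous_const]. }
  assert (E : oint (fun z => q z - (q z0 + k * (z - z0)))%C a b c d = oint q a b c d).
  { rewrite oint_minus by auto. replace (oint (fun z => q z0 + k * (z - z0))%C a b c d) with (RtoC 0); [ring|].
    unfold oint. destruct (Hc _ Hlin) as [L1 [L2 [L3 L4]]].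
    rewrite <- !CInt_minus; [|assumption|apply (vcont_on (fun z => q z0 + k * (z - z0))%C); assumption
      |apply (vcont_on (fun z => q z0 + k * (z - z0))%C); assumption|assumption
      |apply (hcont_on (fun z => q z0 + k * (z - z0))%C); assumption
      |apply (hcont_on (fun z => q z0 + k * (z - z0))%C); assumption].
    rewrite (CInt_ext _ (fun _ => (k * (Ci * RtoC (c - d)))%C) a b) by
      (try assumption; intros; apply injective_projections; simpl; ring).
    rewrite (CInt_ext _ (fun _ => (k * RtoC (b - a))%C) c d) by
      (try assumption; intros; apply injective_projections; simpl; ring).
    rewrite !CInt_const. apply injective_projections; simpl; ring. }
  rewrite <- E. replace (4 * e * D ^ 2) with (4 * (e * D) * D) by ring.
  apply oint_bound_const; auto.
  - destruct Hq as [Q1 [Q2 [Q3 Q4]]].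
    repeat split; intros t Ht;
      apply (continuous_Cminus q (fun z => q z0 + k * (z - z0))%C); auto.
  - intros z Hz. assert (Hz' : in_rect a b c d z).
    { unfold on_boundary in Hz; unfold in_rect. lra. }
    replace (q z - (q z0 + k * (z - z0)))%C with (q z - q z0 - k * (z - z0))%C by ring.
    eapply Rle_trans; [apply H, Hz'|]. apply Rmult_le_compat_l; [exact He|].
    eapply Rle_trans; [apply Cmod_le_Rabs|]. simpl. unfold D. destruct Hz', Hz0.
    apply Rplus_le_compat; apply Rabs_le; simpl in *; lra.
Qed.

Theorem goursat (q : C -> C) (a b c d : R) : a <= b -> c <= d ->
  (forall z, in_rect a b c d z -> exists k, has_cderiv q z k) -> oint q a b c d = 0.
Proof.
  intros H1 H2 H.
  assert (Hcont : forall z, in_rect a b c d z -> continuous q z).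
  { intros z Hz. destruct (H z Hz) as [k Hk]. exact (has_cderiv_continuous _ _ _ Hk). }
  set (w := b - a). set (h := d - c).
  assert (Hw : 0 <= w) by (unfold w; lra). assert (Hh : 0 <= h) by (unfold h; lra).
  assert (A : forall e, 0 < e -> Cmod (oint q a b c d) <= e).
  { intros e He.
    (* The bound scales like the area: four quarters at scale [l / 2] add up to exactly the bound at
       scale [l]. *)
    assert (B := bisection (fun x y l => Cmod (oint q x (x + l * w) y (y + l * h)) <= e * l ^ 2) a c w h Hw Hh).
    cbv beta in B. replace (a + 1 * w) with b in B by (unfold w; ring).
    replace (c + 1 * h) with d in B by (unfold h; ring).
    replace (a + w) with b in B by (unfold w; ring).
    replace (c + h) with d in B by (unfold h; ring).
    replace (e * 1 ^ 2) with e in B by ring. apply B; clear B.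
    - intros x y l Hl X1 X2 Y1 Y2 A1 A2 A3 A4.
      assert (M1 : 0 <= l / 2 * w) by (apply Rmult_le_pos; lra).
      assert (M2 : 0 <= l / 2 * h) by (apply Rmult_le_pos; lra).
      replace (x + l / 2 * w + l / 2 * w) with (x + l * w) in * by field.
      replace (y + l / 2 * h + l / 2 * h) with (y + l * h) in * by field.
      rewrite (oint_split_x q x (x + l / 2 * w) (x + l * w)); [|lra|lra| |].
      rewrite (oint_split_y q x (x + l / 2 * w) y (y + l / 2 * h)); [|lra|lra| |].
      rewrite (oint_split_y q (x + l / 2 * w) (x + l * w) y (y + l / 2 * h)); [|lra|lra| |].
      + eapply Rle_trans; [apply Cmod_triangle|].
        assert (T1 := Cmod_triangle (oint q x (x + l / 2 * w) y (y + l / 2 * h)) (oint q x (x + l / 2 * w) (y + l / 2 * h) (y + l * h))).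
        assert (T2 := Cmod_triangle (oint q (x + l / 2 * w) (x + l * w) y (y + l / 2 * h)) (oint q (x + l / 2 * w) (x + l * w) (y + l / 2 * h) (y + l * h))).
        replace (e * l ^ 2) with (4 * (e * (l / 2) ^ 2)) by field. lra.
      + intros t Ht. apply Hcont. unfold in_rect; simpl; lra.
      + intros t Ht. apply Hcont. unfold in_rect; simpl; lra.
      + intros t Ht. apply Hcont. unfold in_rect; simpl; lra.
      + intros t Ht. apply Hcont. unfold in_rect; simpl; lra.
      + intros t Ht. apply Hcont. unfold in_rect; simpl; lra.
      + intros t Ht. apply Hcont. unfold in_rect; simpl; lra.
    - intros p1 p2 Hp1 Hp2. set (z0 := (p1, p2) : C).
      destruct (H z0) as [k Hk]; [split; assumption|].
      (* The summand [1] keeps [D] positive when the rectangle is degenerate, and [e'] is chosen so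
         that [4 * e' * (l * D) ^ 2 = e * l ^ 2]. *)
      set (D := w + h + 1). assert (HD : 0 < D) by (unfold D; lra).
      set (e' := e / (4 * D ^ 2)).
      assert (He' : 0 < e') by (unfold e'; apply Rdiv_lt_0_compat; [lra|]; apply Rmult_lt_0_compat; [lra|apply pow_lt; lra]).
      destruct (Hk e' He') as [del [Hdel HD']].
      assert (Hk' : forall u : C, Cmod u < del -> Cmod (q (z0 + u) - q z0 - k * u)%C <= e' * Cmod u).
      { intros u Hu. destruct (Ceq_dec u 0) as [->|Hu0].
        - replace (q (z0 + 0) - q z0 - k * 0)%C with (RtoC 0); [rewrite Cmod_0; lra|].
          replace (z0 + 0)%C with z0 by ring. cring.
        - apply HD'. split; [apply Cmod_gt_0, Hu0|exact Hu]. }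
      exists (del / D). split; [apply Rdiv_lt_0_compat; assumption|].
      intros x y l [Hl1 Hl2] X1 X2 Y1 Y2 P1 P2.
      assert (HlD : l * D < del) by (apply Rlt_div_r in Hl2; assumption).
      assert (M1 : 0 <= l * w) by (apply Rmult_le_pos; lra).
      assert (M2 : 0 <= l * h) by (apply Rmult_le_pos; lra).
      apply Rle_trans with (4 * e' * ((x + l * w - x) + (y + l * h - y)) ^ 2).
      + apply goursat_local with z0 k; try lra.
        * split; assumption.
        * repeat split; intros t Ht; apply Hcont; unfold in_rect; simpl; lra.
        * intros z [Z1 Z2]. replace (q z) with (q (z0 + (z - z0)))%C by (f_equal; ring).
          apply Hk'. eapply Rle_lt_trans; [apply Cmod_le_Rabs|]. simpl.
          apply Rle_lt_trans with (l * w + l * h); [|unfold D in HlD; lra].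
          apply Rplus_le_compat; apply Rabs_le; lra.
      + replace (x + l * w - x + (y + l * h - y)) with (l * (w + h)) by ring.
        apply Rle_trans with (4 * e' * (l * D) ^ 2).
        * apply Rmult_le_compat_l; [lra|]. apply pow_incr. split; [apply Rmult_le_pos; lra|].
          apply Rmult_le_compat_l; unfold D; lra.
        * right. unfold e'. field. lra. }
  apply Cmod_eq_0. apply Rle_antisym; [|apply Cmod_ge_0].
  apply le_epsilon. intros e He. rewrite Rplus_0_l. apply A, He.
Qed.

(** * Cauchy's formula *)

(** The bridge to real calculus: it gives the fundamental theorem on the sides of rectangles and,
    later, the derivative of the chordal distance along a segment. *)
Lemma has_cderiv_line (F : C -> C) (z0 v : C) (t : R) (d : C) :
  has_cderiv F (z0 + RtoC t * v)%C d ->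
  is_derive (fun s : R => fst (F (z0 + RtoC s * v)%C)) t (fst (d * v)%C) /\
  is_derive (fun s : R => snd (F (z0 + RtoC s * v)%C)) t (snd (d * v)%C).
Proof.
  intros H. set (V := Cmod v + 1). assert (HV : 0 < V) by (unfold V; generalize (Cmod_ge_0 v); lra).
  assert (A : forall e, 0 < e -> exists del, 0 < del /\ forall h : R, Rabs h < del ->
     Cmod (F (z0 + RtoC (t + h) * v) - F (z0 + RtoC t * v) - d * v * RtoC h)%C <= e * Rabs h).
  { intros e He. assert (He' : 0 < e / V) by (apply Rdiv_lt_0_compat; assumption).
    destruct (H _ He') as [del [Hd HD]].
    exists (del / V). split; [apply Rdiv_lt_0_compat; assumption|]. intros h Hh.
    assert (Hhv : Cmod (RtoC h * v) <= Rabs h * V).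
    { rewrite Cmod_mult, Cmod_R. apply Rmult_le_compat_l; [apply Rabs_pos|]. unfold V; lra. }
    apply Rlt_div_r in Hh; [|exact HV].
    destruct (Ceq_dec (RtoC h * v)%C 0) as [E|E].
    - replace (RtoC (t + h) * v)%C with (RtoC t * v + RtoC h * v)%C by (rewrite RtoC_plus; ring).
      rewrite <- Cmult_assoc, (Cmult_comm v), E.
      replace (F (z0 + (RtoC t * v + 0)) - F (z0 + RtoC t * v) - d * 0)%C with (RtoC 0).
      + rewrite Cmod_0. apply Rmult_le_pos; [lra|apply Rabs_pos].
      + replace (z0 + (RtoC t * v + 0))%C with (z0 + RtoC t * v)%C by ring. ring.
    - assert (HD' := HD (RtoC h * v)%C (conj (proj1 (Cmod_gt_0 _) E) (Rle_lt_trans _ _ _ Hhv Hh))).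
      change (Cmod (F (z0 + RtoC t * v + RtoC h * v) - F (z0 + RtoC t * v) - d * (RtoC h * v))%C
        <= e / V * Cmod (RtoC h * v)) in HD'.
      replace (z0 + RtoC t * v + RtoC h * v)%C with (z0 + RtoC (t + h) * v)%C in HD' by (rewrite RtoC_plus; ring).
      replace (d * (RtoC h * v))%C with (d * v * RtoC h)%C in HD' by ring.
      eapply Rle_trans; [exact HD'|]. apply Rle_trans with (e / V * (Rabs h * V)).
      + apply Rmult_le_compat_l; lra.
      + right. field. lra. }
  split; apply is_derive_Reals; intros e He; assert (He2 : 0 < e / 2) by lra;
    destruct (A _ He2) as [del [Hd HD]]; exists (mkposreal _ Hd); intros h Hh0 Hh; specialize (HD h Hh).
  - assert (X := Rabs_re_le (F (z0 + RtoC (t + h) * v) - F (z0 + RtoC t * v) - d * v * RtoC h)%C).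
    assert (E : forall z w k : C, fst (z - w - k * RtoC h)%C = fst z - fst w - fst k * h) by (intros; simpl; ring).
    rewrite E in X. revert X.
    generalize (fst (F (z0 + RtoC (t + h) * v)%C)) (fst (F (z0 + RtoC t * v)%C)) (fst (d * v)%C).
    intros a b l X. replace ((a - b) / h - l) with ((a - b - l * h) / h) by (field; exact Hh0).
    unfold Rdiv. rewrite Rabs_mult, Rabs_inv. assert (P := Rabs_pos_lt h Hh0).
    apply Rle_lt_trans with (e / 2); [|lra]. apply Rle_div_l; lra.
  - assert (X := Rabs_im_le (F (z0 + RtoC (t + h) * v) - F (z0 + RtoC t * v) - d * v * RtoC h)%C).
    assert (E : forall z w k : C, snd (z - w - k * RtoC h)%C = snd z - snd w - snd k * h) by (intros; simpl; ring).
    rewrite E in X. revert X.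
    generalize (snd (F (z0 + RtoC (t + h) * v)%C)) (snd (F (z0 + RtoC t * v)%C)) (snd (d * v)%C).
    intros a b l X. replace ((a - b) / h - l) with ((a - b - l * h) / h) by (field; exact Hh0).
    unfold Rdiv. rewrite Rabs_mult, Rabs_inv. assert (P := Rabs_pos_lt h Hh0).
    apply Rle_lt_trans with (e / 2); [|lra]. apply Rle_div_l; lra.
Qed.

Lemma CInt_derive_line (F F' : C -> C) (z0 v : C) (a b : R) : a <= b ->
  (forall t, a <= t <= b -> has_cderiv F (z0 + RtoC t * v)%C (F' (z0 + RtoC t * v)%C)) ->
  cont_on (fun t => F' (z0 + RtoC t * v)%C) a b ->
  CInt (fun t => v * F' (z0 + RtoC t * v))%C a b = (F (z0 + RtoC b * v) - F (z0 + RtoC a * v))%C.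
Proof.
  intros Hab HF Hc.
  assert (Hc' : cont_on (fun t => F' (z0 + RtoC t * v) * v)%C a b).
  { intros t Ht. apply continuous_Cmult; [apply Hc, Ht|apply continuous_const]. }
  rewrite (CInt_ext _ (fun t => F' (z0 + RtoC t * v) * v)%C) by (try assumption; intros; ring).
  apply injective_projections; apply is_RInt_unique.
  - apply (is_RInt_derive (V := R_CompleteNormedModule) (fun t => fst (F (z0 + RtoC t * v)%C)));
      intros t; rewrite Rmin_left, Rmax_right by exact Hab; intros Ht.
    + apply has_cderiv_line, HF, Ht.
    + apply (cont_on_fst _ _ _ Hc' t Ht).
  - apply (is_RInt_derive (V := R_CompleteNormedModule) (fun t => snd (F (z0 + RtoC t * v)%C)));
      intros t; rewrite Rmin_left, Rmax_right by exact Hab; intros Ht.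
    + apply has_cderiv_line, HF, Ht.
    + apply (cont_on_snd _ _ _ Hc' t Ht).
Qed.

Lemma oint_derive (F F' : C -> C) a b c d : a <= b -> c <= d ->
  (forall z, on_boundary a b c d z -> has_cderiv F z (F' z)) -> bcont F' a b c d ->
  oint F' a b c d = 0.
Proof.
  intros H1 H2 H [C1 [C2 [C3 C4]]].
  assert (Eh : forall x y, ((0, y) + RtoC x * 1)%C = (x, y)).
  { intros. apply injective_projections; simpl; ring. }
  assert (Ev : forall x y, ((x, 0) + RtoC y * Ci)%C = (x, y)).
  { intros. apply injective_projections; simpl; ring. }
  assert (Hh : forall y, (y = c \/ y = d) -> hcont F' a b y ->
    CInt (fun x => F' (x, y)) a b = (F (b, y) - F (a, y))%C).
  { intros y Hy Hc. rewrite <- (Eh b y), <- (Eh a y).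
    rewrite <- (CInt_derive_line F F' (0, y) 1 a b H1).
    - apply CInt_ext; [assumption|]. intros t Ht. rewrite Eh. ring.
    - intros t Ht. rewrite Eh. apply H. left. simpl. tauto.
    - intros t Ht. apply continuous_ext with (f := fun x => F' (x, y)).
      + intros x. rewrite Eh. reflexivity.
      + apply (hcont_on _ _ _ _ Hc), Ht. }
  assert (Hv : forall x, (x = a \/ x = b) -> vcont F' x c d ->
    (Ci * CInt (fun y => F' (x, y)) c d = F (x, d) - F (x, c))%C).
  { intros x Hx Hc. rewrite <- (Ev x c), <- (Ev x d).
    rewrite <- (CInt_scal Ci _ c d H2 (vcont_on _ _ _ _ Hc)).
    rewrite <- (CInt_derive_line F F' (x, 0) Ci c d H2).
    - apply CInt_ext; [assumption|]. intros t Ht. rewrite Ev. ring.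
    - intros t Ht. rewrite Ev. apply H. right. simpl. tauto.
    - intros t Ht. apply continuous_ext with (f := fun y => F' (x, y)).
      + intros y. rewrite Ev. reflexivity.
      + apply (vcont_on _ _ _ _ Hc), Ht. }
  unfold oint. rewrite !Hh by auto.
  replace (Ci * (CInt (fun y => F' (b, y)) c d - CInt (fun y => F' (a, y)) c d))%C with
    (Ci * CInt (fun y => F' (b, y)) c d - Ci * CInt (fun y => F' (a, y)) c d)%C by ring.
  rewrite !Hv by auto. ring.
Qed.

(** * Squares centred at the origin *)

Definition soint (q : C -> C) (r : R) : C := oint q (- r) r (- r) r.
Definition in_sq (r : R) (z : C) := in_rect (- r) r (- r) r z.
Definition on_sq (r : R) (z : C) := on_boundary (- r) r (- r) r z.

Lemma on_sq_in (r R : R) (z : C) : 0 <= r <= R -> on_sq r z -> in_sq R z.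
Proof. unfold on_sq, in_sq, on_boundary, in_rect. lra. Qed.

Lemma on_sq_ge (r : R) (z : C) : 0 <= r -> on_sq r z -> r <= Cmod z.
Proof.
  intros Hr H. assert (A := Rabs_re_le z). assert (B := Rabs_im_le z).
  destruct H as [[_ [E|E]]|[_ [E|E]]]; rewrite E in *;
  revert A B; unfold Rabs; repeat destruct Rcase_abs; lra.
Qed.

Lemma in_sq_le (r : R) (z : C) : in_sq r z -> Cmod z <= 2 * r.
Proof.
  intros [H1 H2]. eapply Rle_trans; [apply Cmod_le_Rabs|].
  assert (Rabs (fst z) <= r) by (apply Rabs_le; lra).
  assert (Rabs (snd z) <= r) by (apply Rabs_le; lra). lra.
Qed.

Lemma on_sq_neq0 (r : R) (z : C) : 0 < r -> on_sq r z -> z <> 0.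
Proof.
  intros Hr H E. apply on_sq_ge in H; [|lra]. rewrite E, Cmod_0 in H. lra.
Qed.

(** The region between the two squares is cut into four rectangles that avoid [0], and [goursat]
    applies to each. *)
Lemma soint_annulus (q : C -> C) (r R : R) : 0 < r <= R ->
  (forall z, in_sq R z -> z <> 0 -> exists k, has_cderiv q z k) -> soint q R = soint q r.
Proof.
  intros Hr H. unfold soint.
  assert (N : forall x y, (r <= Rabs x \/ r <= Rabs y) -> ((x, y) : C) <> 0).
  { intros x y Hxy E. injection E. intros -> ->. rewrite Rabs_R0 in Hxy. lra. }
  assert (Hr1 : r <= Rabs r) by apply Rle_abs.
  assert (Hr2 : r <= Rabs (- r)) by (rewrite Rabs_Ropp; apply Rle_abs).
  assert (HR1 : r <= Rabs R) by (eapply Rle_trans; [|apply Rle_abs]; lra).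
  assert (HR2 : r <= Rabs (- R)) by (rewrite Rabs_Ropp; exact HR1).
  assert (Hc : forall x y, -R <= x <= R -> - R <= y <= R -> (r <= Rabs x \/ r <= Rabs y) -> continuous q (x, y)).
  { intros x y Hx Hy Hxy. destruct (H (x, y)) as [k Hk]; [split; assumption|apply N, Hxy|].
    exact (has_cderiv_continuous _ _ _ Hk). }
  assert (G : forall a b c d, a <= b -> c <= d -> -R <= a -> b <= R -> -R <= c -> d <= R ->
     (r <= a \/ b <= - r \/ r <= c \/ d <= - r) -> oint q a b c d = 0).
  { intros a b c d A1 A2 A3 A4 A5 A6 A7. apply goursat; try assumption.
    intros [x y] [Hx Hy]. simpl in Hx, Hy. apply H; [split; simpl; lra|]. apply N.
    unfold Rabs; repeat destruct Rcase_abs; lra. }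
  rewrite (oint_split_x q (-R) (-r) R (-R) R); [|lra|lra| |].
  rewrite (oint_split_x q (-r) r R (-R) R); [|lra|lra| |].
  rewrite (oint_split_y q (-r) r (-R) (-r) R); [|lra|lra| |].
  rewrite (oint_split_y q (-r) r (-r) r R); [|lra|lra| |].
  rewrite (G (-R) (-r)), (G r R), (G (-r) r (-R) (-r)), (G (-r) r r R) by lra. ring.
  all: intros t Ht; apply Hc; try lra; auto.
Qed.

Lemma soint_bound_const (q : C -> C) (M r : R) : 0 <= r ->
  (forall z, on_sq r z -> continuous q z) ->
  (forall z, on_sq r z -> Cmod (q z) <= M) -> Cmod (soint q r) <= 16 * M * r.
Proof.
  intros Hr Hq H. replace (16 * M * r) with (4 * M * ((r - - r) + (r - - r))) by ring.
  unfold soint.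
  apply oint_bound_const; [lra|lra| |exact H]. apply bcont_intro; try lra. exact Hq.
Qed.

(** The last hypothesis says that [q] is [o(1 / |z|)] at [0]. By [soint_annulus] the contour may
    shrink to half-side [r], and its length, proportional to [r], then makes the integral
    arbitrarily small. *)
Lemma soint_punctured (q : C -> C) (R : R) : 0 < R ->
  (forall z, in_sq R z -> z <> 0 -> exists k, has_cderiv q z k) ->
  (forall e, 0 < e -> exists d, 0 < d /\ forall z : C, z <> RtoC 0 -> Cmod z < d -> Cmod (q z) * Cmod z <= e) ->
  soint q R = 0.
Proof.
  intros HR H Hs. apply Cmod_eq_0. apply Rle_antisym; [|apply Cmod_ge_0].
  apply le_epsilon. intros e He. rewrite Rplus_0_l.
  assert (He' : 0 < e / 16) by lra.
  (* Points of the contour satisfy [Cmod z <= 2 * r]; the choice [d / 3] keeps this below [d]. *)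
  destruct (Hs _ He') as [d [Hd Hb]]. set (r := Rmin R (d / 3)).
  assert (Hr : 0 < r <= R) by (unfold r, Rmin; destruct Rle_dec; lra).
  assert (Hrd : 2 * r < d) by (unfold r, Rmin; destruct Rle_dec; lra).
  rewrite (soint_annulus q r R Hr H). replace e with (16 * (e / 16 / r) * r) by (field; lra).
  apply soint_bound_const; [lra| |].
  - intros z Hz. destruct (H z) as [k Hk].
    + apply (on_sq_in r); [lra|exact Hz].
    + apply (on_sq_neq0 r); [lra|exact Hz].
    + exact (has_cderiv_continuous _ _ _ Hk).
  - intros z Hz. assert (Hz0 := on_sq_neq0 r z (proj1 Hr) Hz).
    assert (B := Hb z Hz0 (Rle_lt_trans _ _ _ (in_sq_le r z (on_sq_in r r z ltac:(lra) Hz)) Hrd)).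
    apply Rle_div_r; [lra|]. eapply Rle_trans; [|exact B].
    apply Rmult_le_compat_l; [apply Cmod_ge_0|]. apply on_sq_ge; [lra|exact Hz].
Qed.

(* The true value of [kappa r] is 2 i PI; a lower bound for its modulus is enough. *)
Definition kappa (r : R) : C := soint (fun z => / z)%C r.

Lemma continuous_inv_on_sq (r : R) (z : C) : 0 < r -> on_sq r z -> continuous (fun z => / z)%C z.
Proof.
  intros Hr Hz. apply (continuous_Cinv (fun z : C => z)); [apply continuous_Cid|]. apply (on_sq_neq0 r); assumption.
Qed.

(** On each side the imaginary part of [dz / z] is [r / (t ^ 2 + r ^ 2)], at least [1 / (2 * r)]
    over a length [2 * r]. Each side thus contributes at least [1]. *)
Lemma Cmod_kappa (r : R) : 0 < r -> 4 <= Cmod (kappa r).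
Proof.
  intros Hr. eapply Rle_trans; [|apply Rabs_im_le]. eapply Rle_trans; [|apply Rle_abs].
  assert (Hc := fun z Hz => continuous_inv_on_sq r z Hr Hz).
  assert (B := bcont_intro (fun z => / z)%C (-r) r (-r) r ltac:(lra) ltac:(lra) Hc).
  destruct B as [B1 [B2 [B3 B4]]].
  apply hcont_on in B1, B2. apply vcont_on in B3, B4.
  assert (L : forall u, cont_on u (-r) r -> (forall t, -r <= t <= r -> / (2 * r) <= u t) -> 1 <= RInt u (-r) r).
  { intros u Hu Hb. replace 1 with (RInt (fun _ => / (2 * r)) (-r) r).
    - apply RInt_le; [lra|apply ex_RInt_const|apply ex_RInt_cont_on; [lra|assumption]|].
      intros t Ht. apply Hb. lra.
    - rewrite RInt_const. unfold scal; simpl; unfold mult; simpl. field. lra. }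
  assert (Hq : forall t, -r <= t <= r -> / (2 * r) <= r / (t ^ 2 + r ^ 2)).
  { intros t Ht. apply Rle_div_r; [nra|]. apply (Rmult_le_reg_l (2 * r)); [lra|].
    replace (2 * r * (/ (2 * r) * (t ^ 2 + r ^ 2))) with (t ^ 2 + r ^ 2) by (field; lra). nra. }
  assert (L1 := L _ (cont_on_snd _ _ _ B1)). assert (L2 := L (fun t => - snd (/ (t, r))%C)).
  assert (L3 := L (fun t => - fst (/ ((-r)%R, t))%C)). assert (L4 := L _ (cont_on_fst _ _ _ B4)).
  assert (O2 : forall u, cont_on u (-r) r -> RInt (fun t => - u t) (-r) r = - RInt u (-r) r).
  { intros u Hu. apply (@RInt_opp R_CompleteNormedModule). apply ex_RInt_cont_on; [lra|exact Hu]. }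
  assert (O3 : forall u, cont_on u (-r) r -> cont_on (fun t => - u t) (-r) r).
  { intros u Hu t Ht. apply (@continuous_opp _ R_AbsRing R_NormedModule). apply Hu, Ht. }
  specialize (L2 (O3 _ (cont_on_snd _ _ _ B2))). specialize (L3 (O3 _ (cont_on_fst _ _ _ B3))).
  rewrite (O2 (fun t => snd (/ (t, r))%C) (cont_on_snd _ _ _ B2)) in L2.
  rewrite (O2 (fun t => fst (/ ((-r)%R, t))%C) (cont_on_fst _ _ _ B3)) in L3.
  assert (L1' : 1 <= RInt (fun t => snd (/ (t, (-r)%R))%C) (-r) r).
  { apply L1. intros t Ht. eapply Rle_trans; [apply (Hq t Ht)|]. right. simpl. field. nra. }
  assert (L2' : 1 <= - RInt (fun t => snd (/ (t, r))%C) (-r) r).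
  { apply L2. intros t Ht. eapply Rle_trans; [apply (Hq t Ht)|]. right. simpl. field. nra. }
  assert (L3' : 1 <= - RInt (fun t => fst (/ ((-r)%R, t))%C) (-r) r).
  { apply L3. intros t Ht. eapply Rle_trans; [apply (Hq t Ht)|]. right. simpl. field. nra. }
  assert (L4' : 1 <= RInt (fun t => fst (/ (r, t))%C) (-r) r).
  { apply L4. intros t Ht. eapply Rle_trans; [apply (Hq t Ht)|]. right. simpl. field. nra. }
  clear L1 L2 L3 L4. unfold kappa, soint, oint, CInt.
  cbn [fst snd Cplus Cmult Ci Cminus Copp] in *. lra.
Qed.

(** * Cauchy's formulas on squares and continuity of the derivative *)

Lemma has_cderiv_shift (g : C -> C) (p z k : C) :
  has_cderiv g (p + z)%C k -> has_cderiv (fun w => g (p + w)%C) z k.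
Proof.
  intros H. assert (A := has_cderiv_plus _ _ z _ _ (has_cderiv_const p z) (has_cderiv_id z)).
  assert (B := has_cderiv_comp g (fun w => p + w)%C z _ _ H A).
  replace (k * (0 + 1))%C with k in B by cring. exact B.
Qed.

Lemma has_cderiv_incr (g : C -> C) (p z k : C) :
  has_cderiv g (p + z)%C k -> has_cderiv (fun w => g (p + w)%C - g p)%C z k.
Proof.
  intros H. assert (A := has_cderiv_minus _ _ _ _ _ (has_cderiv_shift _ _ _ _ H) (has_cderiv_const (g p) z)).
  replace (k - 0)%C with k in A by cring. exact A.
Qed.

(** Once [d / z] is subtracted, the integrand is [(g (p + z) - g p - d z) / z ^ 2], which is
    [o(1 / |z|)] exactly because [d] is the derivative at [p]; [soint_punctured] applies. *)
Lemma cauchy_deriv (g : C -> C) (p d : C) (R : R) : 0 < R ->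
  (forall z, in_sq R z -> exists k, has_cderiv g (p + z)%C k) -> has_cderiv g p d ->
  soint (fun z => (g (p + z) - g p) / (z * z))%C R = (d * kappa R)%C.
Proof.
  intros HR H Hd.
  assert (Hc : forall z, on_sq R z -> continuous (fun z => (g (p + z) - g p) / (z * z))%C z).
  { intros z Hz. assert (Hz0 := on_sq_neq0 R z HR Hz).
    destruct (H z (on_sq_in R R z ltac:(lra) Hz)) as [k Hk].
    apply continuous_Cdiv.
    - exact (has_cderiv_continuous _ _ _ (has_cderiv_incr _ _ _ _ Hk)).
    - apply continuous_Cmult; apply continuous_Cid.
    - apply Cmult_neq_0; assumption. }
  assert (A : soint (fun z => (g (p + z) - g p) / (z * z) - d * / z)%C R = 0).
  { apply soint_punctured; [exact HR| |].
    - intros z Hz Hz0. destruct (H z Hz) as [k Hk]. eexists.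
      apply has_cderiv_minus; [apply has_cderiv_div|apply has_cderiv_mult].
      + apply has_cderiv_incr, Hk.
      + apply has_cderiv_mult; apply has_cderiv_id.
      + apply Cmult_neq_0; assumption.
      + apply has_cderiv_const.
      + apply (has_cderiv_inv (fun z => z)); [apply has_cderiv_id|exact Hz0].
    - intros e He. destruct (Hd e He) as [del [Hdel HD]]. exists del. split; [exact Hdel|].
      intros z Hz0 Hz. assert (Hp := proj1 (Cmod_gt_0 z) Hz0).
      specialize (HD z (conj Hp Hz)).
      change (Cmod (g (p + z) - g p - d * z)%C <= e * Cmod z) in HD.
      replace ((g (p + z) - g p) / (z * z) - d * / z)%C with ((g (p + z) - g p - d * z) / (z * z))%C by (field; exact Hz0).
      rewrite Cmod_div by (apply Cmult_neq_0; assumption). rewrite Cmod_mult.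
      replace (Cmod (g (p + z)%C - g p - d * z)%C / (Cmod z * Cmod z) * Cmod z)
        with (Cmod (g (p + z)%C - g p - d * z)%C / Cmod z) by (field; lra).
      apply Rle_div_l; assumption. }
  unfold soint in A. rewrite oint_minus in A; try lra.
  - rewrite (oint_scal d (fun z => / z)%C) in A; try lra.
    + unfold soint, kappa. set (X := oint _ _ _ _ _) in *. unfold soint. set (Y := oint (fun z => / z)%C _ _ _ _) in *.
      replace X with (X - d * Y + d * Y)%C by ring. rewrite A. ring.
    + apply bcont_intro; try lra. intros z Hz. apply (continuous_inv_on_sq R); assumption.
  - apply bcont_intro; try lra. exact Hc.
  - apply bcont_intro; try lra. intros z Hz.
    apply continuous_Cmult; [apply continuous_const|]. apply (continuous_inv_on_sq R); assumption.
Qed.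

Lemma continuous_continuity_2d (S : C -> R) (x y : R) :
  continuous S (x, y) -> continuity_2d_pt (fun x y => S (x, y)) x y.
Proof.
  intros H. apply continuity_2d_pt_filterlim. eapply filterlim_ext; [|exact H].
  intros [u v]. reflexivity.
Qed.

(** [cauchy_deriv] at [p] and at a nearby [p'] uses the same contour around [0], so
    [(g' p' - g' p) * kappa R] is a single integral, whose integrand is small by uniform continuity
    of [g] on a compact square. *)
Theorem has_cderiv_continuous_deriv (g g' : C -> C) (p : C) (r : R) : 0 < r ->
  (forall z, Cmod (z - p) < r -> has_cderiv g z (g' z)) -> continuous g' p.
Proof.
  intros Hr H. apply continuous_C_eps. intros e He.
  set (R := r / 8). assert (HR : 0 < R) by (unfold R; lra).
  assert (Hcont : forall x y, fst p - 2 * R <= x <= fst p + 2 * R -> snd p - 2 * R <= y <= snd p + 2 * R ->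
     continuous g (x, y)).
  { intros x y Hx Hy. apply (has_cderiv_continuous g _ (g' (x, y))). apply H.
    eapply Rle_lt_trans; [apply Cmod_le_Rabs|]. simpl.
    apply Rle_lt_trans with (2 * R + 2 * R); [|unfold R; lra].
    apply Rplus_le_compat; apply Rabs_le; lra. }
  (* The integrands will differ by at most [4 * eta / (R * R)], so the integrals differ by at most
     [64 * eta / R = 2 * e]; division by [4 <= Cmod (kappa R)] leaves [e / 2]. *)
  set (eta := e * R / 32). assert (Heta : 0 < eta) by (unfold eta; apply Rdiv_lt_0_compat; [apply Rmult_lt_0_compat|]; lra).
  destruct (uniform_continuity_2d (fun x y => fst (g (x, y))) (fst p - 2 * R) (fst p + 2 * R) (snd p - 2 * R) (snd p + 2 * R)) with (eps := mkposreal eta Heta) as [d1 U1].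
  { intros x y Hx Hy. apply (continuous_continuity_2d (fun z => fst (g z))). apply continuous_C_iff. apply Hcont; assumption. }
  destruct (uniform_continuity_2d (fun x y => snd (g (x, y))) (fst p - 2 * R) (fst p + 2 * R) (snd p - 2 * R) (snd p + 2 * R)) with (eps := mkposreal eta Heta) as [d2 U2].
  { intros x y Hx Hy. apply (continuous_continuity_2d (fun z => snd (g z))). apply continuous_C_iff. apply Hcont; assumption. }
  set (d := Rmin R (Rmin d1 d2)).
  assert (Hd : 0 < d) by (unfold d; repeat apply Rmin_pos; auto; apply cond_pos).
  assert (L : d <= R /\ d <= d1 /\ d <= d2) by (unfold d, Rmin; repeat destruct Rle_dec; repeat split; lra).
  exists d. split; [exact Hd|]. intros p' Hp'.
  assert (Hx := Rle_lt_trans _ _ _ (Rabs_re_le (p' - p)) Hp').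
  assert (Hy := Rle_lt_trans _ _ _ (Rabs_im_le (p' - p)) Hp'). simpl in Hx, Hy.
  assert (Hinc : forall z, in_sq R z -> Cmod (g (p' + z) - g (p + z))%C <= 2 * eta).
  { intros z [Z1 Z2]. eapply Rle_trans; [apply Cmod_le_Rabs|].
    apply Rabs_def2 in Hx, Hy.
    assert (V1 := U1 (fst p + fst z) (snd p + snd z) (fst p' + fst z) (snd p' + snd z)).
    assert (V2 := U2 (fst p + fst z) (snd p + snd z) (fst p' + fst z) (snd p' + snd z)).
    simpl in V1, V2. simpl. unfold Cplus.
    assert (W1 : Rabs (fst p' + fst z - (fst p + fst z)) < d) by (apply Rabs_def1; lra).
    assert (W2 : Rabs (snd p' + snd z - (snd p + snd z)) < d) by (apply Rabs_def1; lra).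
    specialize (V1 ltac:(lra) ltac:(lra) ltac:(lra) ltac:(lra) ltac:(lra) ltac:(lra)).
    specialize (V2 ltac:(lra) ltac:(lra) ltac:(lra) ltac:(lra) ltac:(lra) ltac:(lra)).
    unfold Rminus in V1, V2. lra. }
  assert (Hder : forall z, in_sq R z -> has_cderiv g (p' + z)%C (g' (p' + z)%C) /\ has_cderiv g (p + z)%C (g' (p + z)%C)).
  { intros z Hz. assert (Hz' := in_sq_le _ _ Hz). split; apply H.
    - replace (p' + z - p)%C with ((p' - p) + z)%C by ring.
      eapply Rle_lt_trans; [apply Cmod_triangle|]. unfold R in *; lra.
    - replace (p + z - p)%C with z by ring. unfold R in *; lra. }
  assert (S0 : in_sq R (RtoC 0)) by (unfold in_sq, in_rect; simpl; lra).
  assert (D0 := Hder (RtoC 0) S0). rewrite !Cplus_0_r in D0.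
  assert (A1 := cauchy_deriv g p' (g' p') R HR (fun z Hz => ex_intro _ _ (proj1 (Hder z Hz))) (proj1 D0)).
  assert (A2 := cauchy_deriv g p (g' p) R HR (fun z Hz => ex_intro _ _ (proj2 (Hder z Hz))) (proj2 D0)).
  assert (Hc : forall q z, (forall z, in_sq R z -> has_cderiv g (q + z)%C (g' (q + z)%C)) -> on_sq R z ->
     continuous (fun z => (g (q + z) - g q) / (z * z))%C z).
  { intros q z Hq Hz. assert (Hz0 := on_sq_neq0 R z HR Hz).
    assert (Hk := Hq z (on_sq_in R R z ltac:(lra) Hz)).
    apply continuous_Cdiv.
    - exact (has_cderiv_continuous _ _ _ (has_cderiv_incr _ _ _ _ Hk)).
    - apply continuous_Cmult; apply continuous_Cid.
    - apply Cmult_neq_0; assumption. }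
  assert (A : Cmod (soint (fun z => (g (p' + z) - g p') / (z * z) - (g (p + z) - g p) / (z * z))%C R) <= 16 * (4 * eta / (R * R)) * R).
  { apply soint_bound_const; [lra| |].
    - intros z Hz. apply continuous_Cminus; apply Hc; auto; intros w Hw; apply Hder; exact Hw.
    - intros z Hz. assert (Hz0 := on_sq_neq0 R z HR Hz). assert (HzR := on_sq_ge R z ltac:(lra) Hz).
      replace ((g (p' + z) - g p') / (z * z) - (g (p + z) - g p) / (z * z))%C
        with (((g (p' + z) - g (p + z)) - (g p' - g p)) / (z * z))%C by (field; exact Hz0).
      rewrite Cmod_div by (apply Cmult_neq_0; assumption). rewrite Cmod_mult.
      assert (B1 := Hinc z (on_sq_in R R z ltac:(lra) Hz)). assert (B2 := Hinc (RtoC 0) S0).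
      rewrite !Cplus_0_r in B2.
      assert (B3 := Cmod_minus_le (g (p' + z)%C - g (p + z)%C) (g p' - g p)).
      unfold Rdiv. apply Rmult_le_compat; [apply Cmod_ge_0| |lra|].
      + left. apply Rinv_0_lt_compat. nra.
      + apply Rinv_le_contravar; nra. }
  unfold soint in A. rewrite oint_minus in A; try lra.
  2,3: apply bcont_intro; try lra; intros z Hz; apply Hc; auto; intros w Hw; apply Hder; exact Hw.
  unfold soint in A1, A2. rewrite A1, A2 in A.
  replace (g' p' * kappa R - g' p * kappa R)%C with ((g' p' - g' p) * kappa R)%C in A by ring.
  rewrite Cmod_mult in A. assert (K := Cmod_kappa R HR).
  assert (P := Cmod_ge_0 (g' p' - g' p)).
  assert (Q : Cmod (g' p' - g' p) * 4 <= 2 * e).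
  { eapply Rle_trans; [apply Rmult_le_compat_l; [exact P|exact K]|]. eapply Rle_trans; [exact A|].
    right. unfold eta. field. lra. }
  lra.
Qed.

(** Here continuity of [g] at [p] already makes [(g (p + z) - g p) / z] an [o(1 / |z|)]. Used for
    the estimates in [unique_continuation]. *)
Lemma cauchy_value (g : C -> C) (p : C) (R : R) : 0 < R ->
  (forall z, in_sq R z -> exists k, has_cderiv g (p + z)%C k) ->
  soint (fun z => g (p + z) / z)%C R = (g p * kappa R)%C.
Proof.
  intros HR H.
  destruct (H (RtoC 0)) as [d Hd]. { unfold in_sq, in_rect; simpl; lra. }
  rewrite Cplus_0_r in Hd.
  assert (Hc : forall z, on_sq R z -> continuous (fun z => g (p + z) / z)%C z).
  { intros z Hz. assert (Hz0 := on_sq_neq0 R z HR Hz).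
    destruct (H z (on_sq_in R R z ltac:(lra) Hz)) as [k Hk].
    apply continuous_Cdiv.
    - exact (has_cderiv_continuous _ _ _ (has_cderiv_shift _ _ _ _ Hk)).
    - apply continuous_Cid.
    - assumption. }
  assert (A : soint (fun z => g (p + z) / z - g p * / z)%C R = 0).
  { apply soint_punctured; [exact HR| |].
    - intros z Hz Hz0. destruct (H z Hz) as [k Hk]. eexists.
      apply has_cderiv_minus; [apply has_cderiv_div|apply has_cderiv_mult].
      + apply has_cderiv_shift, Hk.
      + apply has_cderiv_id.
      + assumption.
      + apply has_cderiv_const.
      + apply (has_cderiv_inv (fun z => z)); [apply has_cderiv_id|exact Hz0].
    - intros e He. assert (Hi := has_cderiv_incr g p (RtoC 0) d).
      rewrite Cplus_0_r in Hi. specialize (Hi Hd). apply has_cderiv_continuous in Hi.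
      destruct (proj1 (continuous_C_eps _ _) Hi e He) as [del [Hdel HD]].
      exists del. split; [exact Hdel|].
      intros z Hz0 Hz. assert (Hp := proj1 (Cmod_gt_0 z) Hz0).
      specialize (HD z). replace (z - 0)%C with z in HD by ring. specialize (HD Hz).
      rewrite Cplus_0_r in HD. replace (g p - g p)%C with (RtoC 0) in HD by ring.
      replace (g (p + z)%C - g p - 0)%C with (g (p + z)%C - g p)%C in HD by ring.
      rewrite <- Cmod_mult.
      replace ((g (p + z) / z - g p * / z) * z)%C with (g (p + z) - g p)%C by (field; exact Hz0).
      lra. }
  unfold soint in A. rewrite oint_minus in A; [|lra|lra| |].
  - rewrite (oint_scal (g p) (fun z => / z)%C) in A; [|lra|lra|].
    + unfold soint, kappa. set (X := oint _ _ _ _ _) in *. unfold soint. set (Y := oint (fun z => / z)%C _ _ _ _) in *.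
      replace X with (X - g p * Y + g p * Y)%C by ring. rewrite A. ring.
    + apply bcont_intro; [lra|lra|]. intros z Hz. apply (continuous_inv_on_sq R); assumption.
  - apply bcont_intro; [lra|lra|]. exact Hc.
  - apply bcont_intro; [lra|lra|]. intros z Hz.
    apply continuous_Cmult; [apply continuous_const|]. apply (continuous_inv_on_sq R); assumption.
Qed.

(** The arclength integral over the boundary of the square. *)
Definition side_sum (u : C -> R) (r : R) : R :=
  RInt (fun x => u (x, - r)) (- r) r + RInt (fun x => u (x, r)) (- r) r
  + RInt (fun y => u (r, y)) (- r) r + RInt (fun y => u (- r, y)) (- r) r.

Lemma soint_bound (q : C -> C) (u : C -> R) (c r : R) : 0 < r ->
  (forall z, on_sq r z -> continuous q z) -> (forall z, on_sq r z -> continuous u z) ->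
  (forall z, on_sq r z -> Cmod (q z) <= c * u z) -> Cmod (soint q r) <= 2 * c * side_sum u r.
Proof.
  intros Hr Hq Hu H.
  assert (Hrr : - r <= r) by lra.
  assert (Hcu : forall z, on_sq r z -> continuous (fun z => c * u z) z).
  { intros z Hz. apply (@continuous_mult _ R_AbsRing (fun _ => c) u); [apply continuous_const|apply Hu, Hz]. }
  assert (A := oint_bound q (fun z => c * u z) (-r) r (-r) r Hrr Hrr
    (bcont_intro _ _ _ _ _ Hrr Hrr Hq) (bcont_intro _ _ _ _ _ Hrr Hrr Hcu) H).
  cbv beta in A.
  destruct (bcont_intro u (-r) r (-r) r Hrr Hrr Hu) as [B1 [B2 [B3 B4]]].
  apply hcont_on in B1, B2. apply vcont_on in B3, B4.
  assert (E : forall v, cont_on v (-r) r -> RInt (fun t => c * v t) (-r) r = c * RInt v (-r) r).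
  { intros v Hv. apply (@RInt_scal R_CompleteNormedModule). apply ex_RInt_cont_on; [lra|exact Hv]. }
  rewrite (E _ B1), (E _ B2), (E _ B3), (E _ B4) in A.
  unfold soint, side_sum. eapply Rle_trans; [exact A|]. right. ring.
Qed.

(** The function [(g (p + z) - g p) / z] has derivative [g' (p + z) / z - (g (p + z) - g p) / z ^
    2], whose contour integral therefore vanishes. This turns [cauchy_deriv] into the value formula
    for [g'] with only continuity of [g'], not its differentiability. The [4] is the lower bound for
    [Cmod (kappa r)]. *)
Lemma deriv_le_side_sum (g g' : C -> C) (p : C) (r : R) : 0 < r ->
  (forall z, in_sq r z -> has_cderiv g (p + z)%C (g' (p + z)%C) /\ continuous g' (p + z)%C) ->
  4 * Cmod (g' p) <= 2 / r * side_sum (fun z => Cmod (g' (p + z)%C)) r.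
Proof.
  intros Hr H.
  assert (Hi : forall z, on_sq r z -> in_sq r z) by (intros z; apply on_sq_in; lra).
  assert (Hc' : forall z, in_sq r z -> continuous (fun z => g' (p + z)%C) z).
  { intros z Hz. apply (continuous_comp (fun z : C => (p + z)%C) g'); [|apply H, Hz].
    apply continuous_Cplus; [apply continuous_const|apply continuous_Cid]. }
  assert (S0 : in_sq r (RtoC 0)) by (unfold in_sq, in_rect; simpl; lra).
  assert (D0 := proj1 (H _ S0)). rewrite Cplus_0_r in D0.
  assert (A := cauchy_deriv g p (g' p) r Hr (fun z Hz => ex_intro _ _ (proj1 (H z Hz))) D0).
  assert (C1 : forall z, on_sq r z -> continuous (fun z => g' (p + z) / z)%C z).
  { intros z Hz. apply continuous_Cdiv; [apply Hc', Hi, Hz|apply continuous_Cid|apply (on_sq_neq0 r); assumption]. }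
  assert (C2 : forall z, on_sq r z -> continuous (fun z => (g (p + z) - g p) / (z * z))%C z).
  { intros z Hz. assert (Hz0 := on_sq_neq0 r z Hr Hz). apply continuous_Cdiv.
    - exact (has_cderiv_continuous _ _ _ (has_cderiv_incr _ _ _ _ (proj1 (H z (Hi z Hz))))).
    - apply continuous_Cmult; apply continuous_Cid.
    - apply Cmult_neq_0; assumption. }
  assert (B : soint (fun z => g' (p + z) / z - (g (p + z) - g p) / (z * z))%C r = 0).
  { unfold soint. apply (oint_derive (fun z => (g (p + z) - g p) / z)%C); [lra|lra| |].
    - intros z Hz. assert (Hz0 := on_sq_neq0 r z Hr Hz).
      assert (X := has_cderiv_div _ _ z _ _ (has_cderiv_incr g p z _ (proj1 (H z (Hi z Hz)))) (has_cderiv_id z) Hz0).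
      cbv beta in X.
      replace (g' (p + z) / z - (g (p + z) - g p) / (z * z))%C
        with ((g' (p + z) * z - (g (p + z) - g p) * 1) / (z * z))%C by (field; exact Hz0).
      exact X.
    - apply bcont_intro; [lra|lra|]. intros z Hz. apply continuous_Cminus; auto. }
  unfold soint in B. rewrite oint_minus in B; [|lra|lra| |].
  2,3: apply bcont_intro; [lra|lra|]; assumption.
  assert (E : soint (fun z => g' (p + z) / z)%C r = (g' p * kappa r)%C).
  { rewrite <- A. unfold soint.
    assert (E0 : forall X Y : C, (X - Y)%C = 0 -> X = Y).
    { intros X Y E0. replace X with (X - Y + Y)%C by ring. rewrite E0. ring. }
    apply E0, B. }
  assert (K := Cmod_kappa r Hr).
  assert (M : Cmod (soint (fun z => g' (p + z) / z)%C r) <= 2 * (/ r) * side_sum (fun z => Cmod (g' (p + z)%C)) r).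
  { apply soint_bound; [exact Hr|exact C1| |].
    - intros z Hz. apply continuous_Cmod, Hc', Hi, Hz.
    - intros z Hz. assert (Hz0 := on_sq_neq0 r z Hr Hz). assert (HzR := on_sq_ge r z ltac:(lra) Hz).
      rewrite Cmod_div by exact Hz0. unfold Rdiv. rewrite Rmult_comm. apply Rmult_le_compat_r; [apply Cmod_ge_0|].
      apply Rinv_le_contravar; lra. }
  rewrite E, Cmod_mult in M. unfold Rdiv.
  eapply Rle_trans; [|exact M]. rewrite Rmult_comm. apply Rmult_le_compat_l; [apply Cmod_ge_0|exact K].
Qed.

Lemma has_cderiv_Cpow (w z : C) (n : nat) : exists k, has_cderiv (fun u => (u - w) ^ n)%C z k.
Proof.
  induction n as [|n [k Hk]].
  - exists (RtoC 0). exact (has_cderiv_const (RtoC 1) z).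
  - eexists. exact (has_cderiv_mult (fun u => u - w)%C (fun u => (u - w) ^ n)%C z _ _
      (has_cderiv_minus _ _ _ _ _ (has_cderiv_id z) (has_cderiv_const w z)) Hk).
Qed.

(* Since [g] vanishes near [w], every [g / (z - w) ^ n] is holomorphic; Cauchy's estimate at [p] for these
   functions improves geometrically because [p] is closer to [w] than the contour is. *)
Lemma unique_continuation (g : C -> C) (p w : C) (r : R) : 0 < r ->
  (forall z, in_sq r z -> exists k, has_cderiv g (p + z)%C k) ->
  Cmod (w - p) <= r / 4 -> locally w (fun u => g u = RtoC 0) -> g p = 0.
Proof.
  intros Hr H Hw Hz.
  destruct (Ceq_dec p w) as [->|Hne]; [exact (locally_singleton _ _ Hz)|].
  assert (Hne0 : forall u : C, u <> w -> (u - w)%C <> 0).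
  { intros u Hu E. apply Hu. replace u with (u - w + w)%C by ring. rewrite E. ring. }
  assert (Hd : forall n z, in_sq r z -> exists k, has_cderiv (fun u => g u / (u - w) ^ n)%C (p + z)%C k).
  { intros n z Hin. destruct (Ceq_dec (p + z)%C w) as [E|E].
    (* Near [w] the quotient is identically [0], including at [w] itself, since a zero numerator
       makes the value at a zero denominator irrelevant. *)
    - rewrite E. exists (RtoC 0). eapply has_cderiv_ext_loc; [|apply (has_cderiv_const (RtoC 0))].
      revert Hz. apply locally_C_imp. intros u ->. unfold Cdiv. ring.
    - destruct (H z Hin) as [k Hk]. destruct (has_cderiv_Cpow w (p + z)%C n) as [k' Hk'].
      eexists. apply has_cderiv_div; [exact Hk|exact Hk'|]. apply Cpow_nz, Hne0, E. }
  assert (Hpw := proj1 (Cmod_gt_0 _) (Hne0 p Hne)). rewrite Cmod_minus_sym in Hw.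
  assert (Hi : forall z, on_sq r z -> in_sq r z) by (intros z; apply on_sq_in; lra).
  set (u := fun z => Cmod (g (p + z)%C)). set (K := 2 / r * Rabs (side_sum u r)).
  assert (HK : 0 <= K).
  { apply Rmult_le_pos; [apply Rlt_le, Rdiv_lt_0_compat; lra|apply Rabs_pos]. }
  (* The ratio [1 / 3] compares [Cmod (p - w) <= r / 4] with the distance from [w] to the contour,
     at least [r - r / 4]. *)
  assert (B : forall n, 4 * Cmod (g p) <= K * (1 / 3) ^ n).
  { intros n. assert (V := cauchy_value _ p r Hr (Hd n)). cbv beta in V.
    assert (M : Cmod (soint (fun z => g (p + z) / (p + z - w) ^ n / z)%C r) <=
      2 * (/ (3 * r / 4) ^ n * / r) * side_sum u r).
    { apply soint_bound; [exact Hr| | |].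
      - intros z Hz'. destruct (Hd n z (Hi z Hz')) as [k Hk]. apply continuous_Cdiv.
        + apply has_cderiv_shift in Hk. exact (has_cderiv_continuous _ _ _ Hk).
        + apply continuous_Cid.
        + apply (on_sq_neq0 r); assumption.
      - intros z Hz'. destruct (H z (Hi z Hz')) as [k Hk]. apply continuous_Cmod.
        apply has_cderiv_shift in Hk. exact (has_cderiv_continuous _ _ _ Hk).
      - intros z Hz'. assert (Hz0 := on_sq_neq0 r z Hr Hz'). assert (HzR := on_sq_ge r z ltac:(lra) Hz').
        assert (T : 3 * r / 4 <= Cmod (p + z - w)).
        { assert (T := Cmod_triangle (p + z - w) (w - p)).
          replace (p + z - w + (w - p))%C with z in T by ring. rewrite (Cmod_minus_sym w p) in T. lra. }
        assert (T0 : 0 < Cmod (p + z - w)) by lra.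
        assert (T1 : (p + z - w)%C <> 0) by (apply Cmod_gt_0; exact T0).
        rewrite !Cmod_div, Cmod_pow by (try apply Cpow_nz; assumption). fold (u z).
        unfold Rdiv. rewrite Rmult_assoc, Rmult_comm. apply Rmult_le_compat_r; [apply Cmod_ge_0|].
        apply Rmult_le_compat.
        + left. apply Rinv_0_lt_compat, pow_lt, T0.
        + left. apply Rinv_0_lt_compat. lra.
        + apply Rinv_le_contravar; [apply pow_lt; lra|]. apply pow_incr. unfold Rdiv in T. lra.
        + apply Rinv_le_contravar; lra. }
    rewrite V in M. rewrite Cmod_mult, Cmod_div, Cmod_pow in M by (apply Cpow_nz, Hne0, Hne).
    assert (Kp := Cmod_kappa r Hr).
    assert (Hq := pow_lt _ n Hpw).
    assert (M1 : Cmod (g p) / Cmod (p - w) ^ n * 4 <= / (3 * r / 4) ^ n * K).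
    { eapply Rle_trans.
      - apply Rmult_le_compat_l; [|exact Kp]. apply Rmult_le_pos; [apply Cmod_ge_0|]. left. apply Rinv_0_lt_compat, Hq.
      - eapply Rle_trans; [exact M|]. unfold K.
        assert (0 < / (3 * r / 4) ^ n) by (apply Rinv_0_lt_compat, pow_lt; lra).
        replace (2 * (/ (3 * r / 4) ^ n * / r) * side_sum u r) with (/ (3 * r / 4) ^ n * (2 / r * side_sum u r)) by (unfold Rdiv; ring).
        apply Rmult_le_compat_l; [lra|]. apply Rmult_le_compat_l; [apply Rlt_le, Rdiv_lt_0_compat; lra|apply Rle_abs]. }
    assert (P3 : 0 < (3 * r / 4) ^ n) by (apply pow_lt; lra).
    replace (4 * Cmod (g p)) with (Cmod (g p) / Cmod (p - w) ^ n * 4 * Cmod (p - w) ^ n) by (field; lra).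
    eapply Rle_trans; [apply Rmult_le_compat_r; [lra|exact M1]|].
    rewrite Rmult_comm, <- Rmult_assoc, (Rmult_comm _ K). apply Rmult_le_compat_l; [exact HK|].
    rewrite <- pow_inv, <- Rpow_mult_distr. apply pow_incr. split.
    - apply Rmult_le_pos; [lra|]. left. apply Rinv_0_lt_compat. lra.
    - apply Rle_div_l; lra. }
  apply Cmod_eq_0. apply Rle_antisym; [|apply Cmod_ge_0]. apply le_epsilon. intros e He. rewrite Rplus_0_l.
  destruct (pow_lt_1_zero (1 / 3) ltac:(rewrite Rabs_pos_eq; lra) (e / (K + 1))) as [N HN].
  { apply Rdiv_lt_0_compat; lra. }
  specialize (HN N (Nat.le_refl N)). rewrite Rabs_pos_eq in HN by (apply pow_le; lra).
  specialize (B N). apply Rlt_div_r in HN; [|lra].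
  assert (0 <= (1 / 3) ^ N) by (apply pow_le; lra). assert (G := Cmod_ge_0 (g p)). nra.
Qed.

(** * Charts of the sphere *)

(* [g] represents [F] near [z0] in one of the two standard charts of the sphere, and [S] is the
   derivative of [F] measured with the metric |dw| / (1 + |w|^2), half the spherical one. *)
Definition chart_at (F : C -> option C) (S : C -> R) (z0 : C) (r : R) (g g' : C -> C) : Prop :=
  0 < r /\
  (forall w : C, Cmod (w - z0) < r ->
     has_cderiv g w (g' w) /\ S w = Cmod (g' w) / (1 + Cmod (g w) ^ 2)) /\
  ((forall w : C, Cmod (w - z0) < r -> F w = Some (g w)) \/
   (forall w : C, Cmod (w - z0) < r -> F w = recip (g w))).

Definition sph_deriv (F : C -> option C) (S : C -> R) (z0 : C) : Prop :=
  exists r g g', chart_at F S z0 r g g'.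

Lemma one_plus_sq_pos (x : R) : 0 < 1 + x ^ 2.
Proof. generalize (pow2_ge_0 x). lra. Qed.

Lemma continuous_sph_quotient (g g' : C -> C) (z : C) : continuous g z -> continuous g' z ->
  continuous (fun w => Cmod (g' w) / (1 + Cmod (g w) ^ 2)) z.
Proof.
  intros H H'. apply continuous_Rdiv.
  - apply continuous_Cmod, H'.
  - apply (@continuous_plus _ R_AbsRing R_NormedModule (fun _ => 1)); [apply continuous_const|].
    apply (continuous_comp (fun w => Cmod (g w)) (fun x => x ^ 2)); [apply continuous_Cmod, H|].
    apply (@ex_derive_continuous R_AbsRing R_NormedModule). auto_derive. auto.
  - generalize (one_plus_sq_pos (Cmod (g z))). lra.
Qed.

Lemma Cmod_minus_self (z : C) : Cmod (z - z) = 0.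
Proof. replace (z - z)%C with (RtoC 0) by ring. apply Cmod_0. Qed.

Lemma sph_deriv_continuous F S z0 : sph_deriv F S z0 -> continuous S z0.
Proof.
  intros [r [g [g' [Hr [H _]]]]].
  apply continuous_ext_loc with (g := fun w => Cmod (g' w) / (1 + Cmod (g w) ^ 2)).
  - apply (locally_C_iff z0 (fun w => Cmod (g' w) / (1 + Cmod (g w) ^ 2) = S w)).
    exists r. split; [exact Hr|]. intros w Hw. symmetry. apply H, Hw.
  - apply continuous_sph_quotient.
    + apply (has_cderiv_continuous g z0 (g' z0)). apply H. rewrite Cmod_minus_self. exact Hr.
    + apply (has_cderiv_continuous_deriv g g' z0 r Hr). intros z Hz. apply H, Hz.
Qed.

Lemma recip_0 : recip (RtoC 0) = None.
Proof.
  unfold recip. simpl. destruct (Req_EM_T 0 0) as [_|H]; [|contradict H; reflexivity].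
  destruct (Req_EM_T 0 0) as [_|H]; [reflexivity|contradict H; reflexivity].
Qed.

Lemma recip_neq0 (u : C) : u <> RtoC 0 -> recip u = Some (/ u)%C.
Proof.
  intros Hu. unfold recip. destruct (Req_EM_T (fst u) 0) as [E1|]; [|reflexivity].
  destruct (Req_EM_T (snd u) 0) as [E2|]; [|reflexivity].
  exfalso. apply Hu. apply injective_projections; assumption.
Qed.

Lemma recip_None (u : C) : recip u = None -> u = RtoC 0.
Proof.
  intros H. destruct (Ceq_dec u (RtoC 0)) as [|E]; [assumption|].
  rewrite (recip_neq0 u E) in H. discriminate.
Qed.

Lemma locally_ball_C (z w : C) (r : R) : Cmod (w - z) < r -> locally w (fun u : C => Cmod (u - z) < r).
Proof.
  intros H. apply locally_C_iff. exists (r - Cmod (w - z)). split; [lra|]. intros u Hu.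
  replace (u - z)%C with ((u - w) + (w - z))%C by ring.
  eapply Rle_lt_trans; [apply Cmod_triangle|]. lra.
Qed.

Lemma in_disk_segment (z0 z1 : C) (t : R) : 0 <= t <= 1 -> Cmod z0 < 1 -> Cmod z1 < 1 ->
  Cmod (z0 + RtoC t * (z1 - z0))%C < 1.
Proof.
  intros Ht H0 H1. replace (z0 + RtoC t * (z1 - z0))%C with (RtoC (1 - t) * z0 + RtoC t * z1)%C
    by (rewrite RtoC_minus; ring).
  eapply Rle_lt_trans; [apply Cmod_triangle|]. rewrite !Cmod_mult, !Cmod_R, !Rabs_pos_eq by lra.
  assert (A := Cmod_ge_0 z0). assert (B := Cmod_ge_0 z1).
  destruct (Rle_lt_dec t (1 / 2)); nra.
Qed.

(** Connectedness along the segment from [z0] to a point [z1] where [f] is finite. If [f] were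
    infinite near [z0], let [T] be the supremum of the parameters up to which [f] is infinite near
    the segment. In the chart at [p T] the function [1 / f] vanishes near some earlier point [p t],
    hence near [p T] by unique continuation; so [T] can be pushed forward until it is [1], which
    contradicts the value at [z1]. *)
Lemma poles_nowhere_dense (f : C -> option C) (z0 : C) (d : R) :
  meromorphic_disk f -> (exists z, in_disk z /\ f z <> None) -> in_disk z0 -> 0 < d ->
  exists w : C, Cmod (w - z0) < d /\ in_disk w /\ f w <> None.
Proof.
  intros Hf [z1 [Hz1 Hfz1]] Hz0 Hd. apply NNPP. intros Hno.
  set (p := fun t : R => (z0 + RtoC t * (z1 - z0))%C).
  assert (Hp : forall t, 0 <= t <= 1 -> Cmod (p t) < 1) by (intros t Ht; apply in_disk_segment; assumption).
  set (V := Cmod (z1 - z0) + 1). assert (HV : 0 < V) by (unfold V; generalize (Cmod_ge_0 (z1 - z0)); lra).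
  assert (Hlip : forall t t', Cmod (p t - p t') <= Rabs (t - t') * V).
  { intros t t'. unfold p. replace (z0 + t * (z1 - z0) - (z0 + t' * (z1 - z0)))%C
      with (RtoC (t - t') * (z1 - z0))%C by (rewrite RtoC_minus; ring).
    rewrite Cmod_mult, Cmod_R. apply Rmult_le_compat_l; [apply Rabs_pos|]. unfold V; lra. }
  set (N := fun t => locally (p t) (fun w : C => f w = None)).
  assert (N0 : N 0).
  { unfold N, p. replace (z0 + 0 * (z1 - z0))%C with z0 by ring. apply locally_C_iff.
    exists (Rmin d (1 - Cmod z0)). split.
    { apply Rmin_pos; [exact Hd|]. unfold in_disk in Hz0. change (Cmod z0 < 1) in Hz0. lra. }
    intros w Hw. apply NNPP. intros Hfw. apply Hno. exists w. repeat split; [|  |exact Hfw].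
    - eapply Rlt_le_trans; [exact Hw|apply Rmin_l].
    - change (Cmod w < 1). assert (A := Rlt_le_trans _ _ _ Hw (Rmin_r _ _)).
      replace w with (w - z0 + z0)%C by ring. eapply Rle_lt_trans; [apply Cmod_triangle|]. lra. }
  destruct (completeness (fun t => 0 <= t <= 1 /\ forall t', 0 <= t' <= t -> N t')) as [T [T1 T2]].
  { exists 1. intros t [Ht _]. lra. }
  { exists 0. split; [lra|]. intros t' Ht'. replace t' with 0 by lra. exact N0. }
  assert (HT0 : 0 <= T). { apply T1. split; [lra|]. intros t' Ht'. replace t' with 0 by lra. exact N0. }
  assert (HT1 : T <= 1). { apply T2. intros t [Ht _]. lra. }
  destruct (Hf (p T) (Hp T (conj HT0 HT1))) as [r [g [Hr [Hball [Hg Hfg]]]]].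
  change (forall w : C, Cmod (w - p T) < r -> exists k, has_cderiv g w k) in Hg.
  (* Parameters within [eta] of [T] give points within [rho / 8] of [p T], hence within [rho / 4] of
     each other, as [unique_continuation] demands; the squares of half-side [rho] around them stay
     inside the chart. *)
  set (rho := r / 8). assert (Hrho : 0 < rho) by (unfold rho; lra).
  set (eta := rho / 8 / V). assert (Heta : 0 < eta) by (unfold eta; repeat apply Rdiv_lt_0_compat; lra).
  assert (Hnear : forall t, Rabs (t - T) <= eta -> Cmod (p t - p T) <= rho / 8).
  { intros t Ht. eapply Rle_trans; [apply Hlip|]. apply Rle_trans with (eta * V).
    - apply Rmult_le_compat_r; lra.
    - right. unfold eta. field. lra. }
  assert (Ht : exists t, T - eta <= t <= T /\ 0 <= t <= 1 /\ forall t', 0 <= t' <= t -> N t').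
  { apply NNPP. intros Hn. assert (A : T <= T - eta); [|lra].
    apply T2. intros t [Ht HN]. apply Rnot_lt_le. intros Hlt. apply Hn. exists t.
    assert (t <= T) by (apply T1; split; assumption). repeat split; try lra. exact HN. }
  destruct Ht as [t [HtT [Ht HNt]]].
  assert (Hpt : Cmod (p t - p T) <= rho / 8) by (apply Hnear; apply Rabs_le; lra).
  assert (HNt' := HNt t (conj (proj1 Ht) (Rle_refl t))).
  destruct Hfg as [Hfg|Hfg].
  (* The finite chart is excluded, because [p t] lies in it and is a pole. *)
  { assert (A := locally_singleton _ _ HNt'). cbv beta in A.
    assert (B := Hfg (p t)). change (Cmod (p t - p T) < r -> f (p t) = Some (g (p t))) in B.
    rewrite A in B. assert (X : Cmod (p t - p T) < r) by (unfold rho in *; lra). specialize (B X). discriminate. }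
  change (forall w : C, Cmod (w - p T) < r -> f w = recip (g w)) in Hfg.
  assert (Hgt : locally (p t) (fun u => g u = RtoC 0)).
  { assert (X : Cmod (p t - p T) < r) by (unfold rho in *; lra).
    generalize (filter_and _ _ HNt' (locally_ball_C _ _ _ X)). apply locally_C_imp. intros w [E1 E2].
    rewrite (Hfg w E2) in E1. apply recip_None, E1. }
  assert (Hgq : forall q, Cmod (q - p T) <= rho / 8 -> g q = RtoC 0).
  { intros q Hq. apply (unique_continuation g q (p t) rho Hrho); [| |exact Hgt].
    - intros z Hz. apply Hg. apply in_sq_le in Hz.
      replace (q + z - p T)%C with ((q - p T) + z)%C by ring. eapply Rle_lt_trans; [apply Cmod_triangle|].
      unfold rho in *; lra.
    - replace (p t - q)%C with ((p t - p T) - (q - p T))%C by ring.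
      eapply Rle_trans; [apply Cmod_minus_le|]. lra. }
  assert (HNear : forall s, Rabs (s - T) < eta -> N s).
  { intros s Hs. assert (X : Cmod (p s - p T) < rho / 8).
    { eapply Rle_lt_trans; [apply Hlip|]. apply Rlt_le_trans with (eta * V).
      - apply Rmult_lt_compat_r; lra.
      - right. unfold eta. field. lra. }
    generalize (locally_ball_C _ _ _ X). apply locally_C_imp. intros w Hw.
    rewrite Hfg by (unfold rho in *; lra). rewrite (Hgq w) by lra. apply recip_0. }
  assert (Hall : forall s, 0 <= s < T + eta -> N s).
  { intros s Hs. destruct (Rle_lt_dec s t) as [H|H]; [apply HNt; lra|].
    apply (HNear s). apply Rabs_def1; lra. }
  assert (HT : T = 1).
  { destruct (Req_dec T 1) as [|HT]; [assumption|exfalso].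
    set (s := Rmin 1 (T + eta / 2)).
    assert (Hs : T < s <= T + eta / 2 /\ s <= 1) by (unfold s, Rmin; destruct Rle_dec; lra).
    assert (A : s <= T); [|lra]. apply T1. split; [lra|]. intros t' Ht'. apply Hall. lra. }
  assert (X := locally_singleton _ _ (Hall 1 ltac:(lra))). cbv beta in X. unfold p in X.
  replace (z0 + RtoC 1 * (z1 - z0))%C with z1 in X by (apply injective_projections; simpl; ring).
  contradiction.
Qed.

Lemma one_minus_sq_pos (z : C) : Cmod z < 1 -> 0 < 1 - Cmod z ^ 2.
Proof. intros H. generalize (Cmod_ge_0 z). nra. Qed.

(** The expression [|g'| / (1 + |g| ^ 2)] does not change when [g] is replaced by [1 / g], which
    settles every point that is not a pole in either chart. At a pole, [s] is continuous by
    hypothesis and the chart expression is continuous because [g'] is; they agree at points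
    arbitrarily near the pole by [poles_nowhere_dense], hence at the pole. *)
Lemma HS_norm_sph_deriv (f : C -> option C) (s : C -> R) (z0 : C) :
  meromorphic_disk f -> (exists z, in_disk z /\ f z <> None) -> is_HS_norm f s -> Cmod z0 < 1 ->
  sph_deriv f (fun z => s z / (1 - Cmod z ^ 2)) z0.
Proof.
  intros Hf Hne [Hs1 Hs2] Hz0.
  destruct (Hf z0 Hz0) as [r [g [Hr [Hball [Hg Hfg]]]]].
  change (forall w : C, Cmod (w - z0) < r -> Cmod w < 1) in Hball.
  change (forall w : C, Cmod (w - z0) < r -> exists k, has_cderiv g w k) in Hg.
  set (g' := fun w : C => epsilon (inhabits (RtoC 0)) (fun k : C => has_cderiv g w k)).
  assert (Hg' : forall w : C, Cmod (w - z0) < r -> has_cderiv g w (g' w)).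
  { intros w Hw. apply (epsilon_spec (inhabits (RtoC 0)) (fun k : C => has_cderiv g w k)), Hg, Hw. }
  exists r, g, g'. split; [exact Hr|]. split.
  2:{ exact Hfg. }
  intros w Hw. split; [apply Hg', Hw|].
  assert (Hw1 := one_minus_sq_pos w (Hball w Hw)).
  assert (Hq := one_plus_sq_pos (Cmod (g w))).
  destruct Hfg as [Hfg|Hfg].
  - change (forall w : C, Cmod (w - z0) < r -> f w = Some (g w)) in Hfg.
    assert (A := Hs1 w (g w) (g' w) (Hball w Hw) (Hfg w Hw)).
    change (has_cderiv (fin f) w (g' w) -> s w = 2 * Cmod (g' w) / (1 + Cmod (g w) ^ 2) * ((1 - Cmod w ^ 2) / 2)) in A.
    rewrite A; [field; lra|]. eapply has_cderiv_ext_loc; [|apply Hg', Hw].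
    generalize (locally_ball_C _ _ _ Hw). apply locally_C_imp. intros u Hu. unfold fin. rewrite (Hfg u Hu). reflexivity.
  - change (forall w : C, Cmod (w - z0) < r -> f w = recip (g w)) in Hfg.
    assert (Hform : forall u : C, Cmod (u - z0) < r -> g u <> RtoC 0 ->
      s u = Cmod (g' u) / (1 + Cmod (g u) ^ 2) * (1 - Cmod u ^ 2)).
    { intros u Hu Hgu. assert (E : f u = Some (/ g u)%C) by (rewrite (Hfg u Hu); apply recip_neq0, Hgu).
      assert (A := Hs1 u (/ g u)%C (- g' u / (g u * g u))%C (Hball u Hu) E).
      change (has_cderiv (fin f) u (- g' u / (g u * g u))%C -> s u = 2 * Cmod (- g' u / (g u * g u))%C / (1 + Cmod (/ g u) ^ 2) * ((1 - Cmod u ^ 2) / 2)) in A.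
      assert (P := proj1 (Cmod_gt_0 _) Hgu). assert (Q := one_plus_sq_pos (Cmod (g u))).
      rewrite A.
      - rewrite Cmod_div by (apply Cmult_neq_0; assumption). rewrite Cmod_opp, Cmod_mult, Cmod_inv by exact Hgu.
        field. split; lra.
      - eapply has_cderiv_ext_loc; [|apply (has_cderiv_inv g u (g' u)); [apply Hg', Hu|exact Hgu]].
        assert (Hc := has_cderiv_continuous _ _ _ (Hg' u Hu)).
        generalize (filter_and _ _ (locally_ball_C _ _ _ Hu) (continuous_neq0 g u Hc Hgu)).
        apply locally_C_imp. intros v [Hv1 Hv2]. unfold fin. rewrite (Hfg v Hv1), recip_neq0 by exact Hv2. reflexivity. }
    destruct (Ceq_dec (g w) (RtoC 0)) as [E|E].
    2:{ rewrite (Hform w Hw E). field. lra. }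
    set (Sg := fun u : C => Cmod (g' u) / (1 + Cmod (g u) ^ 2) * (1 - Cmod u ^ 2)).
    assert (Hcg : continuous g w) by exact (has_cderiv_continuous _ _ _ (Hg' w Hw)).
    assert (Hcg' : continuous g' w).
    { apply (has_cderiv_continuous_deriv g g' w (r - Cmod (w - z0))); [lra|]. intros z Hz. apply Hg'.
      replace (z - z0)%C with ((z - w) + (w - z0))%C by ring. eapply Rle_lt_trans; [apply Cmod_triangle|]. lra. }
    assert (HSg : continuous Sg w).
    { apply (@continuous_mult _ R_AbsRing (fun u => Cmod (g' u) / (1 + Cmod (g u) ^ 2)) (fun u => 1 - Cmod u ^ 2)).
      - apply continuous_sph_quotient; assumption.
      - apply (continuous_comp (fun u : C => Cmod u) (fun x => 1 - x ^ 2)).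
        + apply (continuous_Cmod (fun u : C => u)), continuous_Cid.
        + apply (@ex_derive_continuous R_AbsRing R_NormedModule). auto_derive. auto. }
    assert (Efw : f w = None) by (rewrite (Hfg w Hw), E; apply recip_0).
    assert (Esw : s w = Sg w).
    { apply Rminus_diag_uniq. apply NNPP. intros Hneq.
      assert (He : 0 < Rabs (s w - Sg w) / 3) by (generalize (Rabs_pos_lt _ Hneq); lra).
      destruct (Hs2 w (Hball w Hw) Efw _ He) as [d1 [Hd1 D1]].
      destruct (proj1 (continuous_R_eps Sg w) HSg _ He) as [d2 [Hd2 D2]].
      destruct (poles_nowhere_dense f w (Rmin (Rmin d1 d2) (r - Cmod (w - z0))) Hf Hne (Hball w Hw)) as [u [Hu [Hud Hfu]]].
      { repeat apply Rmin_pos; lra. }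
      assert (L : Cmod (u - w) < d1 /\ Cmod (u - w) < d2 /\ Cmod (u - w) < r - Cmod (w - z0)).
      { revert Hu. unfold Rmin. repeat destruct Rle_dec; intros; repeat split; lra. }
      destruct L as [L1 [L2 L3]].
      assert (Hur : Cmod (u - z0) < r).
      { replace (u - z0)%C with ((u - w) + (w - z0))%C by ring. eapply Rle_lt_trans; [apply Cmod_triangle|]. lra. }
      assert (Hgu : g u <> RtoC 0). { intros Eg. apply Hfu. rewrite (Hfg u Hur), Eg. apply recip_0. }
      specialize (D1 u Hud L1). specialize (D2 u L2). rewrite (Hform u Hur Hgu) in D1. fold (Sg u) in D1.
      rewrite Rabs_minus_sym in D1.
      assert (T := Rabs_triang (s w - Sg u) (Sg u - Sg w)).
      replace (s w - Sg u + (Sg u - Sg w)) with (s w - Sg w) in T by ring. lra. }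
    rewrite Esw. unfold Sg. field. lra.
Qed.

Lemma sph_deriv_cexp F S (z : C) : sph_deriv F S (cexp z) ->
  sph_deriv (fun u => F (cexp u)) (fun u => S (cexp u) * Cmod (cexp u)) z.
Proof.
  intros [r [g [g' [Hr [H HF]]]]].
  destruct (proj1 (continuous_C_eps cexp z) (has_cderiv_continuous _ _ _ (has_cderiv_cexp z)) r Hr) as [d [Hd D]].
  exists d, (fun u => g (cexp u)), (fun u => g' (cexp u) * cexp u)%C. split; [exact Hd|]. split.
  - intros w Hw. specialize (D w Hw). destruct (H _ D) as [H1 H2]. split.
    + apply (has_cderiv_comp g cexp); [exact H1|apply has_cderiv_cexp].
    + rewrite H2, Cmod_mult. unfold Rdiv. ring.
  - destruct HF as [HF|HF]; [left|right]; intros w Hw; apply HF, D, Hw.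
Qed.

(** * Iterated integrals on a half-plane *)

(** The half-plane [x < 0] is where [cexp] takes values in the disk. The bound [X] is free so that
    the condition survives translations, which move it to [X - fst p]. *)
Definition cont_left (f : R -> R -> R) (X : R) := forall x y, x < X -> continuity_2d_pt f x y.

Definition dint (f : R -> R -> R) (a b c d : R) : R := RInt (fun x => RInt (f x) c d) a b.

Lemma continuity_2d_swap (f : R -> R -> R) (x y : R) :
  continuity_2d_pt f x y -> continuity_2d_pt (fun u v => f v u) y x.
Proof. intros H e. destruct (H e) as [d Hd]. exists d. intros u v Hu Hv. apply Hd; assumption. Qed.

Lemma continuity_2d_snd (f : R -> R -> R) (x y : R) : continuity_2d_pt f x y -> continuous (f x) y.
Proof.
  intros H. apply continuity_pt_filterlim. intros e He.
  destruct (H (mkposreal e He)) as [d Hd]. exists d. split; [apply cond_pos|].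
  intros z [_ Hz]. apply Hd; [|exact Hz]. unfold Rminus. rewrite Rplus_opp_r, Rabs_R0. apply cond_pos.
Qed.

Lemma continuity_2d_fst (f : R -> R -> R) (x y : R) : continuity_2d_pt f x y -> continuous (fun x => f x y) x.
Proof. intros H. apply (continuity_2d_snd (fun u v => f v u)). apply continuity_2d_swap, H. Qed.

Lemma param_continuous (f : R -> R -> R) (x0 c d eta : R) : 0 < eta -> c <= d ->
  (forall x y, x0 - eta <= x <= x0 + eta -> c <= y <= d -> continuity_2d_pt f x y) ->
  continuous (fun x => RInt (f x) c d) x0.
Proof.
  intros Heta Hcd H. apply continuity_pt_filterlim. intros e He.
  assert (He' : 0 < e / (2 * (d - c + 1))) by (apply Rdiv_lt_0_compat; lra).
  destruct (uniform_continuity_2d f (x0 - eta) (x0 + eta) c d H (mkposreal _ He')) as [del Hdel].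
  exists (Rmin eta del). split; [apply Rmin_pos; [lra|apply cond_pos]|].
  intros x [_ Hx]. simpl. unfold R_dist in *.
  assert (Hx1 := Rlt_le_trans _ _ _ Hx (Rmin_l _ _)). assert (Hx2 := Rlt_le_trans _ _ _ Hx (Rmin_r _ _)).
  apply Rabs_def2 in Hx1.
  assert (Hex : forall x, x0 - eta <= x <= x0 + eta -> ex_RInt (f x) c d).
  { intros z Hz. apply ex_RInt_cont_on; [exact Hcd|]. intros y Hy. apply continuity_2d_snd, H; assumption. }
  assert (E : RInt (fun y => f x y - f x0 y) c d = RInt (f x) c d - RInt (f x0) c d).
  { apply (@RInt_minus R_CompleteNormedModule); apply Hex; lra. }
  rewrite <- E. apply Rle_lt_trans with ((d - c) * (e / (2 * (d - c + 1)))).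
  - apply abs_RInt_le_const; [exact Hcd| |].
    + apply (@ex_RInt_minus R_CompleteNormedModule); apply Hex; lra.
    + intros y Hy. left. apply Hdel; [lra|lra|lra|lra|exact Hx2|].
      unfold Rminus. rewrite Rplus_opp_r, Rabs_R0. apply cond_pos.
  - apply Rle_lt_trans with ((d - c + 1) * (e / (2 * (d - c + 1)))).
    + apply Rmult_le_compat_r; lra.
    + replace ((d - c + 1) * (e / (2 * (d - c + 1)))) with (e / 2) by (field; lra). lra.
Qed.

Lemma inner_continuous (f : R -> R -> R) (X x c d : R) : cont_left f X -> c <= d -> x < X ->
  continuous (fun x => RInt (f x) c d) x.
Proof.
  intros H Hcd Hx. apply (param_continuous f x c d ((X - x) / 2)); [lra|exact Hcd|].
  intros u v Hu _. apply H. lra.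
Qed.

Lemma inner_continuous_swap (f : R -> R -> R) (X a b y : R) : cont_left f X -> a <= b -> b < X ->
  continuous (fun y => RInt (fun x => f x y) a b) y.
Proof.
  intros H Hab Hb. apply (param_continuous (fun y x => f x y) y a b 1); [lra|exact Hab|].
  intros u v Hu Hv. apply (continuity_2d_swap f). apply H. lra.
Qed.

Lemma ex_RInt_inner (f : R -> R -> R) (X x c d : R) : cont_left f X -> c <= d -> x < X -> ex_RInt (f x) c d.
Proof.
  intros H Hcd Hx. apply ex_RInt_cont_on; [exact Hcd|]. intros y _. apply continuity_2d_snd, H, Hx.
Qed.

Lemma ex_RInt_row (f : R -> R -> R) (X a b y : R) : cont_left f X -> a < X -> b < X ->
  ex_RInt (fun x => f x y) a b.
Proof.
  intros H Ha Hb. apply (@ex_RInt_continuous R_CompleteNormedModule). intros x Hx.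
  apply continuity_2d_fst, H. eapply Rle_lt_trans; [apply Hx|]. apply Rmax_lub_lt; assumption.
Qed.

Lemma ex_RInt_outer (f : R -> R -> R) (X a b c d : R) : cont_left f X -> a <= b -> b < X -> c <= d ->
  ex_RInt (fun x => RInt (f x) c d) a b.
Proof.
  intros H Hab Hb Hcd. apply ex_RInt_cont_on; [exact Hab|]. intros x Hx.
  apply (inner_continuous f X); [exact H|exact Hcd|lra].
Qed.

Lemma ex_RInt_outer_swap (f : R -> R -> R) (X a b c d : R) : cont_left f X -> a <= b -> b < X -> c <= d ->
  ex_RInt (fun y => RInt (fun x => f x y) a b) c d.
Proof.
  intros H Hab Hb Hcd. apply ex_RInt_cont_on; [exact Hcd|]. intros y _.
  apply (inner_continuous_swap f X); assumption.
Qed.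

(* Both sides have the same derivative with respect to the upper bound [b]. *)
Lemma dint_swap (f : R -> R -> R) (X a b c d : R) : cont_left f X -> a <= b -> b < X -> c <= d ->
  dint f a b c d = RInt (fun y => RInt (fun x => f x y) a b) c d.
Proof.
  intros H Hab Hb Hcd.
  set (Psi := fun t => RInt (fun y => RInt (fun x => f x y) a t) c d).
  assert (Hder : forall u v, u < X -> is_derive (fun z => RInt (fun x => f x v) a z) u (f u v)).
  { intros u v Hu. apply (is_derive_RInt (V := R_NormedModule) (fun x => f x v) _ a u).
    - exists (mkposreal (X - u) ltac:(lra)). intros z Hz. apply (@RInt_correct R_CompleteNormedModule).
      apply (ex_RInt_row f X); [exact H|lra|].
      change (Rabs (z - u) < X - u) in Hz. apply Rabs_def2 in Hz. lra.
    - apply continuity_2d_fst, H, Hu. }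
  assert (HPsi : forall t, a <= t <= b -> is_derive Psi t (RInt (f t) c d)).
  { intros t Ht.
    assert (A := is_derive_RInt_param (fun z y => RInt (fun x => f x y) a z) c d t).
    replace (RInt (f t) c d) with (RInt (fun y => Derive (fun z => RInt (fun x => f x y) a z) t) c d).
    - apply A.
      + exists (mkposreal (X - t) ltac:(lra)). intros u Hu v _.
        change (Rabs (u - t) < X - t) in Hu. apply Rabs_def2 in Hu.
        exists (f u v). apply Hder. lra.
      + intros v _. apply continuity_2d_pt_ext_loc with f; [|apply H; lra].
        exists (mkposreal (X - t) ltac:(lra)). intros u w Hu _. simpl in Hu. apply Rabs_def2 in Hu.
        symmetry. apply is_derive_unique, Hder. lra.
      + exists (mkposreal (X - t) ltac:(lra)). intros u Hu. change (Rabs (u - t) < X - t) in Hu.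
        apply Rabs_def2 in Hu. destruct (Rle_lt_dec a u) as [L|L].
        * apply (ex_RInt_outer_swap f X); [exact H|exact L|lra|exact Hcd].
        * apply (ex_RInt_ext (fun y => opp (RInt (fun x => f x y) u a))).
          { intros y _. apply (@opp_RInt_swap R_CompleteNormedModule). apply (ex_RInt_row f X); [exact H|lra|lra]. }
          apply (@ex_RInt_opp R_NormedModule).
          apply (ex_RInt_outer_swap f X); [exact H|lra|lra|exact Hcd].
    - apply RInt_ext. intros y _. apply is_derive_unique, Hder. lra. }
  assert (A := is_RInt_derive (V := R_CompleteNormedModule) Psi (fun t => RInt (f t) c d) a b).
  rewrite Rmin_left, Rmax_right in A by exact Hab.
  assert (B := A HPsi (fun t Ht => inner_continuous f X t c d H Hcd (Rle_lt_trans _ _ _ (proj2 Ht) Hb))).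
  apply is_RInt_unique in B. unfold dint. rewrite B.
  assert (Z : Psi a = 0).
  { unfold Psi. rewrite (RInt_ext _ (fun _ => 0)).
    - rewrite RInt_const. unfold scal; simpl; unfold mult; simpl. ring.
    - intros y _. apply (@RInt_point R_CompleteNormedModule). }
  rewrite Z. unfold Psi. unfold minus, plus, opp; simpl. ring.
Qed.

Lemma RInt_subset (u : R -> R) (a b a' b' : R) : a <= a' -> a' <= b' -> b' <= b -> cont_on u a b ->
  (forall x, a <= x <= b -> 0 <= u x) -> RInt u a' b' <= RInt u a b.
Proof.
  intros H1 H2 H3 Hc Hp.
  assert (E : forall s t, a <= s -> s <= t -> t <= b -> ex_RInt u s t).
  { intros s t A1 A2 A3. apply ex_RInt_cont_on; [exact A2|]. apply (cont_on_sub u a b); assumption. }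
  assert (P : forall s t, a <= s -> s <= t -> t <= b -> 0 <= RInt u s t).
  { intros s t A1 A2 A3. apply RInt_ge_0; auto. intros x Hx. apply Hp. lra. }
  rewrite <- (RInt_Chasles u a a' b) by (apply E; lra).
  rewrite <- (RInt_Chasles u a' b' b) by (apply E; lra).
  unfold plus; simpl. assert (A1 := P a a'). assert (A2 := P b' b). lra.
Qed.

Lemma inner_nonneg (f : R -> R -> R) (X x c d : R) : cont_left f X -> c <= d -> x < X ->
  (forall x y, 0 <= f x y) -> 0 <= RInt (f x) c d.
Proof. intros H Hcd Hx Hp. apply RInt_ge_0; [exact Hcd|apply (ex_RInt_inner f X); assumption|auto]. Qed.

Lemma dint_subset (f : R -> R -> R) (X a b c d a' b' c' d' : R) : cont_left f X -> b < X ->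
  (forall x y, 0 <= f x y) -> a <= a' -> a' <= b' -> b' <= b -> c <= c' -> c' <= d' -> d' <= d ->
  dint f a' b' c' d' <= dint f a b c d.
Proof.
  intros H HX Hp A1 A2 A3 C1 C2 C3. unfold dint.
  apply Rle_trans with (RInt (fun x => RInt (f x) c d) a' b').
  - apply RInt_le; [exact A2| | |].
    + apply (ex_RInt_outer f X); [exact H|exact A2|lra|exact C2].
    + apply (ex_RInt_outer f X); [exact H|exact A2|lra|lra].
    + intros x Hx. apply RInt_subset; try assumption; [|intros; apply Hp].
      intros y _. apply continuity_2d_snd, H. lra.
  - apply RInt_subset; try assumption.
    + intros x Hx. apply (inner_continuous f X); [exact H|lra|lra].
    + intros x Hx. apply (inner_nonneg f X); [exact H|lra|lra|exact Hp].
Qed.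

Lemma RInt_shift (u : R -> R) (k a b : R) : ex_RInt u (k + a) (k + b) ->
  RInt (fun x => u (k + x)) a b = RInt u (k + a) (k + b).
Proof.
  intros H. assert (A := RInt_comp_lin (V := R_CompleteNormedModule) u 1 k a b).
  replace (1 * a + k) with (k + a) in A by ring. replace (1 * b + k) with (k + b) in A by ring.
  rewrite <- (A H). apply RInt_ext. intros x _. replace (1 * x + k) with (k + x) by ring.
  unfold scal; simpl; unfold mult; simpl. ring.
Qed.

Lemma dint_shift (f : R -> R -> R) (X p q a b c d : R) : cont_left f X -> p + b < X -> a <= b -> c <= d ->
  dint (fun x y => f (p + x) (q + y)) a b c d = dint f (p + a) (p + b) (q + c) (q + d).
Proof.
  intros H HX Hab Hcd. unfold dint.
  rewrite <- (RInt_shift (fun x => RInt (f x) (q + c) (q + d)) p a b).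
  - apply RInt_ext. rewrite Rmin_left, Rmax_right by exact Hab. intros x Hx.
    apply (RInt_shift (f (p + x))). apply (ex_RInt_inner f X); [exact H|lra|lra].
  - apply (ex_RInt_outer f X); [exact H|lra|exact HX|lra].
Qed.

(** As [r] runs over [[r1, r2]], the points [- r] and [r] sweep two non-overlapping intervals of
    [[- r2, r2]]. This is used for pairs of opposite sides of a growing square. *)
Lemma RInt_reflect_le (u : R -> R) (r1 r2 : R) : 0 <= r1 <= r2 -> cont_on u (- r2) r2 ->
  (forall x, - r2 <= x <= r2 -> 0 <= u x) ->
  RInt (fun r => u (- r) + u r) r1 r2 <= RInt u (- r2) r2.
Proof.
  intros Hr Hc Hp.
  assert (E : forall s t, - r2 <= s -> s <= t -> t <= r2 -> ex_RInt u s t).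
  { intros s t A1 A2 A3. apply ex_RInt_cont_on; [exact A2|]. apply (cont_on_sub u (- r2) r2); assumption. }
  assert (M : is_RInt (fun r => u (- r)) r1 r2 (RInt u (- r2) (- r1))).
  { assert (A := is_RInt_comp_opp (V := R_NormedModule) u r1 r2 (- RInt u (- r2) (- r1))).
    assert (B : is_RInt u (- r1) (- r2) (- RInt u (- r2) (- r1))).
    { apply (@is_RInt_swap R_NormedModule). apply (@RInt_correct R_CompleteNormedModule). apply E; lra. }
    specialize (A B). apply (@is_RInt_opp R_NormedModule) in A. simpl in A.
    replace (RInt u (- r2) (- r1)) with (opp (- RInt u (- r2) (- r1))) by (unfold opp; simpl; ring).
    eapply is_RInt_ext; [|exact A]. intros x _. unfold opp; simpl. ring. }
  assert (A : RInt (fun r => u (- r) + u r) r1 r2 = RInt u (- r2) (- r1) + RInt u r1 r2).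
  { apply is_RInt_unique. apply (@is_RInt_plus R_NormedModule); [exact M|].
    apply (@RInt_correct R_CompleteNormedModule). apply E; lra. }
  rewrite A.
  rewrite <- (RInt_Chasles u (- r2) (- r1) r2) by (apply E; lra).
  unfold plus; simpl. apply Rplus_le_compat_l. apply RInt_subset; try lra.
  - apply (cont_on_sub u (- r2) r2); [exact Hc|lra|lra].
  - intros x Hx. apply Hp. lra.
Qed.

Lemma side_sum_le (u : C -> R) (c : R) (v : C -> R) (r : R) : 0 < r -> 0 <= c ->
  (forall z, on_sq r z -> continuous u z) -> (forall z, on_sq r z -> continuous v z) ->
  (forall z, on_sq r z -> u z <= c * v z) -> side_sum u r <= c * side_sum v r.
Proof.
  intros Hr Hc Hu Hv H. assert (Hrr : - r <= r) by lra.
  destruct (bcont_intro u (-r) r (-r) r Hrr Hrr Hu) as [U1 [U2 [U3 U4]]].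
  destruct (bcont_intro v (-r) r (-r) r Hrr Hrr Hv) as [V1 [V2 [V3 V4]]].
  apply hcont_on in U1, U2, V1, V2. apply vcont_on in U3, U4, V3, V4.
  assert (L : forall p q, cont_on p (-r) r -> cont_on q (-r) r -> (forall t, - r <= t <= r -> p t <= c * q t) ->
    RInt p (-r) r <= c * RInt q (-r) r).
  { intros p q Hp Hq Hpq. replace (c * RInt q (-r) r) with (RInt (fun t => c * q t) (-r) r).
    - apply RInt_le; [exact Hrr|apply ex_RInt_cont_on; assumption| |intros t Ht; apply Hpq; lra].
      apply (@ex_RInt_scal R_CompleteNormedModule). apply ex_RInt_cont_on; assumption.
    - apply (@RInt_scal R_CompleteNormedModule). apply ex_RInt_cont_on; assumption. }
  unfold side_sum.
  assert (A1 := L _ _ U1 V1 (fun t Ht => H (t, (- r)%R) (or_introl (conj Ht (or_introl eq_refl))))).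
  assert (A2 := L _ _ U2 V2 (fun t Ht => H (t, r) (or_introl (conj Ht (or_intror eq_refl))))).
  assert (A3 := L _ _ U4 V4 (fun t Ht => H (r, t) (or_intror (conj Ht (or_intror eq_refl))))).
  assert (A4 := L _ _ U3 V3 (fun t Ht => H ((- r)%R, t) (or_intror (conj Ht (or_introl eq_refl))))).
  cbv beta in *. lra.
Qed.

(* Cauchy's formula on the squares of half-side [r], averaged over [R / 2 <= r <= R]. *)
Lemma deriv_le_dint (g g' : C -> C) (S : R -> R -> R) (p : C) (R X : R) : 0 < R -> fst p + R < X ->
  cont_left S X -> (forall x y, 0 <= S x y) ->
  (forall z, in_sq R z -> has_cderiv g (p + z)%C (g' (p + z)%C) /\ continuous g' (p + z)%C /\
     Cmod (g' (p + z)%C) <= 2 * S (fst p + fst z) (snd p + snd z)) ->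
  R ^ 2 * Cmod (g' p) <= 8 * dint S (fst p - R) (fst p + R) (snd p - R) (snd p + R).
Proof.
  intros HR HX HS HS0 H.
  set (f := fun x y => S (fst p + x) (snd p + y)).
  assert (Hf : cont_left f (X - fst p)).
  { intros x y Hx e. destruct (HS (fst p + x) (snd p + y) ltac:(lra) e) as [d Hd]. exists d.
    intros u v Hu Hv. apply Hd; [replace (fst p + u - (fst p + x)) with (u - x) by ring
      |replace (snd p + v - (snd p + y)) with (v - y) by ring]; assumption. }
  (* [Phi] and [Psi] integrate over full rows and columns: the sides of the square of half-side [r]
     get lengthened to [[- R, R]], so that only their position still depends on [r]. *)
  set (Phi := fun y => RInt (fun x => f x y) (- R) R). set (Psi := fun x => RInt (f x) (- R) R).
  assert (HPhi : forall y, continuous Phi y).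
  { intros y. apply (inner_continuous_swap f (X - fst p)); [exact Hf|lra|lra]. }
  assert (HPsi : cont_on Psi (- R) R).
  { intros x Hx. apply (inner_continuous f (X - fst p)); [exact Hf|lra|lra]. }
  assert (Hrow : forall y, cont_on (fun x => f x y) (- R) R).
  { intros y x Hx. apply continuity_2d_fst, Hf. lra. }
  assert (Hcol : forall x, - R <= x <= R -> cont_on (f x) (- R) R).
  { intros x Hx y Hy. apply continuity_2d_snd, Hf. lra. }
  assert (HPhi0 : forall y, 0 <= Phi y).
  { intros y. apply RInt_ge_0; [lra|apply ex_RInt_cont_on; [lra|apply Hrow]|intros; apply HS0]. }
  assert (HPsi0 : forall x, - R <= x <= R -> 0 <= Psi x).
  { intros x Hx. apply RInt_ge_0; [lra|apply ex_RInt_cont_on; [lra|apply Hcol, Hx]|intros; apply HS0]. }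
  assert (HD1 : dint f (- R) R (- R) R = dint S (fst p - R) (fst p + R) (snd p - R) (snd p + R)).
  { unfold f. apply (dint_shift S X); [exact HS|exact HX|lra|lra]. }
  assert (HD2 : RInt Phi (- R) R = dint f (- R) R (- R) R).
  { symmetry. apply (dint_swap f (X - fst p)); [exact Hf|lra|lra|lra]. }
  assert (HD3 : RInt Psi (- R) R = dint f (- R) R (- R) R) by reflexivity.
  assert (Hr : forall r, R / 2 <= r <= R ->
     R / 2 * Cmod (g' p) <= (Phi (- r) + Phi r) + (Psi (- r) + Psi r)).
  { intros r Hr.
    assert (Hin : forall z, in_sq r z -> in_sq R z) by (unfold in_sq, in_rect; intros; lra).
    assert (Hon : forall z, on_sq r z -> in_sq R z) by (intros z; apply on_sq_in; lra).
    assert (A := deriv_le_side_sum g g' p r ltac:(lra)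
      (fun z Hz => conj (proj1 (H z (Hin z Hz))) (proj1 (proj2 (H z (Hin z Hz)))))).
    assert (B : side_sum (fun z => Cmod (g' (p + z)%C)) r <= 2 * side_sum (fun z => f (fst z) (snd z)) r).
    { apply side_sum_le; [lra|lra| | |].
      - intros z Hz. apply continuous_Cmod. apply (continuous_comp (fun z : C => (p + z)%C) g').
        + apply continuous_Cplus; [apply continuous_const|apply continuous_Cid].
        + apply H, Hon, Hz.
      - intros z Hz. destruct (Hon z Hz) as [Hz1 Hz2]. destruct z as [x y]. simpl in *.
        assert (Q := Hf x y ltac:(lra)). apply continuity_2d_pt_filterlim in Q. exact Q.
      - intros z Hz. apply H, Hon, Hz. }
    assert (S1 : side_sum (fun z => f (fst z) (snd z)) r <= (Phi (- r) + Phi r) + (Psi (- r) + Psi r)).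
    { unfold side_sum. simpl.
      assert (T : forall y, RInt (fun x => f x y) (- r) r <= Phi y).
      { intros y. apply RInt_subset; try lra; [apply Hrow|intros; apply HS0]. }
      assert (T' : forall x, - R <= x <= R -> RInt (f x) (- r) r <= Psi x).
      { intros x Hx. apply RInt_subset; try lra; [apply Hcol, Hx|intros; apply HS0]. }
      assert (T1 := T (- r)). assert (T2 := T r). assert (T3 := T' (- r) ltac:(lra)). assert (T4 := T' r ltac:(lra)).
      change (RInt (fun y => f r y) (- r) r) with (RInt (f r) (- r) r).
      change (RInt (fun y => f (- r) y) (- r) r) with (RInt (f (- r)) (- r) r). lra. }
    set (Q := Phi (- r) + Phi r + (Psi (- r) + Psi r)) in *.
    assert (A' : 4 * Cmod (g' p) <= 2 / r * (2 * Q)).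
    { eapply Rle_trans; [exact A|]. apply Rmult_le_compat_l; [apply Rlt_le, Rdiv_lt_0_compat; lra|]. lra. }
    assert (A'' : r * (4 * Cmod (g' p)) <= 4 * Q).
    { replace (4 * Q) with (r * (2 / r * (2 * Q))) by (field; lra). apply Rmult_le_compat_l; lra. }
    assert (P := Cmod_ge_0 (g' p)). nra. }
  assert (HcT : forall w : Rdefinitions.R -> Rdefinitions.R, cont_on w (- R) R -> cont_on (fun r => w (- r) + w r) (R / 2) R).
  { intros w Hw r Hr'. apply (@continuous_plus _ R_AbsRing R_NormedModule (fun r => w (- r)) w); [|apply Hw; lra].
    apply (continuous_comp Ropp w); [|apply Hw; lra].
    apply (@continuous_opp _ R_AbsRing R_NormedModule (fun x => x)). apply continuous_id. }
  assert (C1 := HcT Phi (fun t _ => HPhi t)). assert (C2 := HcT Psi HPsi).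
  assert (HRR : R / 2 <= R) by lra.
  assert (I : RInt (fun _ => R / 2 * Cmod (g' p)) (R / 2) R <=
     RInt (fun r => (Phi (- r) + Phi r) + (Psi (- r) + Psi r)) (R / 2) R).
  { apply RInt_le; [lra|apply ex_RInt_const| |intros r Hr'; apply Hr; lra].
    apply (@ex_RInt_plus R_NormedModule); apply ex_RInt_cont_on; assumption. }
  rewrite RInt_const in I.
  assert (J : RInt (fun r => (Phi (- r) + Phi r) + (Psi (- r) + Psi r)) (R / 2) R =
     RInt (fun r => Phi (- r) + Phi r) (R / 2) R + RInt (fun r => Psi (- r) + Psi r) (R / 2) R).
  { apply (@RInt_plus R_CompleteNormedModule); apply ex_RInt_cont_on; assumption. }
  rewrite J in I.
  (* Horizontal and vertical sides each sweep the large square at most once. So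
     [R / 2 * (R / 2) * Cmod (g' p)] is at most twice the double integral, whence the factor [8]. *)
  assert (K1 := RInt_reflect_le Phi (R / 2) R ltac:(lra) (fun t _ => HPhi t) (fun t _ => HPhi0 t)).
  assert (K2 := RInt_reflect_le Psi (R / 2) R ltac:(lra) HPsi HPsi0).
  rewrite <- HD1. unfold scal in I; simpl in I; unfold mult in I; simpl in I. simpl. nra.
Qed.

Lemma cont_left_sqr (f : R -> R -> R) (X : R) : cont_left f X -> cont_left (fun x y => f x y ^ 2) X.
Proof.
  intros H x y Hx. apply (continuity_1d_2d_pt_comp (fun t => t ^ 2) f); [|apply H, Hx].
  apply derivable_continuous_pt, derivable_pt_pow.
Qed.

(* Cauchy-Schwarz, through [S <= l / 2 + S ^ 2 / (2 l)] for every [l > 0]. *)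
Lemma dint_cauchy_schwarz (S : R -> R -> R) (X a b c d l : R) : cont_left S X -> a <= b -> b < X -> c <= d ->
  0 < l -> dint S a b c d <= l / 2 * ((b - a) * (d - c)) + / (2 * l) * dint (fun x y => S x y ^ 2) a b c d.
Proof.
  intros H Hab HX Hcd Hl.
  assert (H2 := cont_left_sqr S X H).
  set (L := fun x => l / 2 * (d - c) + / (2 * l) * RInt (fun y => S x y ^ 2) c d).
  assert (E2 := ex_RInt_outer _ X a b c d H2 Hab HX Hcd).
  assert (EL : ex_RInt L a b).
  { apply (@ex_RInt_plus R_NormedModule); [apply ex_RInt_const|]. apply (@ex_RInt_scal R_NormedModule). exact E2. }
  apply Rle_trans with (RInt L a b).
  - apply RInt_le; [exact Hab|apply (ex_RInt_outer S X); assumption|exact EL|].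
    intros x Hx. unfold L.
    assert (Hx' : x < X) by lra.
    assert (E3 := ex_RInt_inner _ X x c d H2 Hcd Hx').
    replace (l / 2 * (d - c) + / (2 * l) * RInt (fun y => S x y ^ 2) c d)
      with (RInt (fun y => l / 2 + / (2 * l) * S x y ^ 2) c d).
    + apply RInt_le; [exact Hcd|apply (ex_RInt_inner S X); assumption| |].
      * apply (@ex_RInt_plus R_NormedModule); [apply ex_RInt_const|]. apply (@ex_RInt_scal R_NormedModule). exact E3.
      * intros y _. apply Rminus_le_0.
        replace (l / 2 + / (2 * l) * S x y ^ 2 - S x y) with ((S x y - l) ^ 2 * / (2 * l)) by (field; lra).
        apply Rmult_le_pos; [apply pow2_ge_0|]. left. apply Rinv_0_lt_compat. lra.
    + rewrite (@RInt_plus R_CompleteNormedModule); [|apply ex_RInt_const|apply (@ex_RInt_scal R_NormedModule); exact E3].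
      rewrite RInt_const. rewrite (@RInt_scal R_CompleteNormedModule) by exact E3.
      unfold scal, plus; simpl; unfold mult; simpl. ring.
  - right. unfold L. rewrite (@RInt_plus R_CompleteNormedModule); [|apply ex_RInt_const|apply (@ex_RInt_scal R_NormedModule); exact E2].
    rewrite RInt_const. rewrite (@RInt_scal R_CompleteNormedModule) by exact E2.
    unfold dint, scal, plus; simpl; unfold mult; simpl. ring.
Qed.

Lemma deriv_sqr_le_dint (g g' : C -> C) (S : R -> R -> R) (p : C) (R X : R) : 0 < R -> fst p + R < X ->
  cont_left S X -> (forall x y, 0 <= S x y) ->
  (forall z, in_sq R z -> has_cderiv g (p + z)%C (g' (p + z)%C) /\ continuous g' (p + z)%C /\
     Cmod (g' (p + z)%C) <= 2 * S (fst p + fst z) (snd p + snd z)) ->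
  R ^ 2 * Cmod (g' p) ^ 2 <= 256 * dint (fun x y => S x y ^ 2) (fst p - R) (fst p + R) (snd p - R) (snd p + R).
Proof.
  intros HR HX HS HS0 H.
  assert (A := deriv_le_dint g g' S p R X HR HX HS HS0 H).
  destruct (Rle_lt_or_eq_dec 0 _ (Cmod_ge_0 (g' p))) as [Hm|Hm].
  - set (m := Cmod (g' p)) in *.
    (* With [l = m / 32] and a square of area [4 * R ^ 2], the first term becomes [R ^ 2 * m / 2],
       half of the left-hand side, and is absorbed there. *)
    assert (B := dint_cauchy_schwarz S X (fst p - R) (fst p + R) (snd p - R) (snd p + R) (m / 32) HS
       ltac:(lra) HX ltac:(lra) ltac:(lra)).
    set (E := dint (fun x y => S x y ^ 2) _ _ _ _) in *.
    assert (Cc : R ^ 2 * m <= R ^ 2 * m / 2 + 128 / m * E).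
    { eapply Rle_trans; [exact A|]. apply Rle_trans with (8 * (m / 32 / 2 * ((fst p + R - (fst p - R)) * (snd p + R - (snd p - R))) + / (2 * (m / 32)) * E)); [lra|].
      right. field. lra. }
    replace (256 * E) with (2 * m * (128 / m * E)) by (field; lra).
    replace (R ^ 2 * m ^ 2) with (2 * m * (R ^ 2 * m / 2)) by field.
    apply Rmult_le_compat_l; lra.
  - rewrite <- Hm. replace (R ^ 2 * 0 ^ 2) with 0 by ring. apply Rmult_le_pos; [lra|].
    assert (H2 := cont_left_sqr S X HS).
    apply RInt_ge_0; [lra|apply (ex_RInt_outer _ X); [exact H2|lra|exact HX|lra]|].
    intros x Hx. apply (inner_nonneg (fun x y => S x y ^ 2) X); [exact H2|lra|lra|intros; apply pow2_ge_0].
Qed.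

(** * Rotations of the sphere *)

(* [G] is a rotation of the sphere sending [o] to [0] and [h] the squared chordal distance to [o];
   [c] is the inverse of one of the two charts, in which [G] is a Moebius transformation. *)
Definition rotation_in_chart (G : option C -> C) (h : option C -> R) (c : C -> option C) : Prop :=
  exists (al be ga de : C) (N : R), 0 < N /\
    Cmod (al * de - be * ga) = N /\
    (forall u : C, Cmod (al * u + be) ^ 2 + Cmod (ga * u + de) ^ 2 = N * (1 + Cmod u ^ 2)) /\
    (forall u : C, h (c u) = Cmod (al * u + be) ^ 2 / (N * (1 + Cmod u ^ 2))) /\
    (forall u : C, (ga * u + de)%C <> RtoC 0 -> G (c u) = ((al * u + be) / (ga * u + de))%C).

(** Let [[a : b]] be homogeneous coordinates of [o]. The matrix with rows [(b, - a)] and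
    [(Cconj a, Cconj b)] is a multiple of a unitary one and sends [[a : b]] to the origin. In the
    chart at infinity its columns are exchanged and the determinant changes sign, which is why
    [rotation_in_chart] records only its modulus. *)
Lemma rotation_exists (o : option C) : exists G h, h o = 0 /\
  rotation_in_chart G h Some /\ rotation_in_chart G h recip.
Proof.
  set (a := match o with Some w => w | None => RtoC 1 end).
  set (b := match o with Some _ => RtoC 1 | None => RtoC 0 end).
  set (N := Cmod a ^ 2 + Cmod b ^ 2).
  assert (HN : 0 < N).
  { unfold N, a, b. destruct o as [w|]; rewrite Cmod_1; [generalize (pow2_ge_0 (Cmod w)); lra|].
    generalize (pow2_ge_0 (Cmod 0)). lra. }
  assert (Id : forall x y u : C, Cmod (x * u + y) ^ 2 + Cmod (Cconj y * u - Cconj x) ^ 2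
     = (Cmod x ^ 2 + Cmod y ^ 2) * (1 + Cmod u ^ 2)).
  { intros x y u. rewrite !Cmod_sqr. simpl. ring. }
  assert (Id0 : forall x : C, (x * Cconj x)%C = RtoC (Cmod x ^ 2)).
  { intros x. rewrite <- Cmod2_conj. rewrite RtoC_pow. reflexivity. }
  (* Where a denominator vanishes the point should go to infinity and the value written here is
     meaningless; [rotation_in_chart] makes no claim about [G] there. *)
  exists (fun o' => match o' with Some w => ((b * w - a) / (Cconj a * w + Cconj b))%C | None => (b / Cconj a)%C end).
  exists (fun o' => match o' with Some w => Cmod (b * w - a) ^ 2 / (N * (1 + Cmod w ^ 2)) | None => Cmod b ^ 2 / N end).
  split.
  { unfold a, b. destruct o as [w|].
    - replace (1 * w - w)%C with (RtoC 0) by ring. rewrite Cmod_0. unfold Rdiv. ring.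
    - rewrite Cmod_0. unfold Rdiv. ring. }
  split.
  - exists b, (- a)%C, (Cconj a), (Cconj b), N. split; [exact HN|]. split; [|split; [|split]].
    + replace (b * Cconj b - - a * Cconj a)%C with (b * Cconj b + a * Cconj a)%C by ring.
      rewrite !Id0, <- RtoC_plus, Cmod_R, Rabs_pos_eq; unfold N in *; lra.
    + intros u. assert (I := Id b (- a)%C u). rewrite Cmod_opp in I.
      replace (Cconj (- a) * u - Cconj b)%C with (- (Cconj a * u + Cconj b))%C in I
        by (apply injective_projections; simpl; ring).
      rewrite Cmod_opp in I. rewrite I. unfold N. ring.
    + intros u. reflexivity.
    + intros u _. reflexivity.
  - exists (- a)%C, b, (Cconj b), (Cconj a), N. split; [exact HN|]. split; [|split; [|split]].
    + replace (- a * Cconj a - b * Cconj b)%C with (- (a * Cconj a + b * Cconj b))%C by ring.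
      rewrite Cmod_opp, !Id0, <- RtoC_plus, Cmod_R, Rabs_pos_eq; unfold N in *; lra.
    + intros u. assert (I := Id (- a)%C b u). rewrite Cmod_opp in I.
      replace (Cconj b * u - Cconj (- a))%C with (Cconj b * u + Cconj a)%C in I
        by (apply injective_projections; simpl; ring).
      exact I.
    + intros u. destruct (Ceq_dec u (RtoC 0)) as [->|E].
      * rewrite recip_0. replace (- a * 0 + b)%C with b by ring. rewrite Cmod_0. f_equal. ring.
      * rewrite recip_neq0 by exact E. assert (P := proj1 (Cmod_gt_0 _) E).
        replace (b * / u - a)%C with ((- a * u + b) / u)%C by (field; exact E).
        rewrite Cmod_div, Cmod_inv by exact E. assert (Q := one_plus_sq_pos (Cmod u)). field.
        repeat split; lra.
    + intros u Hu. destruct (Ceq_dec u (RtoC 0)) as [->|E].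
      * rewrite recip_0. replace (- a * 0 + b)%C with b by ring. replace (Cconj b * 0 + Cconj a)%C with (Cconj a) by ring. reflexivity.
      * rewrite recip_neq0 by exact E.
        replace (Cconj a * / u + Cconj b)%C with ((Cconj b * u + Cconj a) / u)%C by (field; exact E).
        field. split; assumption.
Qed.

(** Both charts take the single form [F w = c (g w)], so that the computations with Moebius
    coefficients are made once. *)
Lemma rotation_chart F S z (G : option C -> C) (h : option C -> R) :
  sph_deriv F S z -> rotation_in_chart G h Some -> rotation_in_chart G h recip ->
  exists r g g' c, 0 < r /\ rotation_in_chart G h c /\
    (forall w : C, Cmod (w - z) < r ->
       has_cderiv g w (g' w) /\ S w = Cmod (g' w) / (1 + Cmod (g w) ^ 2) /\ F w = c (g w)).
Proof.
  intros [r [g [g' [Hr [H HF]]]]] H1 H2. destruct HF as [HF|HF].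
  - exists r, g, g', Some. repeat split; try assumption; [apply H|apply H|apply HF]; assumption.
  - exists r, g, g', recip. repeat split; try assumption; [apply H|apply H|apply HF]; assumption.
Qed.

(* In terms of [A], [B], the components of the rotated map, [h = |A|^2 / (|A|^2 + |B|^2)] and
   [h' = 2 Re (conj A * conj B * (A' B - A B')) / (|A|^2 + |B|^2)^2]. *)
Lemma chordal_derive F S (z0 v : C) (t : R) (G : option C -> C) (h : option C -> R) :
  sph_deriv F S (z0 + RtoC t * v)%C -> rotation_in_chart G h Some -> rotation_in_chart G h recip ->
  exists l, is_derive (fun s : R => h (F (z0 + RtoC s * v)%C)) t l /\
    Rabs l <= S (z0 + RtoC t * v)%C * Cmod v.
Proof.
  intros HS H1 H2.
  destruct (rotation_chart F S _ G h HS H1 H2) as [r [g [g' [c [Hr [[al [be [ga [de [N [HN [Hdet [Hid [Hh _]]]]]]]]] H]]]]]].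
  set (z := (z0 + RtoC t * v)%C) in *.
  assert (Hz : Cmod (z - z) < r) by (rewrite Cmod_minus_self; exact Hr).
  destruct (H z Hz) as [Hg [HSz _]].
  set (A := fun w => (al * g w + be)%C). set (B := fun w => (ga * g w + de)%C).
  assert (Hlin : forall x y : C, has_cderiv (fun w => x * g w + y)%C z (x * g' z)%C).
  { intros x y. assert (X := has_cderiv_plus _ _ _ _ _ (has_cderiv_mult _ _ _ _ _ (has_cderiv_const x z) Hg) (has_cderiv_const y z)).
    cbv beta in X. replace (x * g' z)%C with (0 * g z + x * g' z + 0)%C by ring. exact X. }
  destruct (has_cderiv_line _ z0 v t _ (Hlin al be)) as [A1 A2].
  destruct (has_cderiv_line _ z0 v t _ (Hlin ga de)) as [B1 B2].
  set (dA := (al * g' z * v)%C) in *. set (dB := (ga * g' z * v)%C) in *.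
  change (is_derive (fun s : R => fst (A (z0 + RtoC s * v)%C)) t (fst dA)) in A1.
  change (is_derive (fun s : R => snd (A (z0 + RtoC s * v)%C)) t (snd dA)) in A2.
  change (is_derive (fun s : R => fst (B (z0 + RtoC s * v)%C)) t (fst dB)) in B1.
  change (is_derive (fun s : R => snd (B (z0 + RtoC s * v)%C)) t (snd dB)) in B2.
  set (P := Cmod (A z) ^ 2). set (Q := Cmod (B z) ^ 2).
  assert (HPQ : P + Q = N * (1 + Cmod (g z) ^ 2)) by apply Hid.
  assert (Hg1 := one_plus_sq_pos (Cmod (g z))).
  assert (HPQ0 : 0 < P + Q) by (rewrite HPQ; apply Rmult_lt_0_compat; assumption).
  set (dP := 2 * (fst (A z) * fst dA + snd (A z) * snd dA)).
  set (dQ := 2 * (fst (B z) * fst dB + snd (B z) * snd dB)).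
  assert (Hsq : forall (u1 u2 : R -> R) (d1 d2 : R), is_derive u1 t d1 -> is_derive u2 t d2 ->
    is_derive (fun s => u1 s ^ 2 + u2 s ^ 2) t (2 * (u1 t * d1 + u2 t * d2))).
  { intros u1 u2 d1 d2 U1 U2.
    assert (X1 := is_derive_pow u1 2 t d1 U1). assert (X2 := is_derive_pow u2 2 t d2 U2).
    assert (X := is_derive_plus (K := R_AbsRing) (V := R_NormedModule) _ _ _ _ _ X1 X2).
    replace (2 * (u1 t * d1 + u2 t * d2)) with (plus (INR 2 * d1 * u1 t ^ Init.Nat.pred 2) (INR 2 * d2 * u2 t ^ Init.Nat.pred 2))
      by (unfold plus; simpl; ring).
    exact X. }
  assert (DP := Hsq _ _ _ _ A1 A2). assert (DQ := Hsq _ _ _ _ B1 B2). cbv beta in DP, DQ.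
  fold z in DP, DQ. fold dP in DP. fold dQ in DQ.
  exists ((dP * Q - P * dQ) / (P + Q) ^ 2). split.
  - apply is_derive_ext_loc with (f := fun s : R => (fst (A (z0 + RtoC s * v)%C) ^ 2 + snd (A (z0 + RtoC s * v)%C) ^ 2) /
      ((fst (A (z0 + RtoC s * v)%C) ^ 2 + snd (A (z0 + RtoC s * v)%C) ^ 2) + (fst (B (z0 + RtoC s * v)%C) ^ 2 + snd (B (z0 + RtoC s * v)%C) ^ 2))).
    + assert (HV : 0 < Cmod v + 1) by (generalize (Cmod_ge_0 v); lra).
      exists (mkposreal (r / (Cmod v + 1)) ltac:(apply Rdiv_lt_0_compat; assumption)).
      intros s Hs. change (Rabs (s - t) < r / (Cmod v + 1)) in Hs. apply Rlt_div_r in Hs; [|exact HV].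
      assert (Hw : Cmod (z0 + RtoC s * v - z) < r).
      { unfold z. replace (z0 + s * v - (z0 + t * v))%C with (RtoC (s - t) * v)%C by (rewrite RtoC_minus; ring).
        rewrite Cmod_mult, Cmod_R. eapply Rle_lt_trans; [|exact Hs]. apply Rmult_le_compat_l; [apply Rabs_pos|lra]. }
      destruct (H _ Hw) as [_ [_ E]]. rewrite E, Hh, <- Hid, !Cmod_sqr. reflexivity.
    + assert (X := is_derive_plus (K := R_AbsRing) (V := R_NormedModule) _ _ _ _ _ DP DQ).
      assert (E1 : fst (A z) ^ 2 + snd (A z) ^ 2 = P) by (unfold P; rewrite Cmod_sqr; reflexivity).
      assert (E2 : fst (B z) ^ 2 + snd (B z) ^ 2 = Q) by (unfold Q; rewrite Cmod_sqr; reflexivity).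
      assert (Y := is_derive_div _ _ _ _ _ DP X). cbv beta in Y. fold z in Y. unfold plus in Y; simpl plus in Y.
      cbn [AbelianMonoid.plus] in Y.
      change (fst (A z) ^ 2 + snd (A z) ^ 2 + (fst (B z) ^ 2 + snd (B z) ^ 2) <> 0 ->
        is_derive (fun s : R => (fst (A (z0 + RtoC s * v)%C) ^ 2 + snd (A (z0 + RtoC s * v)%C) ^ 2) /
      ((fst (A (z0 + RtoC s * v)%C) ^ 2 + snd (A (z0 + RtoC s * v)%C) ^ 2) + (fst (B (z0 + RtoC s * v)%C) ^ 2 + snd (B (z0 + RtoC s * v)%C) ^ 2))) t
        ((dP * (fst (A z) ^ 2 + snd (A z) ^ 2 + (fst (B z) ^ 2 + snd (B z) ^ 2)) - (fst (A z) ^ 2 + snd (A z) ^ 2) * (dP + dQ)) / (fst (A z) ^ 2 + snd (A z) ^ 2 + (fst (B z) ^ 2 + snd (B z) ^ 2)) ^ 2)) in Y.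
      rewrite E1, E2 in Y.
      replace ((dP * Q - P * dQ) / (P + Q) ^ 2) with ((dP * (P + Q) - P * (dP + dQ)) / (P + Q) ^ 2) by (field; lra).
      apply Y. lra.
  - assert (Hnum : Rabs (dP * Q - P * dQ) <= (P + Q) * (N * (Cmod (g' z) * Cmod v))).
    { assert (E : dP * Q - P * dQ = 2 * fst (Cconj (A z) * Cconj (B z) * (dA * B z - A z * dB))%C).
      { unfold dP, dQ, P, Q. rewrite !Cmod_sqr. simpl. ring. }
      assert (E3 : (dA * B z - A z * dB)%C = ((al * de - be * ga) * (g' z * v))%C).
      { unfold dA, dB, A, B. ring. }
      rewrite E, Rabs_mult, (Rabs_pos_eq 2) by lra.
      eapply Rle_trans; [apply Rmult_le_compat_l; [lra|apply Rabs_re_le]|].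
      rewrite E3, !Cmod_mult, !Cmod_conj, Hdet. unfold P, Q.
      assert (W : 0 <= N * (Cmod (g' z) * Cmod v)).
      { apply Rmult_le_pos; [lra|]. apply Rmult_le_pos; apply Cmod_ge_0. }
      (* The inequality [2 |A| |B| <= |A| ^ 2 + |B| ^ 2] gives the Lipschitz constant [1].
         Geometrically [h] is the squared sine of the distance for [|dw| / (1 + |w| ^ 2)], a
         function of slope at most [1]. *)
      assert (W2 := pow2_ge_0 (Cmod (A z) - Cmod (B z))).
      replace (2 * (Cmod (A z) * Cmod (B z) * (N * (Cmod (g' z) * Cmod v))))
        with (2 * (Cmod (A z) * Cmod (B z)) * (N * (Cmod (g' z) * Cmod v))) by ring.
      apply Rmult_le_compat_r; [exact W|]. nra. }
    unfold Rdiv. rewrite Rabs_mult, Rabs_inv, (Rabs_pos_eq ((P + Q) ^ 2)) by apply pow2_ge_0.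
    apply Rle_div_l; [apply pow_lt, HPQ0|]. eapply Rle_trans; [exact Hnum|].
    rewrite HSz. right. replace ((P + Q) ^ 2) with ((P + Q) * (N * (1 + Cmod (g z) ^ 2))) by (rewrite <- HPQ; ring).
    field. lra.
Qed.

Lemma chordal_lipschitz F S (z0 v : C) (m : R) (G : option C -> C) (h : option C -> R) :
  rotation_in_chart G h Some -> rotation_in_chart G h recip ->
  (forall t, 0 <= t <= 1 -> sph_deriv F S (z0 + RtoC t * v)%C /\ S (z0 + RtoC t * v)%C <= m) ->
  h (F (z0 + v)%C) <= h (F z0) + m * Cmod v.
Proof.
  intros H1 H2 H.
  assert (D : forall t, 0 <= t <= 1 -> exists l, is_derive (fun s : R => h (F (z0 + RtoC s * v)%C)) t l /\
    Rabs l <= m * Cmod v).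
  { intros t Ht. destruct (H t Ht) as [Hs Hm].
    destruct (chordal_derive F S z0 v t G h Hs H1 H2) as [l [Hl Hb]]. exists l. split; [exact Hl|].
    eapply Rle_trans; [exact Hb|]. apply Rmult_le_compat_r; [apply Cmod_ge_0|exact Hm]. }
  destruct (MVT_gen (fun s : R => h (F (z0 + RtoC s * v)%C)) 0 1 (Derive (fun s : R => h (F (z0 + RtoC s * v)%C)))) as [t [Ht E]].
  - rewrite Rmin_left, Rmax_right by lra. intros t Ht. destruct (D t ltac:(lra)) as [l [Hl _]].
    apply Derive_correct. exists l. exact Hl.
  - rewrite Rmin_left, Rmax_right by lra. intros t Ht. destruct (D t Ht) as [l [Hl _]].
    apply continuity_pt_filterlim. apply (@ex_derive_continuous R_AbsRing R_NormedModule). exists l. exact Hl.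
  - rewrite Rmin_left, Rmax_right in Ht by lra. destruct (D t Ht) as [l [Hl Hb]].
    rewrite (is_derive_unique _ _ _ Hl) in E.
    replace (z0 + RtoC 1 * v)%C with (z0 + v)%C in E by ring.
    replace (z0 + RtoC 0 * v)%C with z0 in E by ring.
    assert (X := Rle_abs l). lra.
Qed.

(** Since [1 - h = |B| ^ 2 / (|A| ^ 2 + |B| ^ 2)] is [1 / (1 + |G| ^ 2)], the last equation says
    that the rotation preserves the spherical derivative. The condition [h (F z) < 1] keeps the
    rotated value away from infinity. *)
Lemma rotated_deriv F S (z : C) (G : option C -> C) (h : option C -> R) :
  rotation_in_chart G h Some -> rotation_in_chart G h recip -> sph_deriv F S z -> h (F z) < 1 ->
  exists r, 0 < r /\ forall w : C, Cmod (w - z) < r ->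
    exists k, has_cderiv (fun w => G (F w)) w k /\ Cmod k * (1 - h (F w)) = S w.
Proof.
  intros H1 H2 HS Hlt.
  destruct (rotation_chart F S _ G h HS H1 H2) as [r [g [g' [c [Hr [[al [be [ga [de [N [HN [Hdet [Hid [Hh HG]]]]]]]]] H]]]]]].
  assert (Hz : Cmod (z - z) < r) by (rewrite Cmod_minus_self; exact Hr).
  assert (Hco : forall w : C, Cmod (w - z) < r -> (1 - h (F w)) * (N * (1 + Cmod (g w) ^ 2)) = Cmod (ga * g w + de) ^ 2).
  { intros w Hw. destruct (H w Hw) as [_ [_ E]]. rewrite E, Hh.
    assert (I := Hid (g w)). assert (Q := one_plus_sq_pos (Cmod (g w))).
    replace (Cmod (ga * g w + de) ^ 2) with (N * (1 + Cmod (g w) ^ 2) - Cmod (al * g w + be) ^ 2) by lra.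
    field. split; lra. }
  assert (Hlin : forall (x y w : C), Cmod (w - z) < r -> has_cderiv (fun w => x * g w + y)%C w (x * g' w)%C).
  { intros x y w Hw. assert (X := has_cderiv_plus _ _ _ _ _ (has_cderiv_mult _ _ _ _ _ (has_cderiv_const x w) (proj1 (H w Hw))) (has_cderiv_const y w)).
    cbv beta in X. replace (x * g' w)%C with (0 * g w + x * g' w + 0)%C by ring. exact X. }
  assert (Hden : (ga * g z + de)%C <> RtoC 0).
  { apply Cmod_gt_0. assert (E := Hco z Hz). assert (Q := one_plus_sq_pos (Cmod (g z))).
    assert (P : 0 < Cmod (ga * g z + de) ^ 2).
    { rewrite <- E. repeat apply Rmult_lt_0_compat; lra. }
    assert (P2 := Cmod_ge_0 (ga * g z + de)). destruct P2 as [P2|P2]; [exact P2|].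
    rewrite <- P2 in P. simpl in P. lra. }
  assert (Hloc := continuous_neq0 _ _ (has_cderiv_continuous _ _ _ (Hlin ga de z Hz)) Hden).
  apply locally_C_iff in Hloc. destruct Hloc as [d [Hd Hne]].
  exists (Rmin r d). split; [apply Rmin_pos; assumption|]. intros w Hw.
  assert (Hw1 := Rlt_le_trans _ _ _ Hw (Rmin_l _ _)). assert (Hw2 := Rlt_le_trans _ _ _ Hw (Rmin_r _ _)).
  assert (Hdw := Hne w Hw2). cbv beta in Hdw.
  assert (X := has_cderiv_div _ _ _ _ _ (Hlin al be w Hw1) (Hlin ga de w Hw1) Hdw). cbv beta in X.
  eexists. split.
  - eapply has_cderiv_ext_loc; [|exact X].
    assert (Hb := locally_ball_C z w (Rmin r d) Hw). revert Hb. apply locally_C_imp. intros u Hu.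
    assert (Hu1 := Rlt_le_trans _ _ _ Hu (Rmin_l _ _)). assert (Hu2 := Rlt_le_trans _ _ _ Hu (Rmin_r _ _)).
    destruct (H u Hu1) as [_ [_ E]]. rewrite E. symmetry. apply HG. apply (Hne u Hu2).
  - destruct (H w Hw1) as [_ [ES _]]. rewrite ES.
    replace ((al * g' w * (ga * g w + de) - (al * g w + be) * (ga * g' w)))%C
      with ((al * de - be * ga) * g' w)%C by ring.
    rewrite Cmod_div by (apply Cmult_neq_0; assumption). rewrite !Cmod_mult, Hdet.
    assert (E := Hco w Hw1). assert (Q := one_plus_sq_pos (Cmod (g w))).
    assert (Pd := proj1 (Cmod_gt_0 _) Hdw).
    replace (Cmod (ga * g w + de) * Cmod (ga * g w + de)) with ((1 - h (F w)) * (N * (1 + Cmod (g w) ^ 2)))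
      by (rewrite E; ring).
    assert (Hk : 1 - h (F w) <> 0).
    { intros Z. rewrite Z in E. rewrite Rmult_0_l in E. apply (pow_lt _ 2) in Pd. lra. }
    field. repeat split; lra.
Qed.

(** * Epsilon-regularity *)

(** Compactness by [bisection]: a bound on the four quarters gives one on the rectangle, and
    continuity gives one near each point. *)
Lemma bounded_on_rect (S : C -> R) (a b c d : R) : a <= b -> c <= d ->
  (forall z, in_rect a b c d z -> continuous S z) ->
  exists M, forall z, in_rect a b c d z -> S z <= M.
Proof.
  intros Hab Hcd H.
  assert (B := bisection (fun x y l => exists M, forall z,
    in_rect x (x + l * (b - a)) y (y + l * (d - c)) z -> S z <= M) a c (b - a) (d - c) ltac:(lra) ltac:(lra)).
  cbv beta in B. replace (a + 1 * (b - a)) with b in B by ring. replace (c + 1 * (d - c)) with d in B by ring.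
  apply B; clear B.
  - intros x y l Hl X1 X2 Y1 Y2 [M1 H1] [M2 H2] [M3 H3] [M4 H4].
    replace (x + l / 2 * (b - a) + l / 2 * (b - a)) with (x + l * (b - a)) in * by field.
    replace (y + l / 2 * (d - c) + l / 2 * (d - c)) with (y + l * (d - c)) in * by field.
    exists (Rmax (Rmax M1 M2) (Rmax M3 M4)). intros z [Z1 Z2].
    assert (L1 := Rmax_l (Rmax M1 M2) (Rmax M3 M4)). assert (L2 := Rmax_r (Rmax M1 M2) (Rmax M3 M4)).
    assert (K1 := Rmax_l M1 M2). assert (K2 := Rmax_r M1 M2).
    assert (K3 := Rmax_l M3 M4). assert (K4 := Rmax_r M3 M4).
    destruct (Rle_lt_dec (fst z) (x + l / 2 * (b - a))); destruct (Rle_lt_dec (snd z) (y + l / 2 * (d - c))).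
    + specialize (H1 z). unfold in_rect in H1. lra.
    + specialize (H3 z). unfold in_rect in H3. lra.
    + specialize (H2 z). unfold in_rect in H2. lra.
    + specialize (H4 z). unfold in_rect in H4. lra.
  - intros p q Hp Hq.
    assert (Hc : continuous S (p, q)) by (apply H; unfold in_rect; simpl; lra).
    destruct (proj1 (continuous_R_eps S (p, q)) Hc 1 ltac:(lra)) as [del [Hdel HD]].
    set (D := b - a + (d - c) + 1). assert (HDp : 0 < D) by (unfold D; lra).
    exists (del / D). split; [apply Rdiv_lt_0_compat; assumption|].
    intros x y l [Hl1 Hl2] X1 X2 Y1 Y2 P1 P2. apply Rlt_div_r in Hl2; [|exact HDp].
    exists (S (p, q) + 1). intros z [Z1 Z2].
    assert (A : Rabs (S z - S (p, q)) < 1).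
    { apply HD. eapply Rle_lt_trans; [apply Cmod_le_Rabs|]. simpl.
      apply Rle_lt_trans with (l * (b - a) + l * (d - c)); [|unfold D in Hl2; lra].
      apply Rplus_le_compat; apply Rabs_le; lra. }
    apply Rabs_def2 in A. lra.
Qed.

Lemma sph_deriv_nonneg F S z : sph_deriv F S z -> 0 <= S z.
Proof.
  intros [r [g [g' [Hr [H _]]]]]. destruct (H z) as [_ ->]; [rewrite Cmod_minus_self; exact Hr|].
  apply Rmult_le_pos; [apply Cmod_ge_0|]. left. apply Rinv_0_lt_compat, one_plus_sq_pos.
Qed.

Lemma dint_ext (f g : R -> R -> R) (a b c d : R) : (forall x y, f x y = g x y) ->
  dint f a b c d = dint g a b c d.
Proof.
  intros H. unfold dint. apply RInt_ext. intros x _. apply RInt_ext. intros y _. apply H.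
Qed.

(* A chart rotated so that [F p] becomes [0] is bounded by [1] on the whole square: there the chordal
   distance to [F p] is at most [sup S] times the diameter. *)
Lemma sph_deriv_le_area F S (p : C) (R m : R) : 0 < R -> fst p + R < 0 ->
  (forall z, fst z < 0 -> sph_deriv F S z) ->
  (forall z, in_sq R z -> S (p + z)%C <= m) -> 4 * m * R <= 1 ->
  R ^ 2 * S p ^ 2 <= 256 * dint (fun x y => S (x, y) ^ 2) (fst p - R) (fst p + R) (snd p - R) (snd p + R).
Proof.
  intros HR Hp HS Hm HmR.
  destruct (rotation_exists (F p)) as [G [h [Hh0 [H1 H2]]]].
  assert (Hleft : forall z, in_sq R z -> fst (p + z)%C < 0) by (intros z [Hz _]; simpl; lra).
  assert (S0 : in_sq R (RtoC 0)) by (unfold in_sq, in_rect; simpl; lra).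
  assert (Hm0 : 0 <= m).
  { apply Rle_trans with (S (p + 0)%C); [|apply Hm, S0]. apply (sph_deriv_nonneg F), HS, Hleft, S0. }
  (* From [Cmod z <= 2 * R] and [4 * m * R <= 1]. The bound [1 / 2] describes a hemisphere, and
     there [Cmod (g' w) * (1 - h (F w)) = S w] yields the factor [2] required by
     [deriv_sqr_le_dint]. *)
  assert (Hh : forall z, in_sq R z -> h (F (p + z)%C) <= 1 / 2).
  { intros z Hz. eapply Rle_trans.
    - apply (chordal_lipschitz F S p z m G h H1 H2). intros t Ht.
      assert (Htz : in_sq R (RtoC t * z)%C).
      { destruct Hz as [Z1 Z2]. unfold in_sq, in_rect. simpl. split; nra. }
      split; [apply HS, Hleft, Htz|apply Hm, Htz].
    - rewrite Hh0. assert (Z := in_sq_le R z Hz). nra. }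
  set (g := fun w => G (F w)).
  set (g' := fun w : C => epsilon (inhabits (RtoC 0)) (fun k : C => has_cderiv g w k)).
  assert (Hloc : forall z, in_sq R z -> exists r, 0 < r /\ forall w : C, Cmod (w - (p + z)) < r ->
     has_cderiv g w (g' w) /\ Cmod (g' w) * (1 - h (F w)) = S w).
  { intros z Hz. destruct (rotated_deriv F S (p + z)%C G h H1 H2 (HS _ (Hleft z Hz))) as [r [Hr Hr']].
    - assert (X := Hh z Hz). lra.
    - exists r. split; [exact Hr|]. intros w Hw. destruct (Hr' w Hw) as [k [Hk1 Hk2]].
      assert (Hgw : has_cderiv g w (g' w)).
      { apply (epsilon_spec (inhabits (RtoC 0)) (fun k : C => has_cderiv g w k)). exists k. exact Hk1. }
      split; [exact Hgw|]. rewrite (has_cderiv_unique g w (g' w) k Hgw Hk1). exact Hk2. }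
  set (T := fun x y => Rabs (S (x, y))).
  assert (HT : cont_left T 0).
  { intros x y Hx. apply (continuity_1d_2d_pt_comp Rabs (fun x y => S (x, y))).
    - apply Rcontinuity_abs.
    - apply continuous_continuity_2d. apply (sph_deriv_continuous F), HS. exact Hx. }
  rewrite (dint_ext _ (fun x y => T x y ^ 2)) by (intros; unfold T; symmetry; apply pow2_abs).
  assert (HSp : S p <= Cmod (g' p)).
  { destruct (Hloc _ S0) as [r [Hr Hr']]. destruct (Hr' p) as [_ E].
    - replace (p - (p + 0))%C with (RtoC 0) by ring. rewrite Cmod_0. exact Hr.
    - rewrite Hh0 in E. lra. }
  apply Rle_trans with (R ^ 2 * Cmod (g' p) ^ 2).
  - apply Rmult_le_compat_l; [apply pow2_ge_0|]. apply pow_incr. split; [|exact HSp].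
    apply (sph_deriv_nonneg F), HS. lra.
  - apply (deriv_sqr_le_dint g g' T p R 0 HR Hp HT); [intros; apply Rabs_pos|].
    intros z Hz. destruct (Hloc z Hz) as [r [Hr Hr']].
    assert (Hc : Cmod (p + z - (p + z)) < r) by (rewrite Cmod_minus_self; exact Hr).
    destruct (Hr' _ Hc) as [D E]. split; [exact D|]. split.
    + apply (has_cderiv_continuous_deriv g g' _ r Hr). intros w Hw. apply (Hr' w Hw).
    + unfold T. change (fst p + fst z, snd p + snd z) with (p + z)%C.
      assert (X := Hh z Hz). assert (Y := Cmod_ge_0 (g' (p + z)%C)). assert (Z := Rle_abs (S (p + z)%C)). nra.
Qed.

(* Among the points [z] of the square take one nearly maximizing [dist z * S z], [dist] being the
   distance to the boundary: around it [S] is under control at the scale where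
   [sph_deriv_le_area] applies. *)
Theorem eps_regularity F S (p : C) (r : R) : 0 < r -> fst p + r < 0 ->
  (forall z, fst z < 0 -> sph_deriv F S z) ->
  dint (fun x y => S (x, y) ^ 2) (fst p - r) (fst p + r) (snd p - r) (snd p + r) < 1 / 65536 ->
  r ^ 2 * S p ^ 2 <= 4096 * dint (fun x y => S (x, y) ^ 2) (fst p - r) (fst p + r) (snd p - r) (snd p + r).
Proof.
  intros Hr Hp HS HE. set (E := dint _ _ _ _ _) in *.
  assert (HSc : cont_left (fun x y => S (x, y)) 0).
  { intros x y Hx. apply continuous_continuity_2d, (sph_deriv_continuous F), HS, Hx. }
  assert (HS2 := cont_left_sqr _ _ HSc).
  assert (Hsub : forall a b c d, fst p - r <= a -> a <= b -> b <= fst p + r -> snd p - r <= c -> c <= d -> d <= snd p + r ->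
    dint (fun x y => S (x, y) ^ 2) a b c d <= E).
  { intros. apply (dint_subset _ 0); try assumption. intros; apply pow2_ge_0. }
  assert (Hnn : forall z, fst z < 0 -> 0 <= S z) by (intros z Hz; apply (sph_deriv_nonneg F), HS, Hz).
  assert (HSp := Hnn p ltac:(lra)).
  destruct HSp as [HSp|HSp].
  2:{ rewrite <- HSp. replace (r ^ 2 * 0 ^ 2) with 0 by ring. apply Rmult_le_pos; [lra|].
      apply Rle_trans with (dint (fun x y => S (x, y) ^ 2) (fst p) (fst p) (snd p) (snd p)); [|apply Hsub; lra].
      right. unfold dint. symmetry. apply (@RInt_point R_CompleteNormedModule). }
  destruct (bounded_on_rect S (fst p - r) (fst p + r) (snd p - r) (snd p + r)) as [M HM]; [lra|lra| |].
  { intros z [Hz _]. apply (sph_deriv_continuous F), HS. lra. }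
  set (A := fun v => exists z d, 0 <= d /\ fst p - r + d <= fst z /\ fst z <= fst p + r - d /\
     snd p - r + d <= snd z /\ snd z <= snd p + r - d /\ v = d * S z).
  destruct (completeness A) as [m [Hm1 Hm2]].
  { exists (r * M). intros v [z [d [Hd [X1 [X2 [Y1 [Y2 ->]]]]]]].
    assert (SM : S z <= M) by (apply HM; unfold in_rect; lra).
    assert (0 <= S z) by (apply Hnn; lra). apply Rmult_le_compat; lra. }
  { exists (r * S p), p, r. repeat split; lra. }
  assert (Hrm : r * S p <= m) by (apply Hm1; exists p, r; repeat split; lra).
  assert (Hm0 : 0 < m) by (eapply Rlt_le_trans; [|exact Hrm]; apply Rmult_lt_0_compat; assumption).
  assert (Hz : exists z d, 0 <= d /\ fst p - r + d <= fst z /\ fst z <= fst p + r - d /\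
     snd p - r + d <= snd z /\ snd z <= snd p + r - d /\ m / 2 < d * S z).
  { apply NNPP. intros Hn. assert (X : m <= m / 2); [|lra]. apply Hm2.
    intros v [z [d [Hd [X1 [X2 [Y1 [Y2 ->]]]]]]]. apply Rnot_lt_le. intros Hlt. apply Hn.
    exists z, d. repeat split; assumption. }
  destruct Hz as [q [d [Hd [X1 [X2 [Y1 [Y2 Hq]]]]]]].
  assert (Hq0 : 0 <= S q) by (apply Hnn; lra).
  assert (Hd0 : 0 < d) by (destruct Hd as [|<-]; [assumption|lra]).
  assert (Hs0 : 0 < S q) by (destruct Hq0 as [|E0]; [assumption|rewrite <- E0 in Hq; lra]).
  set (sg := S q) in *.
  (* Within [d / 2] of [q] the distance to the boundary is still at least [d / 2], so
     [S <= 2 * m / d <= 4 * sg]. For this bound [sph_deriv_le_area] requires [16 * sg * R <= 1],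
     which is the second term. *)
  set (R := Rmin (d / 2) (/ (16 * sg))).
  assert (Hi : 0 < / (16 * sg)) by (apply Rinv_0_lt_compat; lra).
  assert (HR : 0 < R) by (unfold R; apply Rmin_pos; lra).
  assert (HR1 : R <= d / 2) by apply Rmin_l. assert (HR2 : R <= / (16 * sg)) by apply Rmin_r.
  assert (Hbound : forall z, in_sq R z -> S (q + z)%C <= 4 * sg).
  { intros z [Z1 Z2].
    assert (V : d / 2 * S (q + z)%C <= m).
    { apply Hm1. exists (q + z)%C, (d / 2). simpl. repeat split; lra. }
    apply (Rmult_le_reg_l (d / 2)); [lra|]. lra. }
  assert (HsR : 16 * sg * R <= 1).
  { apply Rle_trans with (16 * sg * / (16 * sg)); [apply Rmult_le_compat_l; lra|]. right. field. lra. }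
  assert (K := sph_deriv_le_area F S q R (4 * sg) HR ltac:(lra) HS Hbound ltac:(lra)).
  assert (K2 := Hsub (fst q - R) (fst q + R) (snd q - R) (snd q + R) ltac:(lra) ltac:(lra) ltac:(lra) ltac:(lra) ltac:(lra) ltac:(lra)).
  fold sg in K.
  assert (K3 : (R * sg) ^ 2 <= 256 * E) by (rewrite Rpow_mult_distr; lra).
  (* Origin of the threshold: if the second term were the smaller one, [(R * sg) ^ 2] would be
     [1 / 256], and [K3] would force [E >= 1 / 65536]. *)
  assert (K4 : R = d / 2).
  { unfold R. apply Rmin_left. apply Rnot_lt_le. intros Hlt.
    assert (ER : R = / (16 * sg)) by (unfold R; apply Rmin_right; lra).
    rewrite ER in K3. replace (/ (16 * sg) * sg) with (1 / 16) in K3 by (field; lra). lra. }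
  rewrite K4 in K3.
  (* By the choice of [q], [r * S p <= m < 2 * d * sg]. Squaring the factor [4] gives
     [16 * 256 = 4096]. *)
  assert (K5 : r * S p <= 4 * (d / 2 * sg)) by lra.
  assert (K6 : (r * S p) ^ 2 <= (4 * (d / 2 * sg)) ^ 2).
  { apply pow_incr. split; [|exact K5]. left. apply Rmult_lt_0_compat; assumption. }
  rewrite Rpow_mult_distr in K6. rewrite (Rpow_mult_distr 4) in K6. lra.
Qed.

(** * Auxiliary facts on integrals, periods and the exponential *)

Lemma Rint_is_RInt (g : R -> R) (a b v : R) : Rint g a b v <-> is_RInt g a b v.
Proof.
  split.
  - intros [pr <-]. rewrite <- RInt_Reals. apply (@RInt_correct R_CompleteNormedModule).
    apply ex_RInt_Reals_1, pr.
  - intros H. exists (ex_RInt_Reals_0 g a b (ex_intro _ _ H)). rewrite <- RInt_Reals. apply is_RInt_unique, H.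
Qed.

Lemma RInt_periodic (u : R -> R) (T y : R) : (forall t, continuous u t) -> (forall t, u (T + t) = u t) ->
  RInt u y (y + T) = RInt u 0 T.
Proof.
  intros Hc Hp.
  assert (E : forall a b, ex_RInt u a b) by (intros; apply (@ex_RInt_continuous R_CompleteNormedModule); auto).
  assert (A : RInt u (T + 0) (T + y) = RInt u 0 y).
  { rewrite <- RInt_shift by apply E. apply RInt_ext. intros; apply Hp. }
  rewrite Rplus_0_r in A. rewrite (Rplus_comm y T).
  rewrite <- (RInt_Chasles u y 0 (T + y)) by apply E.
  rewrite <- (RInt_Chasles u 0 T (T + y)) by apply E. rewrite A.
  rewrite <- (opp_RInt_swap u 0 y) by apply E. unfold plus, opp; simpl. ring.
Qed.

Lemma exp_lt_1 (x : R) : x < 0 -> exp x < 1.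
Proof. intros H. rewrite <- exp_0. apply exp_increasing, H. Qed.

Lemma cexp_periodic (x y : R) : cexp (x, 2 * PI + y) = cexp (x, y).
Proof.
  unfold cexp; simpl. rewrite (Rplus_comm (2 * PI) y), cos_plus, sin_plus, cos_2PI, sin_2PI.
  f_equal; ring.
Qed.

(** * Area in logarithmic coordinates *)

(* If [s z = |f' z| (1 - |z|^2) / (1 + |f z|^2)] then this is the corresponding derivative of
   [f o exp], for the metric |dw| / (1 + |w|^2). *)
Definition log_density (s : C -> R) (z : C) : R := s (cexp z) / (1 - Cmod (cexp z) ^ 2) * Cmod (cexp z).

Definition circle_area (S : C -> R) (x : R) : R := RInt (fun y => S (x, y) ^ 2) 0 (2 * PI).

(** The substitution [rho = exp x] turns the polar area into the integral of [4 * circle_area S],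
    whence [M / 4]. The integral from [0] to [exp x1] is nonnegative and is dropped, so the centre,
    which has no logarithm, never enters. *)
Lemma circle_area_bound (s : C -> R) (S : C -> R) : S = log_density s -> finite_sph_area s ->
  cont_left (fun x y => S (x, y) ^ 2) 0 ->
  exists M, forall x1 x2, x1 <= x2 -> x2 < 0 -> RInt (circle_area S) x1 x2 <= M.
Proof.
  intros HSdef [M HM] HS. exists (M / 4). intros x1 x2 H12 Hx2.
  assert (HPI := PI_RGT_0).
  destruct (HM (exp x2) (conj (exp_pos x2) (exp_lt_1 x2 Hx2))) as [I [HI [v [Hv HvM]]]].
  apply Rint_is_RInt in Hv.
  assert (HIn : forall rho, 0 <= rho <= exp x2 -> 0 <= I rho).
  { intros rho Hrho. specialize (HI rho Hrho). apply Rint_is_RInt in HI.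
    assert (HI' := is_RInt_unique _ _ _ _ HI). rewrite <- HI'. apply RInt_ge_0; [lra|eexists; exact HI|].
    intros phi _. apply Rmult_le_pos; [apply pow2_ge_0|lra]. }
  set (J := fun rho => 4 * circle_area S (ln rho) / rho).
  assert (HIJ : forall rho, 0 < rho <= exp x2 -> I rho = J rho).
  { intros rho [Hr1 Hr2]. assert (HI' := HI rho ltac:(lra)). apply Rint_is_RInt in HI'.
    apply (is_RInt_unique (V := R_CompleteNormedModule)) in HI'. rewrite <- HI'. unfold J, circle_area.
    assert (Hr3 : rho < 1) by (generalize (exp_lt_1 x2 Hx2); lra).
    assert (Hln : ln rho < 0) by (rewrite <- ln_1; apply ln_increasing; lra).
    assert (Ex := ex_RInt_inner _ 0 (ln rho) 0 (2 * PI) HS ltac:(lra) Hln).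
    replace (4 * RInt (fun y => S (ln rho, y) ^ 2) 0 (2 * PI) / rho)
      with (4 / rho * RInt (fun y => S (ln rho, y) ^ 2) 0 (2 * PI)) by (unfold Rdiv; ring).
    assert (Sc : RInt (fun y => 4 / rho * S (ln rho, y) ^ 2) 0 (2 * PI) = 4 / rho * RInt (fun y => S (ln rho, y) ^ 2) 0 (2 * PI)).
    { apply (@RInt_scal R_CompleteNormedModule). exact Ex. }
    rewrite <- Sc. apply RInt_ext. intros y _. rewrite HSdef. unfold log_density. rewrite Cmod_cexp.
    unfold cexp. simpl fst. simpl snd. rewrite exp_ln by exact Hr1.
    match goal with |- @eq _ ?l ?r => change (@eq R l r) end. field. split; [nra|lra]. }
  assert (Hac : forall x, x < 0 -> continuous (circle_area S) x).
  { intros x Hx. apply (inner_continuous (fun x y => S (x, y) ^ 2) 0); [exact HS|lra|exact Hx]. }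
  assert (HJ : RInt J (exp x1) (exp x2) = 4 * RInt (circle_area S) x1 x2).
  { rewrite <- (RInt_comp (V := R_CompleteNormedModule) J exp exp x1 x2).
    - assert (Ex : ex_RInt (circle_area S) x1 x2).
      { apply ex_RInt_cont_on; [exact H12|]. intros x Hx. apply Hac. lra. }
      assert (Sc : RInt (fun x => 4 * circle_area S x) x1 x2 = 4 * RInt (circle_area S) x1 x2).
      { apply (@RInt_scal R_CompleteNormedModule). exact Ex. }
      rewrite <- Sc. apply RInt_ext. intros x _. unfold J. rewrite ln_exp. unfold scal; simpl; unfold mult; simpl.
      assert (P := exp_pos x).
      match goal with |- @eq _ ?l ?r => change (@eq R l r) end. field. lra.
    - intros x Hx. rewrite Rmin_left, Rmax_right in Hx by exact H12. unfold J.
      apply (continuous_Rdiv (fun rho => 4 * circle_area S (ln rho)) (fun rho => rho)).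
      + apply (@continuous_mult _ R_AbsRing (fun _ => 4) (fun rho => circle_area S (ln rho))); [apply continuous_const|].
        apply (continuous_comp ln (circle_area S)).
        * apply (@ex_derive_continuous R_AbsRing R_NormedModule). exists (/ exp x). apply is_derive_ln, exp_pos.
        * rewrite ln_exp. apply Hac. lra.
      + apply continuous_id.
      + generalize (exp_pos x). lra.
    - intros x _. split; [auto_derive; [auto|ring]|].
      apply (@ex_derive_continuous R_AbsRing R_NormedModule). auto_derive. auto. }
  assert (He : exp x1 <= exp x2) by (destruct H12 as [H|<-]; [left; apply exp_increasing, H|right; reflexivity]).
  assert (Hp1 := exp_pos x1).
  assert (E1 : ex_RInt I 0 (exp x2)) by (eexists; exact Hv).
  assert (E2 : ex_RInt I 0 (exp x1)) by (apply (@ex_RInt_Chasles_1 R_CompleteNormedModule) with (exp x2); [lra|exact E1]).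
  assert (E3 : ex_RInt I (exp x1) (exp x2)) by (apply (@ex_RInt_Chasles_2 R_CompleteNormedModule) with 0; [lra|exact E1]).
  assert (Ch := RInt_Chasles I 0 (exp x1) (exp x2) E2 E3).
  rewrite (is_RInt_unique _ _ _ _ Hv) in Ch. unfold plus in Ch; simpl in Ch.
  assert (P : 0 <= RInt I 0 (exp x1)) by (apply RInt_ge_0; [lra|exact E2|intros; apply HIn; lra]).
  assert (Q : RInt I (exp x1) (exp x2) = RInt J (exp x1) (exp x2)).
  { apply RInt_ext. rewrite Rmin_left, Rmax_right by exact He. intros rho Hrho. apply HIJ. lra. }
  rewrite HJ in Q. lra.
Qed.

(** * Hyperbolic length as a parameter *)

Lemma tanh_half (t : R) : Defs.tanh (t / 2) = (1 - exp (- t)) / (1 + exp (- t)).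
Proof.
  unfold Defs.tanh. assert (P := exp_pos (- (t / 2))).
  assert (E1 : exp (t / 2) = / exp (- (t / 2))) by (rewrite exp_Ropp, Rinv_inv; reflexivity).
  assert (E2 : exp (- t) = exp (- (t / 2)) * exp (- (t / 2))) by (rewrite <- exp_plus; f_equal; field).
  rewrite E1, E2. field. split; nra.
Qed.

Lemma tanh_half_abs (t : R) : Rabs (Defs.tanh (t / 2)) < 1.
Proof.
  rewrite tanh_half. assert (P := exp_pos (- t)). apply Rabs_def1.
  - apply Rlt_div_l; lra.
  - apply Rlt_div_r; lra.
Qed.

Lemma tanh_half_pos (t : R) : 0 < t -> 0 < Defs.tanh (t / 2).
Proof.
  intros Ht. rewrite tanh_half. assert (P := exp_pos (- t)). assert (Q := exp_lt_1 (- t) ltac:(lra)).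
  apply Rdiv_lt_0_compat; lra.
Qed.

(** The abscissa, in logarithmic coordinates, of the circle of hyperbolic radius [t] about the
    origin. *)
Definition log_radius (t : R) : R := ln (Defs.tanh (t / 2)).

Lemma log_radius_neg (t : R) : 0 < t -> log_radius t < 0.
Proof.
  intros Ht. unfold log_radius. rewrite <- ln_1. apply ln_increasing; [apply tanh_half_pos, Ht|].
  assert (A := tanh_half_abs t). apply Rabs_def2 in A. lra.
Qed.

Lemma tanh_half_continuous (t : R) : continuous (fun t => Defs.tanh (t / 2)) t.
Proof.
  apply continuous_ext with (f := fun t => (1 - exp (- t)) / (1 + exp (- t))).
  - intros x. symmetry. apply tanh_half.
  - apply (@ex_derive_continuous R_AbsRing R_NormedModule). auto_derive.
    generalize (exp_pos (- t)). intros. lra.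
Qed.

Lemma log_radius_continuous (t : R) : 0 < t -> continuous log_radius t.
Proof.
  intros Ht. apply (continuous_comp (fun t => Defs.tanh (t / 2)) ln); [apply tanh_half_continuous|].
  apply (@ex_derive_continuous R_AbsRing R_NormedModule). exists (/ Defs.tanh (t / 2)).
  apply is_derive_ln, tanh_half_pos, Ht.
Qed.

Lemma exp_1_ge_2 : 2 <= exp 1.
Proof. generalize (exp_ineq1_le 1). lra. Qed.

(** One unit of hyperbolic radius is worth at least [exp (- t) / 2] in logarithmic coordinates,
    which dictates the size of the squares in [HS_norm_bound]. By [ln y <= y - 1] for the quotient
    [y] of the two radii, it remains to show [y <= 1 - q / 2] with [q = exp (- t)], a polynomial
    inequality that uses [exp (- (1)) <= 1 / 2]. *)
Lemma log_radius_step (t : R) : 0 < t -> log_radius t + exp (- t) / 2 <= log_radius (t + 1).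
Proof.
  intros Ht. assert (P := tanh_half_pos t Ht). assert (P' := tanh_half_pos (t + 1) ltac:(lra)).
  unfold log_radius.
  assert (H : ln (Defs.tanh (t / 2) / Defs.tanh ((t + 1) / 2)) <= Defs.tanh (t / 2) / Defs.tanh ((t + 1) / 2) - 1).
  { set (y := Defs.tanh (t / 2) / Defs.tanh ((t + 1) / 2)). assert (Hy : 0 < y) by (apply Rdiv_lt_0_compat; assumption).
    assert (A := exp_ineq1_le (ln y)). rewrite exp_ln in A by exact Hy. lra. }
  rewrite ln_div in H by assumption.
  set (q := exp (- t)). assert (Hq := exp_pos (- t)). fold q in Hq.
  assert (Hq1 : q < 1) by (apply exp_lt_1; lra).
  set (k := exp (- (1))). assert (Hk := exp_pos (- (1))). fold k in Hk.
  assert (Hk2 : k <= 1 / 2).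
  { unfold k. rewrite exp_Ropp. replace (1 / 2) with (/ 2) by field. apply Rinv_le_contravar; [lra|apply exp_1_ge_2]. }
  assert (E : exp (- (t + 1)) = q * k) by (unfold q, k; rewrite <- exp_plus; f_equal; ring).
  assert (B : Defs.tanh (t / 2) / Defs.tanh ((t + 1) / 2) <= 1 - q / 2); [|lra].
  rewrite !tanh_half, E. fold q. clearbody q k. clear - Hq Hq1 Hk Hk2.
  assert (Hqk : 0 < q * k) by (apply Rmult_lt_0_compat; lra).
  assert (Hqk2 : q * k <= q * (1 / 2)) by (apply Rmult_le_compat_l; lra).
  replace ((1 - q) / (1 + q) / ((1 - q * k) / (1 + q * k))) with (((1 - q) * (1 + q * k)) / ((1 + q) * (1 - q * k)))
    by (field; repeat split; lra).
  apply Rle_div_l; [apply Rmult_lt_0_compat; lra|].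
  set (w := q * k) in *.
  assert (X : 0 <= q * (q - 2 * w)) by (apply Rmult_le_pos; lra).
  assert (Y : 0 <= q * w * (1 + q)) by (apply Rmult_le_pos; [apply Rmult_le_pos|]; lra).
  assert (Z : 0 <= q * (1 - q)) by (apply Rmult_le_pos; lra).
  assert (W : w <= q / 2) by lra.
  lra.
Qed.

Lemma gamma_cexp (theta t : R) : 0 < t -> gamma theta t = cexp (log_radius t, theta).
Proof.
  intros Ht. unfold gamma, cexp, log_radius. simpl. rewrite exp_ln by (apply tanh_half_pos, Ht). reflexivity.
Qed.

Lemma Cmod_gamma (theta t : R) : Cmod (gamma theta t) < 1.
Proof.
  eapply Rle_lt_trans; [|apply (tanh_half_abs t)]. right.
  unfold gamma, Cmod; simpl fst; simpl snd. rewrite <- sqrt_Rsqr_abs. f_equal. unfold Rsqr.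
  replace ((Defs.tanh (t / 2) * cos theta) ^ 2 + (Defs.tanh (t / 2) * sin theta) ^ 2)
    with (Defs.tanh (t / 2) * Defs.tanh (t / 2) * (Rsqr (sin theta) + Rsqr (cos theta))) by (unfold Rsqr; ring).
  rewrite sin2_cos2. ring.
Qed.

Lemma gamma_continuous (theta t : R) : continuous (fun t : R => (gamma theta t : C)) t.
Proof.
  apply continuous_C_iff. unfold gamma. simpl.
  split; [apply (@continuous_mult _ R_AbsRing (fun t => Defs.tanh (t / 2)) (fun _ => cos theta))
         |apply (@continuous_mult _ R_AbsRing (fun t => Defs.tanh (t / 2)) (fun _ => sin theta))];
    first [apply tanh_half_continuous | apply continuous_const].
Qed.

(** * The length estimate *)

(** The integral telescopes to the one of [B] over [[rho - 1, rho + 1]] minus the one over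
    [[T - 1, T + 1]]. On both windows, of length [2], [B] lies between [L - e] and [L], so the bound
    does not depend on [rho]. *)
Lemma RInt_increment_shift (B : R -> R) (T rho L e : R) : 1 < T -> T <= rho ->
  (forall t, 0 < t -> continuous B t) -> (forall t, T - 1 <= t -> L - e <= B t <= L) ->
  RInt (fun t => B (t + 1) - B (t - 1)) T rho <= 2 * e.
Proof.
  intros HT Hrho Hc HB.
  assert (E : forall a b, T - 1 <= a -> a <= b -> ex_RInt B a b).
  { intros a b Ha Hab. apply ex_RInt_cont_on; [exact Hab|]. intros t Ht. apply Hc. lra. }
  assert (Ep : ex_RInt B (1 + T) (1 + rho)) by (apply E; lra).
  assert (Em : ex_RInt B (- (1) + T) (- (1) + rho)) by (apply E; lra).
  assert (Sp := RInt_shift B 1 T rho Ep). assert (Sm := RInt_shift B (- (1)) T rho Em).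
  assert (Hsh : forall k, - (1) <= k -> ex_RInt (fun t => B (k + t)) T rho).
  { intros k Hk. apply ex_RInt_cont_on; [exact Hrho|]. intros t Ht.
    apply (continuous_comp (fun t => k + t) B); [|apply Hc; lra].
    apply (@continuous_plus _ R_AbsRing R_NormedModule (fun _ => k)); [apply continuous_const|apply continuous_id]. }
  rewrite (RInt_ext _ (fun t => B (1 + t) - B (- (1) + t))) by
    (intros t _; rewrite (Rplus_comm 1 t), (Rplus_comm (- (1)) t); reflexivity).
  assert (D : RInt (fun t => B (1 + t) - B (- (1) + t)) T rho
    = RInt (fun t => B (1 + t)) T rho - RInt (fun t => B (- (1) + t)) T rho).
  { apply (@RInt_minus R_CompleteNormedModule); apply Hsh; lra. }
  rewrite D, Sp, Sm.
  assert (C1 := RInt_Chasles B (- (1) + T) (1 + T) (1 + rho) (E (- (1) + T) (1 + T) ltac:(lra) ltac:(lra)) Ep).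
  assert (C2 := RInt_Chasles B (- (1) + T) (- (1) + rho) (1 + rho) Em (E (- (1) + rho) (1 + rho) ltac:(lra) ltac:(lra))).
  unfold plus in C1, C2; simpl in C1, C2.
  assert (K : forall c a b, RInt (fun _ : R => c) a b = (b - a) * c).
  { intros c a b. rewrite RInt_const. reflexivity. }
  assert (B1 : RInt B (- (1) + rho) (1 + rho) <= 2 * L).
  { assert (X : 2 * L = RInt (fun _ => L) (- (1) + rho) (1 + rho)) by (rewrite K; ring). rewrite X.
    apply RInt_le; [lra|apply E; lra|apply ex_RInt_const|]. intros t Ht. apply HB. lra. }
  assert (B2 : 2 * (L - e) <= RInt B (- (1) + T) (1 + T)).
  { assert (X : 2 * (L - e) = RInt (fun _ => L - e) (- (1) + T) (1 + T)) by (rewrite K; ring). rewrite X.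
    apply RInt_le; [lra|apply ex_RInt_const|apply E; lra|]. intros t Ht. apply HB. lra. }
  lra.
Qed.

(* The square of half-side [exp (- t) / 2] around [(log_radius t, theta)] lies between the
   circles of hyperbolic radii [t - 1] and [t + 1]. *)
Lemma HS_norm_bound F (s S : C -> R) (B : R -> R) (theta t : R) : 1 < t -> S = log_density s ->
  (forall z, fst z < 0 -> sph_deriv F S z) ->
  (forall t1 t2, 0 < t1 -> t1 <= t2 -> B t2 - B t1 = RInt (circle_area S) (log_radius t1) (log_radius t2)) ->
  B (t + 1) - B (t - 1) < 1 / 65536 ->
  s (gamma theta t) ^ 2 <= 1048576 * (B (t + 1) - B (t - 1)).
Proof.
  intros Ht HSdef HS HB Hsmall.
  set (x := log_radius t). set (q := exp (- t)). set (r := q / 2).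
  assert (Hq := exp_pos (- t)). fold q in Hq.
  assert (Hq1 : q <= 1 / 2).
  { apply Rle_trans with (exp (- (1))).
    - left. apply exp_increasing. lra.
    - rewrite exp_Ropp. replace (1 / 2) with (/ 2) by field. apply Rinv_le_contravar; [lra|apply exp_1_ge_2]. }
  assert (Hx1 : x + r <= log_radius (t + 1)) by (apply log_radius_step; lra).
  assert (Hx2 : log_radius (t - 1) <= x - r).
  { assert (A := log_radius_step (t - 1) ltac:(lra)). replace (t - 1 + 1) with t in A by ring. fold x in A.
    assert (q <= exp (- (t - 1))) by (left; apply exp_increasing; lra). unfold r. lra. }
  assert (Hx3 := log_radius_neg (t + 1) ltac:(lra)).
  assert (HSc : cont_left (fun x y => S (x, y)) 0).
  { intros u v Hu. apply continuous_continuity_2d, (sph_deriv_continuous F), HS, Hu. }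
  assert (HS2 := cont_left_sqr _ _ HSc).
  assert (HPI := PI_RGT_0). assert (HPI2 : 1 < PI) by (generalize PI2_1; lra).
  set (E := dint (fun x y => S (x, y) ^ 2) (x - r) (x + r) (theta - r) (theta + r)).
  assert (HE : E <= B (t + 1) - B (t - 1)).
  { rewrite (HB (t - 1) (t + 1)) by lra.
    (* The square is enlarged to the whole annulus: a full period of angles centred at [theta],
       brought back to [[0, 2 * PI]] by periodicity. The lost localisation in the angle costs
       nothing, because the increments of [B] still telescope. *)
    apply Rle_trans with (dint (fun x y => S (x, y) ^ 2) (log_radius (t - 1)) (log_radius (t + 1)) (theta - PI) (theta - PI + 2 * PI)).
    - apply (dint_subset _ 0); try assumption; try (unfold r in *; lra). intros; apply pow2_ge_0.
    - right. unfold dint. apply RInt_ext. rewrite Rmin_left, Rmax_right by (unfold r in *; lra).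
      intros u Hu. unfold circle_area. apply (RInt_periodic (fun y => S (u, y) ^ 2)).
      + intros y. apply (continuity_2d_snd (fun x y => S (x, y) ^ 2)), HS2. lra.
      + intros y. rewrite HSdef. unfold log_density. rewrite cexp_periodic. reflexivity. }
  assert (Hreg : r ^ 2 * S (x, theta) ^ 2 <= 4096 * E).
  { apply (eps_regularity F S (x, theta) r); [unfold r; lra|simpl; lra|exact HS|].
    change (E < 1 / 65536). lra. }
  (* At radius [(1 - q) / (1 + q)] the conversion factor [(1 - |z| ^ 2) / |z|] equals
     [4 * q / (1 - q ^ 2)], and [q = 2 * r]. *)
  assert (Hs : s (gamma theta t) = 8 / (1 - q ^ 2) * (r * S (x, theta))).
  { rewrite HSdef. unfold log_density.
    replace (cexp (x, theta)) with (gamma theta t : C) by (apply gamma_cexp; lra).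
    assert (G1 : Cmod (gamma theta t) = (1 - q) / (1 + q)).
    { rewrite (gamma_cexp theta t) by lra. rewrite Cmod_cexp. simpl. unfold log_radius.
      rewrite exp_ln by (apply tanh_half_pos; lra). apply tanh_half. }
    rewrite G1. unfold r. assert (0 < 1 - q ^ 2) by nra. field. repeat split; nra. }
  rewrite Hs.
  (* A crude bound from [q <= 1 / 2]; its square [256] times [4096] is the constant [1048576]. *)
  assert (Hk : 0 <= 8 / (1 - q ^ 2) <= 16).
  { assert (0 < 1 - q ^ 2) by nra. split; [left; apply Rdiv_lt_0_compat; lra|]. apply Rle_div_l; [assumption|]. nra. }
  rewrite Rpow_mult_distr.
  assert (H8 : (8 / (1 - q ^ 2)) ^ 2 <= 256).
  { replace 256 with (16 ^ 2) by ring. apply pow_incr, Hk. }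
  rewrite (Rpow_mult_distr r).
  apply Rle_trans with (256 * (r ^ 2 * S (x, theta) ^ 2)); [|lra].
  apply Rmult_le_compat_r; [|exact H8]. apply Rmult_le_pos; apply pow2_ge_0.
Qed.

(** Cauchy-Schwarz in additive form, from [|u| <= l / 2 + u ^ 2 / (2 * l)]. A parameter [l] of order
    [1 / sqrt rho] will produce the growth [sqrt rho]. *)
Lemma Rabs_RInt_le_sqr (u : R -> R) (a b l : R) : a <= b -> 0 < l -> cont_on u a b ->
  Rabs (RInt u a b) <= l / 2 * (b - a) + / (2 * l) * RInt (fun t => u t ^ 2) a b.
Proof.
  intros Hab Hl Hu.
  assert (E : ex_RInt u a b) by (apply ex_RInt_cont_on; assumption).
  assert (E2 : ex_RInt (fun t => u t ^ 2) a b).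
  { apply ex_RInt_cont_on; [exact Hab|]. intros t Ht. apply (continuous_comp u (fun x => x ^ 2)); [apply Hu, Ht|].
    apply (@ex_derive_continuous R_AbsRing R_NormedModule). auto_derive. auto. }
  assert (E3 : ex_RInt (fun t => / (2 * l) * u t ^ 2) a b) by (apply (@ex_RInt_scal R_NormedModule); exact E2).
  assert (A : RInt (fun t => l / 2 + / (2 * l) * u t ^ 2) a b = RInt (fun _ => l / 2) a b + RInt (fun t => / (2 * l) * u t ^ 2) a b).
  { apply (@RInt_plus R_CompleteNormedModule); [apply ex_RInt_const|exact E3]. }
  assert (A' : RInt (fun t => / (2 * l) * u t ^ 2) a b = / (2 * l) * RInt (fun t => u t ^ 2) a b).
  { apply (@RInt_scal R_CompleteNormedModule). exact E2. }
  assert (A'' : RInt (fun _ => l / 2) a b = (b - a) * (l / 2)) by (rewrite RInt_const; reflexivity).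
  assert (X : l / 2 * (b - a) + / (2 * l) * RInt (fun t => u t ^ 2) a b = RInt (fun t => l / 2 + / (2 * l) * u t ^ 2) a b)
    by (rewrite A, A', A''; ring).
  rewrite X.
  eapply Rle_trans; [apply abs_RInt_le; assumption|].
  apply RInt_le; [exact Hab| | |].
  - apply (ex_RInt_cont_on (fun t => Rabs (u t))); [exact Hab|]. intros t Ht.
    apply (continuous_comp u Rabs); [apply Hu, Ht|]. apply continuity_pt_filterlim, Rcontinuity_abs.
  - apply (@ex_RInt_plus R_NormedModule); [apply ex_RInt_const|exact E3].
  - intros t _. apply Rminus_le_0. rewrite <- (pow2_abs (u t)).
    replace (l / 2 + / (2 * l) * Rabs (u t) ^ 2 - Rabs (u t)) with ((Rabs (u t) - l) ^ 2 * / (2 * l)) by (field; lra).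
    apply Rmult_le_pos; [apply pow2_ge_0|]. left. apply Rinv_0_lt_compat. lra.
Qed.

Theorem theorem3p3 (f : Cx -> option Cx) (s : Cx -> R) :
  meromorphic_disk f ->
  (exists z, in_disk z /\ f z <> None) ->
  is_HS_norm f s ->
  finite_sph_area s ->
  forall theta : R,
    exists L : R -> R,
      (forall rho0, 0 < rho0 -> Rint (fun t => s (gamma theta t)) 0 rho0 (L rho0)) /\
      (forall eps, 0 < eps -> exists R0, forall rho0, R0 < rho0 ->
         Rabs (L rho0) <= eps * sqrt rho0).
Proof.
  intros Hf Hne Hs Harea theta.
  set (F := fun z : C => f (cexp z)). set (S := log_density s).
  assert (HS : forall z, fst z < 0 -> sph_deriv F S z).
  { intros z Hz. apply (sph_deriv_cexp f (fun z => s z / (1 - Cmod z ^ 2)) z).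
    apply HS_norm_sph_deriv; try assumption. rewrite Cmod_cexp. apply exp_lt_1, Hz. }
  assert (HSc : cont_left (fun x y => S (x, y)) 0).
  { intros u v Hu. apply continuous_continuity_2d, (sph_deriv_continuous F), HS, Hu. }
  assert (HS2 := cont_left_sqr _ _ HSc).
  assert (Hcont : forall t, continuous (fun t => s (gamma theta t)) t).
  { intros t. apply (continuous_comp (fun t : R => (gamma theta t : C)) s); [apply gamma_continuous|].
    assert (Hg := Cmod_gamma theta t).
    assert (A := sph_deriv_continuous _ _ _ (HS_norm_sph_deriv f s (gamma theta t) Hf Hne Hs Hg)).
    apply continuous_ext_loc with (g := fun z : C => s z / (1 - Cmod z ^ 2) * (1 - Cmod z ^ 2)).
    - assert (Hl : locally (gamma theta t : C) (fun w : C => Cmod (w - RtoC 0) < 1)).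
      { apply locally_ball_C. replace (gamma theta t - 0)%C with (gamma theta t : C) by (apply injective_projections; simpl; ring). exact Hg. }
      revert Hl. apply locally_C_imp. intros w Hw. replace (w - 0)%C with w in Hw by ring.
      assert (P := one_minus_sq_pos w Hw).
      match goal with |- @eq _ ?a ?b => change (@eq R a b) end. field. lra.
    - apply (@continuous_mult _ R_AbsRing (fun z : C => s z / (1 - Cmod z ^ 2)) (fun z : C => 1 - Cmod z ^ 2)); [exact A|].
      apply (continuous_comp (fun z : C => Cmod z) (fun x => 1 - x ^ 2)).
      + apply (continuous_Cmod (fun z : C => z)), continuous_Cid.
      + apply (@ex_derive_continuous R_AbsRing R_NormedModule). auto_derive. auto. }
  assert (Hex : forall a b, ex_RInt (fun t => s (gamma theta t)) a b).
  { intros a b. apply (@ex_RInt_continuous R_CompleteNormedModule). intros t _. apply Hcont. }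
  exists (fun rho0 => RInt (fun t => s (gamma theta t)) 0 rho0). split.
  { intros rho0 _. apply Rint_is_RInt. apply (@RInt_correct R_CompleteNormedModule), Hex. }
  destruct (circle_area_bound s S eq_refl Harea HS2) as [M HM].
  assert (Hac : forall x, x < 0 -> continuous (circle_area S) x).
  { intros x Hx. apply (inner_continuous (fun x y => S (x, y) ^ 2) 0); [exact HS2| |exact Hx].
    generalize PI_RGT_0. lra. }
  assert (Hae : forall x1 x2, x1 < 0 -> x2 < 0 -> ex_RInt (circle_area S) x1 x2).
  { intros x1 x2 H1 H2. apply (@ex_RInt_continuous R_CompleteNormedModule). intros x Hx. apply Hac.
    eapply Rle_lt_trans; [apply Hx|]. apply Rmax_lub_lt; assumption. }
  (* The area is counted from hyperbolic radius [1], since the centre of the disk lies at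
     [x = - oo]; only increments of [B] matter. *)
  set (x0 := log_radius 1). assert (Hx0 : x0 < 0) by (apply log_radius_neg; lra).
  set (B := fun t => RInt (circle_area S) x0 (log_radius t)).
  assert (HBd : forall t1 t2, 0 < t1 -> t1 <= t2 -> B t2 - B t1 = RInt (circle_area S) (log_radius t1) (log_radius t2)).
  { intros t1 t2 H1 H2. assert (N1 := log_radius_neg t1 H1). assert (N2 := log_radius_neg t2 ltac:(lra)).
    assert (Ch := RInt_Chasles (circle_area S) x0 (log_radius t1) (log_radius t2) (Hae _ _ Hx0 N1) (Hae _ _ N1 N2)).
    unfold plus in Ch; simpl in Ch. unfold B. lra. }
  assert (Hlr : forall t1 t2, 0 < t1 -> t1 <= t2 -> log_radius t1 <= log_radius t2).
  { intros t1 t2 H1 [H2|<-]; [|lra]. left. apply ln_increasing; [apply tanh_half_pos, H1|].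
    rewrite !tanh_half. assert (P1 := exp_pos (- t1)). assert (P2 := exp_pos (- t2)).
    assert (Lt : exp (- t2) < exp (- t1)) by (apply exp_increasing; lra).
    apply Rlt_div_l; [lra|]. unfold Rdiv. rewrite Rmult_assoc, (Rmult_comm (/ _)), <- Rmult_assoc.
    apply Rlt_div_r; [lra|]. nra. }
  assert (HBm : forall t1 t2, 0 < t1 -> t1 <= t2 -> B t1 <= B t2).
  { intros t1 t2 H1 H2. assert (D := HBd t1 t2 H1 H2).
    assert (N2 := log_radius_neg t2 ltac:(lra)). assert (Lr := Hlr t1 t2 H1 H2).
    assert (0 <= RInt (circle_area S) (log_radius t1) (log_radius t2)); [|lra].
    apply RInt_ge_0; [exact Lr|apply Hae; lra|]. intros x Hx.
    apply (inner_nonneg (fun x y => S (x, y) ^ 2) 0); [exact HS2| |lra|intros; apply pow2_ge_0].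
    generalize PI_RGT_0. lra. }
  assert (HBM : forall t, 1 <= t -> B t <= M).
  { intros t Ht. apply HM; [apply Hlr; lra|apply log_radius_neg; lra]. }
  assert (HBc : forall t, 0 < t -> continuous B t).
  { intros t Ht. apply (continuous_comp log_radius (fun x => RInt (circle_area S) x0 x)); [apply log_radius_continuous, Ht|].
    apply (@ex_derive_continuous R_AbsRing R_NormedModule). exists (circle_area S (log_radius t)).
    assert (N := log_radius_neg t Ht).
    apply (is_derive_RInt (V := R_NormedModule) (circle_area S) _ x0); [|apply Hac, N].
    exists (mkposreal (- log_radius t) ltac:(lra)). intros y Hy.
    change (Rabs (y - log_radius t) < - log_radius t) in Hy. apply Rabs_def2 in Hy.
    apply (@RInt_correct R_CompleteNormedModule), Hae; lra. }
  destruct (completeness (fun v => exists t, 1 <= t /\ v = B t)) as [Lam [L1 L2]].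
  { exists M. intros v [t [Ht ->]]. apply HBM, Ht. }
  { exists (B 1), 1. split; [lra|reflexivity]. }
  intros eps Heps.
  (* The first term makes [1048576 * (2 * del)] at most [eps ^ 2 / 4]; the second keeps the
     increments of [B] strictly below the threshold [1 / 65536]. *)
  set (del := Rmin (eps ^ 2 / 8388608) (1 / 131072)).
  assert (Hdel : 0 < del).
  { unfold del. apply Rmin_pos; [|lra]. apply Rdiv_lt_0_compat; [apply pow_lt, Heps|lra]. }
  assert (Hdel1 : del <= eps ^ 2 / 8388608) by apply Rmin_l.
  assert (Hdel2 : del <= 1 / 131072) by apply Rmin_r.
  assert (HT : exists T, 1 <= T /\ Lam - del < B T).
  { apply NNPP. intros Hn. assert (X : Lam <= Lam - del); [|lra]. apply L2.
    intros v [t [Ht ->]]. apply Rnot_lt_le. intros Hlt. apply Hn. exists t. split; assumption. }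
  (* One unit beyond [T0], because the estimate at [t] looks back to [t - 1]. *)
  destruct HT as [T0 [HT1 HT2]]. set (T := T0 + 1).
  assert (HBT : forall t, T - 1 <= t -> Lam - del <= B t <= Lam).
  { intros t Ht. unfold T in Ht. split.
    - left. eapply Rlt_le_trans; [exact HT2|]. apply HBm; lra.
    - apply L1. exists t. split; [lra|reflexivity]. }
  set (c := Rabs (RInt (fun t => s (gamma theta t)) 0 T)).
  assert (Hc : 0 <= c) by apply Rabs_pos.
  (* The last bound forces [c <= eps * sqrt rho / 2]: the ray up to [T] takes half of the
     allowance. *)
  exists (Rmax (Rmax T 1) ((2 * c / eps) ^ 2)). intros rho Hrho.
  assert (R1 := Rmax_l (Rmax T 1) ((2 * c / eps) ^ 2)). assert (R2 := Rmax_r (Rmax T 1) ((2 * c / eps) ^ 2)).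
  assert (R3 := Rmax_l T 1).
  assert (HrT : T < rho) by lra. assert (Hr0 : 0 < rho) by (unfold T in *; lra).
  assert (Hsq := sqrt_lt_R0 rho Hr0). set (w := sqrt rho) in *.
  assert (Hww : w * w = rho) by (apply sqrt_sqrt; lra).
  assert (Hcw : c <= eps * w / 2).
  { assert (X : 2 * c / eps <= w).
    { assert (Y : 0 <= 2 * c / eps) by (apply Rmult_le_pos; [lra|left; apply Rinv_0_lt_compat, Heps]).
      rewrite <- (sqrt_pow2 _ Y). apply sqrt_le_1_alt. lra. }
    apply Rle_div_l in X; [|exact Heps]. lra. }
  assert (Ch := RInt_Chasles (fun t => s (gamma theta t)) 0 T rho (Hex _ _) (Hex _ _)).
  unfold plus in Ch; simpl in Ch. rewrite <- Ch.
  eapply Rle_trans; [apply Rabs_triang|]. fold c.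
  assert (HTr : T <= rho) by lra.
  (* This choice balances the two terms of Cauchy-Schwarz: each is at most [eps * w / 4]. *)
  set (l := eps / (2 * w)). assert (Hl : 0 < l) by (apply Rdiv_lt_0_compat; lra).
  assert (Q := Rabs_RInt_le_sqr (fun t => s (gamma theta t)) T rho l HTr Hl (fun t _ => Hcont t)).
  cbv beta in Q.
  assert (HcB : cont_on (fun t => B (t + 1) - B (t - 1)) T rho).
  { intros t Ht. unfold T in Ht.
    assert (Sh : forall k, - (1) <= k -> continuous (fun t => B (t + k)) t).
    { intros k Hk. apply (continuous_comp (fun t => t + k) B); [|apply HBc; lra].
      apply (@continuous_plus _ R_AbsRing R_NormedModule (fun t => t) (fun _ => k)); [apply continuous_id|apply continuous_const]. }
    apply (@continuous_minus _ R_AbsRing R_NormedModule (fun t => B (t + 1)) (fun t => B (t - 1))).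
    - apply Sh. lra.
    - apply (Sh (- (1))). lra. }
  assert (I : RInt (fun t => s (gamma theta t) ^ 2) T rho <= 1048576 * (2 * del)).
  { apply Rle_trans with (RInt (fun t => 1048576 * (B (t + 1) - B (t - 1))) T rho).
    - apply RInt_le; [exact HTr| | |].
      + apply (@ex_RInt_continuous R_CompleteNormedModule). intros t _.
        apply (continuous_comp (fun t => s (gamma theta t)) (fun x => x ^ 2)); [apply Hcont|].
        apply (@ex_derive_continuous R_AbsRing R_NormedModule). auto_derive. auto.
      + apply (@ex_RInt_scal R_NormedModule). apply ex_RInt_cont_on; assumption.
      + intros t Ht. apply (HS_norm_bound F s S B theta t); [unfold T in Ht; lra|reflexivity|exact HS|exact HBd|].
        assert (X1 := HBT (t + 1) ltac:(lra)). assert (X2 := HBT (t - 1) ltac:(lra)). lra.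
    - assert (Sc : RInt (fun t => 1048576 * (B (t + 1) - B (t - 1))) T rho = 1048576 * RInt (fun t => B (t + 1) - B (t - 1)) T rho).
      { apply (@RInt_scal R_CompleteNormedModule). apply ex_RInt_cont_on; assumption. }
      rewrite Sc. apply Rmult_le_compat_l; [lra|].
      apply (RInt_increment_shift B T rho Lam del); [unfold T; lra|exact HTr|exact HBc|exact HBT]. }
  assert (Q1 : l / 2 * (rho - T) <= eps * w / 4).
  { apply Rle_trans with (l / 2 * rho); [apply Rmult_le_compat_l; unfold T; lra|].
    right. unfold l. rewrite <- Hww. field. lra. }
  assert (Q2 : / (2 * l) * RInt (fun t => s (gamma theta t) ^ 2) T rho <= eps * w / 4).
  { apply Rle_trans with (/ (2 * l) * (1048576 * (2 * (eps ^ 2 / 8388608)))).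
    - apply Rmult_le_compat_l; [left; apply Rinv_0_lt_compat; lra|]. lra.
    - right. unfold l. field. split; lra. }
  lra.
Qed.
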